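(* Let $X$ be an infinite discrete space, and let $G$ be a subgroup of the permutation group $({\rm S}(X),\tau_p)$ whose action on $X$ is ultratransitive. Then $b_rG=e_{\alpha X}G=e_{\rm B}G$. The Roelcke compactification $b_rG$ of $G$ is the closure of $G$ in $b_r{\rm U}(\ell^2(X))={\rm WAP}\,{\rm U}(\ell^2(X))$, and it is a sim-compactification and the WAP-compactification of $G$. $G$ is a WAP group.
   Context: $\tau_p$ is the topology of pointwise convergence (permutation topology), with subbase $\{g\mid g(x)=y\}$, $x,y\in X$. The action of $G$ on $X$ is ultratransitive if for every $n$ and all pairwise distinct $x_1,\dots,x_n$ and pairwise distinct $y_1,\dots,y_n$ in $X$ there is $g\in G$ with $g(x_i)=y_i$, $i=1,\dots,n$. $\alpha X=X\cup\{\infty\}$ is the one-point compactification, $G$ fixing $\infty$. $\ell^2(X)$ is the Hilbert space with orthonormal basis $(e_x)_{x\in X}$, ${\rm U}(\ell^2(X))$ its unitary group in the strong operator topology; $G$ is embedded in ${\rm U}(\ell^2(X))$ by $g(e_x)=e_{gx}$ (a topological embedding). ${\rm B}$ is the closed unit ball of $\ell^2(X)$ in the weak topology. For a compact $G$-space $Z\in\{\alpha X,{\rm B}\}$, $e_ZG$ is the closure of $\{z\mapsto gz\mid g\in G\}$ in $Z^Z$ (product topology), a compactification of $G$ (Ellis compactification). $b_rG$ is the Roelcke compactification: the Samuel compactification of $G$ with respect to the uniformity with base of covers $\{OgO\mid g\in G\}$, $O$ a neighbourhood of $e$. $b_r{\rm U}(\ell^2(X))$ is the space of linear operators of norm $\le1$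 in the weak operator topology, which is also the WAP-compactification of ${\rm U}(\ell^2(X))$ (known). The WAP-compactification ${\rm WAP}\,G$ is the maximal (universal) semitopological semigroup compactification of $G$. An sm-compactification of $G$ is a proper compactification to which left translations extend to a continuous $G$-action and which carries a separately continuous monoid multiplication extending that of $G$; a sim-compactification is an sm-compactification which is a semitopological inverse monoid with continuous inversion extending that of $G$. $G$ is a WAP group if its WAP-compactification coincides with its Roelcke compactification. Equality of compactifications means existence of a homeomorphism commuting with the embeddings of $G$. *)

(* Defs.v *)
From HB Require Import structures.
From mathcomp Require Import all_boot all_order all_algebra.
From mathcomp Require Import complex ring lra.
From mathcomp Require Import all_classical all_reals all_analysis.
Import numFieldNormedType.Exports.

Set Implicit Arguments.
Unset Strict Implicit.
Unset Printing Implicit Defensive.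

Import Order.TTheory GRing.Theory Num.Theory.
Import Normc.

Local Open Scope classical_set_scope.
Local Open Scope ring_scope.

Section l2_predicate.
Variables (R : realType) (T : choiceType).
Implicit Types (f g : T -> R[i]).

Definition l2sq f : \bar R := \esum_(x in [set: T]) (normc (f x) ^+ 2)%:E.

Definition l2pred : {pred T -> R[i]} := fun f => (l2sq f < +oo)%E.

Let sq_ge0 f x : (0 <= (normc (f x) ^+ 2)%:E)%E.
Proof. by rewrite lee_fin sqr_ge0. Qed.

Lemma l2sq_ge0 f : (0 <= l2sq f)%E.
Proof. by apply: esum_ge0. Qed.

Lemma esumZ (c : R) (u : T -> R) : 0 <= c -> (forall x, 0 <= u x) ->
  (\esum_(x in [set: T]) (c * u x)%:E <= c%:E * \esum_(x in [set: T]) (u x)%:E)%E.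
Proof.
move=> c0 u0; apply: ge_ereal_sup => _ /= [A [finA _] <-].
under eq_fsbigr do rewrite EFinM.
rewrite -ge0_mule_fsumr; last by move=> x; rewrite lee_fin.
rewrite lee_wpmul2l ?lee_fin//; apply: ereal_sup_ubound.
by exists A.
Qed.

Lemma l2sqZ (c : R[i]) f : (l2sq (c *: f) <= (normc c ^+ 2)%:E * l2sq f)%E.
Proof.
apply: le_trans (esumZ _ _) => //; last by move=> x; exact: sqr_ge0.
  apply: le_esum => x _; rewrite lee_fin /=.
  by rewrite (normcM c (f x)) exprMn.
exact: sqr_ge0.
Qed.

Lemma l2sqD_weighted (t : R) f g : 0 < t < 1 ->
  (l2sq (f + g)%R <= t^-1%:E * l2sq f + (1 - t)^-1%:E * l2sq g)%E.
Proof.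
move=> /andP[t0 t1].
have t2 : 0 < 1 - t by rewrite subr_gt0.
have u0 : 0 <= t^-1 by rewrite invr_ge0 ltW.
have v0 : 0 <= (1 - t)^-1 by rewrite invr_ge0 ltW.
apply: le_trans (leeD (esumZ u0 _) (esumZ v0 _)); do ?[by move=> x; exact: sqr_ge0].
rewrite -esumD; do ?[by move=> x _; rewrite lee_fin mulr_ge0 ?sqr_ge0].
apply: le_esum => x _; rewrite -EFinD lee_fin.
set a := normc (f x); set b := normc (g x).
have a0 : 0 <= a by rewrite -ler0c /a -[_%:C%C]/(`|f x|).
have b0 : 0 <= b by rewrite -ler0c /b -[_%:C%C]/(`|g x|).
have nab : normc (f x + g x) <= a + b by exact: (@le_normcD R (f x) (g x)).
have n0 : 0 <= normc (f x + g x) by rewrite -ler0c -[_%:C%C]/(`|f x + g x|).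
apply: (@le_trans _ _ ((a + b) ^+ 2)).
  by rewrite ler_sqr ?nnegrE ?addr_ge0.
rewrite -subr_ge0.
have -> : t^-1 * a ^+ 2 + (1 - t)^-1 * b ^+ 2 - (a + b) ^+ 2 =
    t^-1 * (1 - t)^-1 * ((1 - t) * a - t * b) ^+ 2.
  by field; rewrite !gt_eqF.
by rewrite mulr_ge0 ?sqr_ge0// mulr_ge0.
Qed.

End l2_predicate.

Section l2_type.
Variables (R : realType) (T : choiceType).

Lemma l2pred_submod : GRing.submod_closed (@l2pred R T).
Proof.
split=> [|c f g]; rewrite /in_mem /= /l2pred.
  rewrite /l2sq esum1 ?ltry// => x _.
  by have -> : normc ((0 : T -> R[i]) x) = 0 by [exact: normc0]; rewrite expr0n.
have half01 : 0 < (2^-1 : R) < 1 by apply/andP; split; lra.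
move=> lf lg; apply: le_lt_trans (l2sqD_weighted (c *: f) g half01) _.
have fin (u : R) (h : T -> R[i]) : (l2sq h < +oo)%E -> (u%:E * l2sq h < +oo)%E.
  move=> lh; have : l2sq h \is a fin_num by rewrite ge0_fin_numE ?l2sq_ge0.
  by move=> /fineK <-; rewrite -EFinM ltry.
rewrite lte_add_pinfty ?fin//.
by apply: le_lt_trans (l2sqZ _ _) _; exact: fin.
Qed.

Record l2 := L2 { l2fun :> T -> R[i]; l2funP : l2fun \in @l2pred R T }.

HB.instance Definition _ := [isSub for l2fun].
HB.instance Definition _ := [Choice of l2 by <:].
HB.instance Definition _ :=
  GRing.SubChoice_isSubLmodule.Build R[i] _ (@l2pred R T) l2 l2pred_submod.

Definition l2norm (f : l2) : R := Num.sqrt (fine (l2sq f)).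

Lemma l2sqE (f : l2) : l2sq f = (l2norm f ^+ 2)%:E.
Proof.
rewrite sqr_sqrtr ?fine_ge0 ?l2sq_ge0// fineK//.
by rewrite ge0_fin_numE ?l2sq_ge0//; exact: (l2funP f).
Qed.

Lemma l2norm_ge0 (f : l2) : 0 <= l2norm f.
Proof. exact: sqrtr_ge0. Qed.

Lemma l2norm_eq0 (f : l2) : l2norm f = 0 -> f = 0.
Proof.
move=> f0; apply: val_inj; apply/funext => x /=.
apply: eq0_normc; apply/eqP; rewrite -sqrf_eq0 eq_le sqr_ge0 andbT -lee_fin.
have <- : l2sq f = 0%:E by rewrite l2sqE f0 expr0n.
apply: ereal_sup_ubound; exists [set x]; first by split.
by rewrite fsbig_set1.
Qed.

Lemma l2normD (f g : l2) : l2norm (f + g) <= l2norm f + l2norm g.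
Proof.
set a := l2norm f; set b := l2norm g.
have [a0|a0] := eqVneq a 0.
  by rewrite (l2norm_eq0 a0) add0r a0 add0r.
have [b0|b0] := eqVneq b 0.
  by rewrite (l2norm_eq0 b0) addr0 b0 addr0.
have {}a0 : 0 < a by rewrite lt_neqAle eq_sym a0 l2norm_ge0.
have {}b0 : 0 < b by rewrite lt_neqAle eq_sym b0 l2norm_ge0.
rewrite -ler_sqr ?nnegrE ?addr_ge0 ?l2norm_ge0//.
have t01 : 0 < a / (a + b) < 1.
  by rewrite divr_gt0 ?addr_gt0//= ltr_pdivrMr ?addr_gt0// mul1r ltrDl.
have := l2sqD_weighted f g t01.
rewrite -[(l2fun f + l2fun g)%R]/(l2fun (f + g)) !l2sqE -!EFinM -EFinD lee_fin.
move=> /le_trans; apply; rewrite -/a -/b le_eqVlt; apply/orP; left; apply/eqP.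
have ab : a + b != 0 by rewrite gt_eqF ?addr_gt0.
have -> : 1 - a / (a + b) = b / (a + b) by field.
by field; rewrite ab !gt_eqF.
Qed.

Lemma le_l2normZ (c : R[i]) (f : l2) : l2norm (c *: f) <= normc c * l2norm f.
Proof.
have c0 : 0 <= normc c by rewrite -ler0c -[_%:C%C]/(`|c|).
rewrite -ler_sqr ?nnegrE ?l2norm_ge0 ?mulr_ge0 ?l2norm_ge0//.
by rewrite -lee_fin -l2sqE exprMn EFinM -l2sqE; exact: l2sqZ.
Qed.

Lemma l2normZ (c : R[i]) (f : l2) : l2norm (c *: f) = normc c * l2norm f.
Proof.
apply/eqP; rewrite eq_le le_l2normZ/=.
have [->|c0] := eqVneq c 0; first by rewrite normc0 mul0r l2norm_ge0.
have nc0 : 0 < normc c.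
  rewrite lt_neqAle -ler0c -[X in _ && (_ <= X)]/(`|c|) normr_ge0 andbT eq_sym.
  by apply: contra c0 => /eqP/eq0_normc ->.
rewrite mulrC -ler_pdivlMr// mulrC -normcV.
by apply: le_trans (le_l2normZ _ _); rewrite scalerA mulVf// scale1r.
Qed.

Let norm (f : l2) : R[i] := (l2norm f)%:C%C.

Let normD f g : norm (f + g) <= norm f + norm g.
Proof. by rewrite /norm -raddfD/= lecR l2normD. Qed.

Let normZ c f : norm (c *: f) = `|c| * norm f.
Proof. by rewrite /norm l2normZ rmorphM; congr (_ * _); case: c. Qed.

Let norm_eq0 f : norm f = 0 -> f = 0.
Proof. by move=> /complexI/l2norm_eq0. Qed.

HB.instance Definition _ :=
  Lmodule_isNormed.Build R[i] l2 normD normZ norm_eq0.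

End l2_type.
Arguments l2 : clear implicits.

Section inner_product.
Variables (R : realType) (T : choiceType).

(* Unconditional sum of an absolutely summable family; [fine] makes it total. *)
Definition rsum (u : T -> R) : R :=
  fine (\esum_(x in [set: T]) ((EFin \o u)^\+ x))%E -
  fine (\esum_(x in [set: T]) ((EFin \o u)^\- x))%E.

Definition csum (u : T -> R[i]) : R[i] :=
  Complex (rsum (fun x => complex.Re (u x))) (rsum (fun x => complex.Im (u x))).

Definition inner (f g : l2 R T) : R[i] := csum (fun x => f x * (g x)^*%C).

End inner_product.

(* A group with a topology: no compatibility axiom is bundled, because none of
   the definitions below needs one. *)
#[short(type="groupTopologicalType")]
HB.structure Definition GroupTopological := {G of Group G & Topological G}.

(* Only the data of a compactification; the axioms are [is_compactification]. *)
Record gcompactification (G : topologicalType) := GCompactification {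
  cspace :> topologicalType;
  cmap : G -> cspace }.

Section compactifications.
Variable G : topologicalType.
Implicit Types c d : gcompactification G.

Definition is_compactification c :=
  [/\ compact [set: c], hausdorff_space c, continuous (@cmap G c) &
      dense (range (@cmap G c))].

Definition is_embedding (K : topologicalType) (j : G -> K) :=
  injective j /\
  forall A : set G, open A <-> exists2 V : set K, open V & j @^-1` V = A.

Definition compactification_eq c d :=
  exists (h : c -> d) (k : d -> c),
    [/\ cancel h k, cancel k h, continuous h, continuous k &
        forall g, h (cmap c g) = cmap d g].

Lemma closure_range_proof (K : topologicalType) (j : G -> K) (g : G) :
  j g \in closure (range j).
Proof. by apply/mem_set/subset_closure; exists g. Qed.

Definition closure_comp (K : topologicalType) (j : G -> K) :
    gcompactification G :=
  @GCompactification G (set_type (closure (range j)))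
    (fun g => exist _ (j g) (closure_range_proof j g)).

(* Closure of {z |-> g z | g in G} in Z^Z with the product topology. *)
Definition ellis (Z : topologicalType) (act : G -> Z -> Z) :
    gcompactification G :=
  @closure_comp {ptws Z -> Z} act.

(* [E] stands for a (base of) entourages of a uniformity on [G]; it need not
   generate the given topology. *)
Definition bounded_ucont (R : realType) (E : set_system (G * G)) : set (G -> R) :=
  [set f | (exists M, forall x, `|f x| <= M) /\
           (fun p => (f p.1, f p.2)) @ E --> entourage].

(* Closure of the image of [G] in the product of copies of [R] indexed by the
   bounded uniformly continuous real functions, under evaluation. *)
Definition samuel (R : realType) (E : set_system (G * G)) :
    gcompactification G :=
  @closure_comp {ptws (set_type (@bounded_ucont R E)) -> R}
    (fun x f => set_val f x).

End compactifications.

Section topological_groups.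
Variable G : groupTopologicalType.
Implicit Types c d : gcompactification G.
Local Open Scope group_scope.

Definition double_translate (O : set G) (g : G) : set G :=
  [set a * g * b | a in O & b in O].

(* Entourages of the uniformity with base of covers {O g O | g in G}: a cover
   [c] yields the entourage made of the pairs lying in a common member of [c]. *)
Definition roelcke_entourage : set_system (G * G) :=
  filter_from (nbhs (1 : G))
    (fun O => \bigcup_g (double_translate O g `*` double_translate O g)).

Definition roelcke (R : realType) : gcompactification G :=
  samuel R roelcke_entourage.

Definition separately_continuous (K : topologicalType) (m : K -> K -> K) :=
  forall s, continuous (m s) /\ continuous (m^~ s).

Definition semitop_semigroup_comp c (m : c -> c -> c) :=
  [/\ is_compactification c, associative m, separately_continuous m &
      {morph @cmap G c : g h / g * h >-> m g h}].

(* Universal among the semitopological semigroup compactifications of [G], which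
   need not be proper. *)
Definition is_WAP_comp c := exists m : c -> c -> c,
  semitop_semigroup_comp m /\
  forall d (m' : d -> d -> d), semitop_semigroup_comp m' ->
    exists phi : c -> d, [/\ continuous phi, {morph phi : s t / m s t >-> m' s t} &
      forall g, phi (cmap c g) = cmap d g].

Definition WAP_group (R : realType) :=
  exists2 c, is_WAP_comp c & compactification_eq c (roelcke R).

Definition left_translations_extend c := exists act : G -> c -> c,
  [/\ forall s, act 1 s = s,
      forall g h s, act (g * h) s = act g (act h s),
      continuous (fun p : G * c => act p.1 p.2) &
      forall g h, act g (cmap c h) = cmap c (g * h)].

Definition sm_comp c (m : c -> c -> c) :=
  [/\ semitop_semigroup_comp m,
      left_id (cmap c 1) m /\ right_id (cmap c 1) m,
      is_embedding (@cmap G c) & left_translations_extend c].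

Definition is_sim_comp c := exists (m : c -> c -> c) (inv : c -> c),
  [/\ sm_comp m,
      forall s, m (m s (inv s)) s = s /\ m (m (inv s) s) (inv s) = inv s,
      forall s t, m (m s t) s = s -> m (m t s) t = t -> t = inv s,
      continuous inv &
      forall g, inv (cmap c g) = cmap c g^-1].

End topological_groups.

Section subgroup.
Variables (S : groupTopologicalType) (G : groupClosed S).

Definition subgroup : Type := {g : S | g \in G}.

HB.instance Definition _ := [isSub of subgroup for @proj1_sig _ _].
HB.instance Definition _ := [Choice of subgroup by <:].

Lemma subgroup_closed : group_closed (fun g : S => g \in G).
Proof. by split=> [|g h]; [exact: gpred1 | exact: gpredF]. Qed.

HB.instance Definition _ :=
  SubChoice_isSubGroup.Build S _ subgroup subgroup_closed.
HB.instance Definition _ :=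
  Topological.copy subgroup (initial_topology (fun g : subgroup => val g)).

End subgroup.

Section bijection_inverse.
Variables (A B : Type) (f : A -> B).
Hypothesis fb : bijective f.

Lemma bij_inv_exists : exists g, cancel f g /\ cancel g f.
Proof. by case: fb => g fK gK; exists g. Qed.

Definition bij_inv : B -> A := sval (cid bij_inv_exists).

Lemma bij_invK : cancel f bij_inv.
Proof. exact: (svalP (cid bij_inv_exists)).1. Qed.

Lemma bij_invKV : cancel bij_inv f.
Proof. exact: (svalP (cid bij_inv_exists)).2. Qed.

Lemma bij_inv_bij : bijective bij_inv.
Proof. by exists f; [exact: bij_invKV | exact: bij_invK]. Qed.

End bijection_inverse.

Section permutation_group.
Variable X : discreteTopologicalType.

(* Pointwise convergence: [X] is discrete, so the sets {g | g x = y} form a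
   subbase. *)
Definition perm_group : Type :=
  set_type [set g : {ptws X -> X} | bijective g].

HB.instance Definition _ := SubChoice.on perm_group.
HB.instance Definition _ := Topological.on perm_group.

Definition perm_fun (g : perm_group) : X -> X := val g.

Lemma perm_fun_bij g : bijective (perm_fun g).
Proof. exact: (set_valP g). Qed.

Definition mk_perm (f : X -> X) (fb : bijective f) : perm_group :=
  exist _ (f : {ptws X -> X}) (mem_set fb).

Lemma perm_fun_inj : injective perm_fun.
Proof. by move=> g h gh; exact: val_inj. Qed.

Let id_bij : bijective (@id X).
Proof. by exists id. Qed.

Definition perm_one := mk_perm id_bij.
Definition perm_mul (g h : perm_group) :=
  mk_perm (bij_comp (perm_fun_bij g) (perm_fun_bij h)).
Definition perm_inv (g : perm_group) := mk_perm (bij_inv_bij (perm_fun_bij g)).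

Let perm_mulA : associative perm_mul.
Proof. by move=> f g h; exact: perm_fun_inj. Qed.

Let perm_mul1g : left_id perm_one perm_mul.
Proof. by move=> f; exact: perm_fun_inj. Qed.

Let perm_mulg1 : right_id perm_one perm_mul.
Proof. by move=> f; exact: perm_fun_inj. Qed.

Let perm_mulVg : left_inverse perm_one perm_inv perm_mul.
Proof.
by move=> f; apply: perm_fun_inj; apply/funext => x; exact: bij_invK.
Qed.

Let perm_mulgV : right_inverse perm_one perm_inv perm_mul.
Proof.
by move=> f; apply: perm_fun_inj; apply/funext => x; exact: bij_invKV.
Qed.

HB.instance Definition _ := isGroup.Build perm_group
  perm_mulA perm_mul1g perm_mulg1 perm_mulVg perm_mulgV.

Definition ultratransitive (G : {pred perm_group}) :=
  forall n (x y : 'I_n -> X), injective x -> injective y ->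
    exists2 g, g \in G & forall i, perm_fun g (x i) = y i.

(* The library encodes the one-point compactification as [option X], with [None]
   the point at infinity. *)
Definition alpha_act (g : perm_group) :
    one_point_compactification X -> one_point_compactification X :=
  omap (perm_fun g).

End permutation_group.

Section unitary_group.
Variables (R : realType) (X : choiceType).
Local Notation H := (l2 R X).

Definition unitary (u : H -> H) :=
  [/\ linear u, forall f g, inner (u f) (u g) = inner f g & bijective u].

(* Pointwise convergence for the norm of [H] is the strong operator topology. *)
Definition unitary_group : Type :=
  set_type [set u : {ptws H -> H} | unitary u].

HB.instance Definition _ := SubChoice.on unitary_group.
HB.instance Definition _ := Topological.on unitary_group.

Definition unitary_fun (u : unitary_group) : H -> H := val u.

Lemma unitary_funP u : unitary (unitary_fun u).
Proof. exact: (set_valP u). Qed.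

Definition mk_unitary (u : H -> H) (uU : unitary u) : unitary_group :=
  exist _ (u : {ptws H -> H}) (mem_set uU).

Lemma unitary_fun_inj : injective unitary_fun.
Proof. by move=> u v uv; exact: val_inj. Qed.

Lemma unitary_id : unitary id.
Proof. by split=> //; exists id. Qed.

Lemma unitary_comp u v : unitary u -> unitary v -> unitary (u \o v).
Proof.
move=> [ul ui ub] [vl vi vb]; split; last exact: bij_comp.
  by move=> c f g /=; rewrite vl ul.
by move=> f g /=; rewrite ui vi.
Qed.

Lemma unitary_inv u (uU : unitary u) (ub : bijective u) : unitary (bij_inv ub).
Proof.
case: uU => ul ui _; split; last exact: bij_inv_bij.
  move=> c f g; apply: (bij_inj ub).
  by rewrite ul !bij_invKV.
by move=> f g; rewrite -ui !bij_invKV.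
Qed.

Lemma unitary_bij u : bijective (unitary_fun u).
Proof. by case: (unitary_funP u). Qed.

Definition unitary_one := mk_unitary unitary_id.
Definition unitary_mul (u v : unitary_group) :=
  mk_unitary (unitary_comp (unitary_funP u) (unitary_funP v)).
Definition unitary_inverse (u : unitary_group) :=
  mk_unitary (unitary_inv (unitary_funP u) (unitary_bij u)).

Let unitary_mulA : associative unitary_mul.
Proof. by move=> f g h; exact: unitary_fun_inj. Qed.

Let unitary_mul1g : left_id unitary_one unitary_mul.
Proof. by move=> f; exact: unitary_fun_inj. Qed.

Let unitary_mulg1 : right_id unitary_one unitary_mul.
Proof. by move=> f; exact: unitary_fun_inj. Qed.

Let unitary_mulVg : left_inverse unitary_one unitary_inverse unitary_mul.
Proof.
by move=> f; apply: unitary_fun_inj; apply/funext => x; exact: bij_invK.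
Qed.

Let unitary_mulgV : right_inverse unitary_one unitary_inverse unitary_mul.
Proof.
by move=> f; apply: unitary_fun_inj; apply/funext => x; exact: bij_invKV.
Qed.

HB.instance Definition _ := isGroup.Build unitary_group
  unitary_mulA unitary_mul1g unitary_mulg1 unitary_mulVg unitary_mulgV.

End unitary_group.

Section weak_topologies.
Variables (R : realType) (X : choiceType).
Local Notation H := (l2 R X).

Definition l2_weak : Type :=
  initial_topology (fun f : H => inner f : {ptws H -> R[i]^o}).
HB.instance Definition _ := Topological.on l2_weak.

Definition unit_ball : Type :=
  set_type [set f : l2_weak | `|f : H| <= 1].
HB.instance Definition _ := Topological.on unit_ball.

(* Linear operators of norm at most 1. *)
Definition contraction (T : H -> H) := linear T /\ forall f, `|T f| <= `|f|.

(* Pointwise weak convergence is the weak operator topology. *)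
Definition contractions : Type :=
  set_type [set T : {ptws H -> l2_weak} | contraction T].
HB.instance Definition _ := Topological.on contractions.

End weak_topologies.

Section permutation_operators.
Variables (R : realType) (X : discreteTopologicalType).
Local Notation H := (l2 R X).
Implicit Types g h : perm_group X.

Lemma bij_setT (e : X -> X) : bijective e -> set_bij [set: X] [set: X] e.
Proof.
move=> [e' eK e'K]; split=> //.
- by move=> x y _ _ /(can_inj eK).
- by move=> y _; exists (e' y).
Qed.

Lemma esum_bij (e : X -> X) (a : X -> \bar R) : bijective e ->
  \esum_(x in [set: X]) a (e x) = \esum_(x in [set: X]) a x.
Proof. by move=> /bij_setT eb; rewrite -(reindex_esum _ _ _ _ eb). Qed.

Lemma rsum_bij (e : X -> X) (u : X -> R) : bijective e ->
  rsum (u \o e) = rsum u.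
Proof.
move=> eb; rewrite /rsum; congr (fine _ - fine _).
  rewrite -[RHS](esum_bij (EFin \o u)^\+%E eb).
  by apply: eq_esum => x _; rewrite !funeposE.
rewrite -[RHS](esum_bij (EFin \o u)^\-%E eb).
by apply: eq_esum => x _; rewrite !funenegE.
Qed.

Lemma csum_bij (u : X -> R[i]) (e : X -> X) : bijective e ->
  csum (u \o e) = csum u.
Proof.
move=> eb; rewrite /csum; congr (Complex _ _).
  exact: (rsum_bij (fun x => complex.Re (u x)) eb).
exact: (rsum_bij (fun x => complex.Im (u x)) eb).
Qed.

Lemma l2sq_bij (e : X -> X) (f : X -> R[i]) : bijective e ->
  l2sq (f \o e) = l2sq f.
Proof. exact: (esum_bij (fun x => (normc (f x) ^+ 2)%:E)). Qed.

Lemma l2_perm_subproof g (f : H) :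
  (fun x => f (perm_fun g^-1%g x)) \in @l2pred R X.
Proof.
rewrite /in_mem/= /l2pred (l2sq_bij f (perm_fun_bij g^-1%g)).
exact: (l2funP f).
Qed.

(* This is the operator e_x |-> e_(g x); see [l2_perm_basis]. *)
Definition l2_perm g (f : H) : H := L2 (l2_perm_subproof g f).

Lemma l2_basis_subproof (x : X) :
  (fun y => (y == x)%:R : R[i]) \in @l2pred R X.
Proof.
rewrite /in_mem/= /l2pred /l2sq (esumID [set x])//.
  rewrite setTI esum_set1 ?lee_fin ?sqr_ge0// esum1 ?adde0 ?ltry// => y [_ /eqP yx].
  by rewrite (negbTE yx) normc0 expr0n.
by move=> y _; rewrite lee_fin sqr_ge0.
Qed.

Definition l2_basis (x : X) : H := L2 (l2_basis_subproof x).

Lemma l2_perm_basis g x : l2_perm g (l2_basis x) = l2_basis (perm_fun g x).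
Proof.
apply: val_inj; apply/funext => y /=.
suff -> : (perm_fun g^-1%g y == x) = (y == perm_fun g x) by [].
apply/eqP/eqP => [<-|->]; last exact: bij_invK.
by apply/esym; exact: (bij_invKV (perm_fun_bij g)).
Qed.

Lemma l2_perm_unitary g : unitary (l2_perm g).
Proof.
have inv_bij := perm_fun_bij g^-1%g.
split.
- by move=> c f h; exact: val_inj.
- move=> f h; exact: (csum_bij (fun x => f x * (h x)^*%C) inv_bij).
- exists (l2_perm g^-1%g) => f; apply: val_inj; apply/funext => x /=.
    by congr (l2fun f _); rewrite invgK; exact: bij_invK.
  by congr (l2fun f _); rewrite invgK; exact: bij_invKV.
Qed.

Definition perm_unitary g : unitary_group R X := mk_unitary (l2_perm_unitary g).

Lemma l2_perm_norm g (f : H) : `|l2_perm g f| = `|f|.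
Proof.
by congr (Complex (Num.sqrt (fine _)) 0); exact: (l2sq_bij f (perm_fun_bij g^-1%g)).
Qed.

Lemma ball_act_subproof g (f : unit_ball R X) :
  (l2_perm g (val f) : l2_weak R X) \in
    [set f : l2_weak R X | `|f : H| <= 1].
Proof. by apply: mem_set; rewrite /= l2_perm_norm; exact: (set_valP f). Qed.

Definition ball_act g (f : unit_ball R X) : unit_ball R X :=
  exist _ (l2_perm g (val f) : l2_weak R X) (ball_act_subproof g f).

End permutation_operators.

Section contraction_of_unitary.
Variables (R : realType) (X : choiceType).
Local Notation H := (l2 R X).

Lemma inner_self (f : H) : inner f f = `|f| ^+ 2.
Proof.
have sqE x : f x * (f x)^*%C = ((normc (f x)) ^+ 2)%:C%C.
  by rewrite rmorphXn/= -[(normc _)%:C%C]/(`|f x|) sqr_normc.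
have rsum_ge0 (u : X -> R) : (forall x, 0 <= u x) ->
    rsum u = fine (\esum_(x in [set: X]) (u x)%:E).
  move=> u0; rewrite /rsum.
  have -> : (\esum_(x in [set: X]) (EFin \o u)^\- x = 0)%E.
    by apply: esum1 => x _; rewrite funenegE max_r//= lee_fin oppr_le0.
  rewrite subr0; congr fine; apply: eq_esum => x _.
  by rewrite funeposE max_l//= lee_fin.
have rsum_sq : rsum (fun x => normc (f x) ^+ 2) = l2norm f ^+ 2.
  rewrite rsum_ge0; last by move=> x; exact: sqr_ge0.
  by rewrite -[LHS]/(fine (l2sq f)) l2sqE.
have rsum0 : rsum (fun _ : X => 0 : R) = 0.
  by rewrite rsum_ge0// esum1.
have -> : inner f f = csum (fun x => (normc (f x) ^+ 2)%:C%C).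
  by rewrite /inner; congr csum; apply/funext => x; exact: sqE.
by rewrite /csum/= rsum_sq rsum0 -[`|f|]/((l2norm f)%:C%C) -rmorphXn.
Qed.

Lemma unitary_norm (u : H -> H) f : unitary u -> `|u f| = `|f|.
Proof.
move=> [_ ui _]; apply/eqP; rewrite -(@eqrXn2 _ 2)//.
by rewrite -!inner_self ui.
Qed.

Lemma unitary_contraction (u : unitary_group R X) :
  contraction (unitary_fun u).
Proof.
split; first by case: (unitary_funP u).
by move=> f; rewrite (unitary_norm f (unitary_funP u)).
Qed.

Definition contraction_of_unitary (u : unitary_group R X) : contractions R X :=
  exist _ (unitary_fun u : {ptws H -> l2_weak R X})
    (mem_set (unitary_contraction u)).

Definition contraction_comp : gcompactification (unitary_group R X) :=
  GCompactification contraction_of_unitary.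

End contraction_of_unitary.

(* Main.v *)
(** Each of the spaces in the statement is compared with the Roelcke (Samuel)
    compactification through one criterion: a compact space [c] containing the
    group densely is the Roelcke compactification when point-separating
    continuous functions on [c] restrict to Roelcke uniformly continuous ones
    and every point of [c] has neighbourhoods whose trace on the group lies in a
    single [O g O].

    For the unitary group the second condition says that [u] and [v] with almost
    the same finite matrix satisfy [v \in O u O]. The Gram matrix of the vectors
    [f_i] and [u f_i] depends only on the matrix of [u], and in an infinite
    dimensional Hilbert space two finite families with almost equal Gram matrices
    are almost exchanged by a unitary operator. The same fact, applied to a
    unitary dilation of a contraction, gives the density of the unitary group.
    For an ultratransitive group the analogue is exact: a finite partial
    bijection extends to an element of the group. Hence the compactification is
    the inverse monoid of partial bijections of [X], seen as 0-1 matrices.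

    Universality among semitopological semigroup compactifications holds because
    their continuous functions are Roelcke uniformly continuous: a separately
    continuous function on a product of compact spaces has, on some nonempty open
    set of one variable, oscillation at most [eps] uniformly in the other
    variable, and translations carry this open set to a neighbourhood of 1. *)

Require Import Defs.
From mathcomp Require Import all_boot all_order all_algebra.
From mathcomp Require Import complex ring lra.
From mathcomp Require finmap.
From mathcomp Require Import all_classical all_reals all_analysis.
Import numFieldNormedType.Exports.

Set Implicit Arguments.
Unset Strict Implicit.
Unset Printing Implicit Defensive.

Import Order.TTheory GRing.Theory Num.Theory.
Import Normc.

Local Open Scope classical_set_scope.
Local Open Scope ring_scope.

(** * Extension of functions and the Roelcke compactification *)

(** [bU] is a Samuel compactification by definition, so the contractions enter only through a
    homeomorphism that has to be proved. The obstacle there is that a contraction [T] may shorten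
    vectors while every unitary operator near it in the weak operator topology preserves norms: the
    inner products of the [T (f i)] among themselves say nothing about those of nearby [u (f i)].
    Only the mixed products with the [f j] are prescribed by [T]; the diagonal blocks of the Gram
    matrix are those of [f], and contractivity of [T] is what makes the completed matrix positive.
    As it may be singular, its null directions cannot be normalized and are handled apart. No
    multiplication is built directly on a Samuel compactification. Composition and transposition are
    checked on 0-1 matrices, composition also on contractions, and the results are transported. One
    semitopological multiplication suffices for universality: the map to any other semigroup
    compactification already exists for uniform reasons and is multiplicative by density. *)

Lemma cvg_initialP (S : choiceType) (T : topologicalType) (f : S -> T)
    (F : set_system S) (s : S) : Filter F ->
  F --> (s : initial_topology f) <-> f @ F --> f s.
Proof.
move=> FF; split=> [Fs|fFs].
  move=> A fsA; have := @initial_continuous _ _ f (s : initial_topology f) A fsA.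
  exact: Fs.
move=> A [_ [[B oB <-] Bfs] BA].
have /fFs fB : nbhs (f s) B by apply: open_nbhs_nbhs.
by apply: (filterS BA); exact: fB.
Qed.

Lemma cvg_ptwsP (U : Type) (V : topologicalType) (F : set_system {ptws U -> V})
    (f : {ptws U -> V}) : Filter F ->
  F --> f <-> forall x, (fun g : {ptws U -> V} => g x) @ F --> f x.
Proof.
move=> FF; split=> [/cvg_sup Ff x|Ff].
  by have /cvg_initialP := Ff x.
by apply/cvg_sup => x; apply/cvg_initialP; exact: Ff.
Qed.

Lemma ptws_eval_continuous (U : Type) (V : topologicalType) (x : U) :
  continuous (fun g : {ptws U -> V} => g x).
Proof. by move=> f; have /cvg_ptwsP : nbhs f --> f by []; apply. Qed.

Lemma continuous_ptwsP (T : topologicalType) (U : Type) (V : topologicalType)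
    (h : T -> {ptws U -> V}) :
  continuous h <-> forall x, continuous (fun t => h t x).
Proof.
split=> [hc x t|hc t]; last by apply/cvg_ptwsP => x; exact: hc.
exact: (cvg_comp _ _ (hc t) (@ptws_eval_continuous _ _ x (h t))).
Qed.

Lemma set_val_continuous (T : topologicalType) (A : set T) :
  continuous (@set_val T A).
Proof. exact: initial_continuous. Qed.

Lemma cvg_set_typeP (T : topologicalType) (A : set T) (F : set_system (set_type A))
    (s : set_type A) : Filter F ->
  F --> s <-> @set_val T A @ F --> set_val s.
Proof. by move=> FF; exact: cvg_initialP. Qed.

Lemma continuous_set_typeP (S T : topologicalType) (A : set T)
    (h : S -> set_type A) :
  continuous h <-> continuous (fun s => set_val (h s)).
Proof.
split=> [hc s|hc s]; last by apply/cvg_set_typeP; exact: hc.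
exact: (cvg_comp _ _ (hc s) (@set_val_continuous _ _ (h s))).
Qed.

Lemma separating_hausdorff (R : realType) (K : topologicalType) (I : Type)
    (phi : I -> K -> R) :
  (forall i, continuous (phi i)) ->
  (forall p q, (forall i, phi i p = phi i q) -> p = q) -> hausdorff_space K.
Proof.
move=> phic sep p q pq; apply: sep => i; apply: Rhausdorff => A B pA qB.
have [x [xA xB]] := pq _ _ (phic i _ _ pA) (phic i _ _ qB).
by exists (phi i x).
Qed.

Lemma dense_nbhs (G : Type) (K : topologicalType) (j : G -> K) (p : K)
    (A : set K) : dense (range j) -> nbhs p A -> exists g, A (j g).
Proof.
rewrite nbhsE => jd [B [oB Bp] BA].
have [|y [By [g _ gy]]] := jd B _ oB; first by exists p.
by exists g; apply: BA; rewrite gy.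
Qed.

Lemma dense_eq (G : Type) (K L : topologicalType) (j : G -> K) (h k : K -> L) :
  hausdorff_space L -> dense (range j) -> continuous h -> continuous k ->
  (forall g, h (j g) = k (j g)) -> h =1 k.
Proof.
move=> hL jd hc kc hk p; apply: hL => A B pA pB.
have hA : nbhs p (h @^-1` A) by exact: hc.
have kB : nbhs p (k @^-1` B) by exact: kc.
have [g [gA gB]] := dense_nbhs jd (filterI hA kB).
by exists (h (j g)); split=> //; rewrite hk.
Qed.

(** A cluster point in [K] of the traces on [G] of the neighbourhoods of [p] has the coordinates
    [psi i p], and it is unique since [phi] separates points. Continuity uses that a filter on a
    compact space with a single cluster point converges. *)
Lemma dense_extension (R : realType) (G I : Type) (b K : topologicalType)
    (j0 : G -> b) (j : G -> K) (phi : I -> K -> R) (psi : I -> b -> R) :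
  dense (range j0) -> compact [set: K] ->
  (forall i, continuous (phi i)) -> (forall i, continuous (psi i)) ->
  (forall i g, phi i (j g) = psi i (j0 g)) ->
  (forall p q, (forall i, phi i p = phi i q) -> p = q) ->
  exists2 h : b -> K, continuous h & forall g, h (j0 g) = j g.
Proof.
move=> j0d Kc phic psic phipsi sep.
have hK := separating_hausdorff phic sep.
have exq p : exists q, forall i, phi i q = psi i p.
  pose F := filter_from (nbhs p) (fun A => j @` (j0 @^-1` A)).
  have FF : ProperFilter F.
    apply: filter_from_proper; last first.
      by move=> A /(dense_nbhs j0d)[g gA]; exists (j g); exists g.
    apply: filter_from_filter; first by exists setT; exact: filterT.
    move=> A B pA pB; exists (A `&` B); first exact: filterI.
    by move=> _ [g [gA gB] <-]; split; exists g.
  have [q [_ Fq]] := Kc F FF filterT.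
  exists q => i; apply: Rhausdorff => A B qA pB.
  have FB : F (j @` (j0 @^-1` (psi i @^-1` B))).
    by exists (psi i @^-1` B) => //; exact: psic.
  have [_ [[g gB <-] gA]] := Fq _ _ FB (phic i _ _ qA).
  by exists (phi i (j g)); split=> //; rewrite phipsi.
have [h hP] := choice exq.
exists h; last by move=> g; apply: sep => i; rewrite hP phipsi.
move=> p; have clP q : cluster (h @ nbhs p) q -> q = h p.
  move=> hq; apply: sep => i; rewrite hP; apply: Rhausdorff => A B qA pB.
  have hB : (h @ nbhs p) (phi i @^-1` B).
    suff : nbhs p (psi i @^-1` B) by apply: filterS => x /=; rewrite hP.
    exact: psic.
  by have [x [xB xA]] := hq _ _ hB (phic i _ _ qA); exists (phi i x).
have hF : ProperFilter (h @ nbhs p) by exact: fmap_proper_filter.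
apply: (@compact_cluster_set1 _ _ _ [set: K]) => //; do ?exact: filterT.
apply/seteqP; split=> [q /clP //|_ ->].
by have [q [_ Fq]] := Kc _ hF filterT; rewrite -(clP _ Fq).
Qed.

(** Small oscillation makes the images under [f] of the neighbourhood traces of [p] a Cauchy filter;
    the value at [p] is its limit. *)
Lemma oscillation_extension (R : realType) (G : Type) (K : topologicalType)
    (j : G -> K) (f : G -> R) : dense (range j) ->
  (forall (p : K) (e : R), 0 < e -> exists2 W, nbhs p W &
     forall u v, W (j u) -> W (j v) -> `|f u - f v| <= e) ->
  exists2 psi : K -> R, continuous psi & forall g, psi (j g) = f g.
Proof.
move=> jd osc.
pose F (p : K) := filter_from (nbhs p) (fun A => f @` (j @^-1` A)).
have FF p : ProperFilter (F p).
  apply: filter_from_proper; last first.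
    by move=> A /(dense_nbhs jd)[g gA]; exists (f g); exists g.
  apply: filter_from_filter; first by exists setT; exact: filterT.
  move=> A B pA pB; exists (A `&` B); first exact: filterI.
  by move=> _ [g [gA gB] <-]; split; exists g.
have Fcvg (p : K) : exists r : R, F p --> r.
  suff : cvg (F p) by move=> Fp; exists (lim (F p)).
  apply: cauchy_cvg; apply/cauchy_ballP => e e0.
  (* Halving turns the non-strict bound of the hypothesis into a strict ball. *)
  have [W pW We] := osc p (e / 2) (divr_gt0 e0 (ltr0Sn _ _)).
  exists (f @` (j @^-1` W), f @` (j @^-1` W)); first by split; exists W.
  move=> [_ _] [/= [u Wu <-] [v Wv <-]]; rewrite /ball /=.
  by apply: le_lt_trans (We _ _ Wu Wv) _; rewrite ltr_pdivrMr// ltr_pMr// ltr1n.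
have [psi psiP] := choice Fcvg.
(* This comparison of [psi] with [f] on a whole open set yields both the continuity of [psi] and its
   agreement with [f]. *)
have near p (e : R) : 0 < e -> exists2 W, open_nbhs p W &
    forall q g, W q -> W (j g) -> `|psi q - f g| <= e.
  move=> e0; have [W pW We] := osc p (e / 2) (divr_gt0 e0 (ltr0Sn _ _)).
  move: pW; rewrite nbhsE => -[V [oV Vp] VW]; exists V => // q g Vq Vg.
  have e20 : 0 < e / 2 by rewrite divr_gt0.
  have /psiP[B qB BA] : nbhs (psi q) (ball (psi q) (e / 2)) by exact: nbhsx_ballx.
  have [u [uB uV]] := dense_nbhs jd (filterI qB (open_nbhs_nbhs (conj oV Vq))).
  have : ball (psi q) (e / 2) (f u) by apply: BA; exists u.
  rewrite /ball /= => psiu.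
  rewrite -(subrKA (f u)) (splitr e) (le_trans (ler_normD _ _))// lerD ?(ltW psiu)//.
  by apply: We; exact: VW.
exists psi.
  move=> p; apply/cvgrPdist_le => e e0.
  have e20 : 0 < e / 2 by rewrite divr_gt0.
  have [W Wp We] := near p _ e20.
  have [g Wg] := dense_nbhs jd (open_nbhs_nbhs Wp).
  apply: filterS (open_nbhs_nbhs Wp) => q Wq.
  rewrite -(subrKA (f g)) (splitr e) (le_trans (ler_normD _ _))// lerD//.
    by apply: We => //; exact: Wp.2.
  by rewrite distrC; exact: We.
move=> g; apply/eqP; rewrite -subr_eq0 -normr_le0.
apply/ler_addgt0Pl => e e0; rewrite addr0.
by have [W Wp We] := near (j g) e e0; apply: We; exact: Wp.2.
Qed.

Lemma set_type_compact (T : topologicalType) (A : set T) :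
  compact A -> compact [set: set_type A].
Proof.
move=> Ac F FF _.
have vA : (@set_val T A @ F) A.
  suff : @set_val T A @^-1` A = [set: set_type A].
    by rewrite /= /nbhs /= /filter.fmap /= => ->; exact: filterT.
  by apply/seteqP; split=> // -[x xA] _; exact: set_mem xA.
have [x [Ax Fx]] := Ac _ (fmap_proper_filter _ FF) vA.
exists (exist _ x (mem_set Ax)); split=> // B C FB [_ [[D oD <-] Dx] DC].
have vB : (@set_val T A @ F) (@set_val T A @` B).
  suff : F (@set_val T A @^-1` (@set_val T A @` B)) by [].
  by apply: filterS FB => y By /=; exists y.
have [_ [[y By <-] Dy]] := Fx _ _ vB (open_nbhs_nbhs (conj oD Dx)).
by exists y; split=> //; exact: DC.
Qed.

Section closure_compactification.
Variables (G K : topologicalType) (j : G -> K).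

Lemma closure_comp_dense : dense (range (cmap (closure_comp j))).
Proof.
move=> B [p + [A oA AB]]; rewrite -{}AB => Ap; have /set_mem := valP p.
move=> /(_ A (open_nbhs_nbhs (conj oA Ap)))[_ [[g _ <-] Ag]].
by exists (cmap (closure_comp j) g); split; last by exists g.
Qed.

Lemma closure_comp_compact : compact [set: K] -> compact [set: closure_comp j].
Proof.
move=> Kc; apply: set_type_compact.
by apply: (subclosed_compact _ Kc) => //; exact: closed_closure.
Qed.

Lemma continuous_closure_comp (L : topologicalType) (h : L -> K) (j' : G -> L) :
  dense (range j') -> continuous h -> (forall g, h (j' g) = j g) ->
  exists2 k : L -> closure_comp j, continuous k &
    forall g, k (j' g) = cmap (closure_comp j) g.
Proof.
move=> j'd hc hj.
have hP p : h p \in closure (range j).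
  apply: mem_set => A hA; have [g gA] := dense_nbhs j'd (hc _ _ hA).
  by exists (j g); split; [exists g | rewrite -hj].
exists (fun p => exist _ (h p) (hP p)); first exact/continuous_set_typeP.
by move=> g; apply: val_inj => /=; exact: hj.
Qed.

End closure_compactification.

Section compactification_eq_theory.
Variable G : topologicalType.
Implicit Types c d e : gcompactification G.

Lemma compactification_eq_refl c : compactification_eq c c.
Proof. by exists id, id; split=> // x; exact: cvg_id. Qed.

Lemma compactification_eq_sym c d :
  compactification_eq c d -> compactification_eq d c.
Proof. by move=> [h [k [hK kK hc kc hj]]]; exists k, h; split=> // g; rewrite -hj. Qed.

Lemma hausdorff_injective (S T : topologicalType) (h : S -> T) :
  continuous h -> injective h -> hausdorff_space T -> hausdorff_space S.
Proof.
move=> hc hi hT p q pq; apply: hi; apply: hT => A B pA qB.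
by have [x [xA xB]] := pq _ _ (hc _ _ pA) (hc _ _ qB); exists (h x).
Qed.

Lemma compactification_eq_compactification c d :
  compactification_eq c d -> is_compactification c -> is_compactification d.
Proof.
move=> [h [k [hK kK hc kc hj]]] [cc ch cj cd]; split.
- have -> : [set: d] = h @` [set: c].
    by apply/seteqP; split=> // y _; exists (k y).
  by apply: continuous_compact => //; apply: continuous_subspaceT.
- exact: (hausdorff_injective kc (can_inj kK)).
- have -> : @cmap G d = h \o @cmap G c by apply/funext => g; rewrite -hj.
  by move=> x; apply: continuous_comp; [exact: cj | exact: hc].
- move=> O [y Oy] oO; have [||x [xO [g _ gx]]] := cd (h @^-1` O).
  + by exists (k y); rewrite /= kK.
  + by apply: open_comp => // x _; exact: hc.
  + by exists (h x); split=> //; exists g; rewrite // -hj gx.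
Qed.

End compactification_eq_theory.

(** * Criterion for the Roelcke compactification *)

Section roelcke_theory.
Variables (R : realType) (G : groupTopologicalType).
Implicit Types (c d : gcompactification G) (O : set G).

Definition roelcke_bucont := @bounded_ucont G R (@roelcke_entourage G).

Lemma roelcke_bucontP (f : G -> R) : roelcke_bucont f <->
  (exists M, forall x, `|f x| <= M) /\
  (forall e : R, 0 < e -> exists2 O, nbhs (1%g : G) O &
    forall g u v, double_translate O g u -> double_translate O g v ->
      `|f u - f v| < e).
Proof.
split=> -[fM fu]; split=> //.
  move=> e e0.
  have [V V1 VA] := fu _ (entourage_ball R (PosNum e0)).
  exists V => // g u v ug vg; have := VA (u, v); rewrite /= /ball /=.
  by apply; exists g.
move=> A; rewrite -entourage_ballE => -[e /= e0 eA].
have [V V1 Ve] := fu e e0; exists V => // -[u v] [g _ [/= ug vg]].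
by apply: eA; rewrite /ball /=; exact: (Ve g).
Qed.

Lemma roelcke_eval_continuous (f : set_type roelcke_bucont) :
  continuous (fun p : roelcke G R => set_val p f).
Proof.
move=> p; pose ev (q : {ptws set_type roelcke_bucont -> R}) := q f.
have evc : {for set_val p, continuous ev} := @ptws_eval_continuous _ _ f _.
exact: (continuous_comp (@set_val_continuous _ _ p) evc).
Qed.

Lemma roelcke_coordinate (f : G -> R) : roelcke_bucont f ->
  exists psi : roelcke G R -> R,
    continuous psi /\ forall g, psi (cmap _ g) = f g.
Proof.
move=> fb; exists (fun p => set_val p (exist _ f (mem_set fb))); split=> //.
exact: roelcke_eval_continuous.
Qed.

Lemma roelcke_extension (K : topologicalType) (j : G -> K) (I : Type)
    (phi : I -> K -> R) : compact [set: K] ->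
  (forall i, continuous (phi i)) ->
  (forall p q, (forall i, phi i p = phi i q) -> p = q) ->
  (forall i, roelcke_bucont (phi i \o j)) ->
  exists2 h : roelcke G R -> K, continuous h & forall g, h (cmap _ g) = j g.
Proof.
move=> Kc phic sep phib.
have [psi psiP] := choice (fun i => roelcke_coordinate (phib i)).
apply: (@dense_extension R G I _ _ _ _ phi psi) => //.
- exact: closure_comp_dense.
- by move=> i; have [] := psiP i.
- by move=> i g; have [_ ->] := psiP i.
Qed.

(* The functions [phi i] give a map from the Samuel compactification to [c]. By
   the last hypothesis bounded uniformly continuous functions extend to [c],
   which gives its inverse. *)
Lemma roelcke_eq c (I : Type) (phi : I -> c -> R) :
  compact [set: c] -> dense (range (@cmap G c)) ->
  (forall i, continuous (phi i)) ->
  (forall p q, (forall i, phi i p = phi i q) -> p = q) ->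
  (forall i, roelcke_bucont (phi i \o cmap c)) ->
  (forall (p : c) O, nbhs (1%g : G) O -> exists2 W, nbhs p W &
    forall u v, W (cmap c u) -> W (cmap c v) ->
      exists2 g, double_translate O g u & double_translate O g v) ->
  compactification_eq (roelcke G R) c.
Proof.
move=> Kc cd phic sep phib small.
have [h hc hj] := roelcke_extension Kc phic sep phib.
have ext (f : set_type roelcke_bucont) :
    exists psi : c -> R, continuous psi /\ forall g, psi (cmap c g) = set_val f g.
  have /roelcke_bucontP[_ fu] := set_valP f.
  suff [psi] : exists2 psi : c -> R, continuous psi &
    forall g, psi (cmap c g) = set_val f g by exists psi.
  apply: oscillation_extension => // p e e0.
  have [V V1 Ve] := fu e e0; have [W pW WV] := small p V V1.
  exists W => // u v /WV uW /uW[g gu gv]; apply: ltW; exact: (Ve g).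
have [psi psiP] := choice ext.
have [k kc kj] : exists2 k : c -> roelcke G R, continuous k &
    forall g, k (cmap c g) = cmap _ g.
  apply: (@continuous_closure_comp G {ptws set_type roelcke_bucont -> R} _ c
    (fun p f => psi f p) (cmap c) cd).
    by apply/continuous_ptwsP => f; have [] := psiP f.
  by move=> g; apply/funext => f; have [_ ->] := psiP f.
have hK := separating_hausdorff phic sep.
have rH : hausdorff_space (roelcke G R).
  apply: (@separating_hausdorff R _ (set_type roelcke_bucont)
    (fun f (p : roelcke G R) => set_val p f)).
    exact: roelcke_eval_continuous.
  by move=> p q pq; apply: val_inj; apply/funext.
exists h, k; split=> //.
  apply: (dense_eq rH (@closure_comp_dense _ _ _) (h := k \o h) (k := id)) => //.
    by move=> x; apply: continuous_comp; [exact: hc | exact: kc].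
    by move=> x; exact: cvg_id.
  by move=> g /=; rewrite hj kj.
apply: (dense_eq hK cd (h := h \o k) (k := id)) => //.
  by move=> x; apply: continuous_comp; [exact: kc | exact: hc].
  by move=> x; exact: cvg_id.
by move=> g /=; rewrite kj hj.
Qed.

End roelcke_theory.

(** * Semitopological semigroup compactifications *)

(** The branches of the binary tree in [small_oscillation] are uncountable; [D] is the diagonal
    set. *)
Lemma cantor_bool (f : (nat -> bool) -> nat) : ~ injective f.
Proof.
move=> fi; pose D n := `[< exists2 a, f a = n & ~~ a n >].
have DE : D (f D) <-> ~~ D (f D).
  split=> [/asboolP[a /fi ->] //|nD]; apply/asboolP; by exists D.
by case: (D (f D)) DE => -[H1 H2]; [have := H1 isT | have := H2 isT].
Qed.

Lemma quantize (R : realType) (M e : R) : 0 < e ->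
  exists K (q : R -> 'I_K.+1), forall x y, `|x| <= M -> `|y| <= M ->
    q x = q y -> `|x - y| <= e.
Proof.
move=> e0; exists (Num.truncn ((M + M) / e)).
exists (fun x => inord (Num.truncn ((x + M) / e))) => x y xM yM.
have bnd z : `|z| <= M -> 0 <= (z + M) / e /\
    (Num.truncn ((z + M) / e) < (Num.truncn ((M + M) / e)).+1)%N.
  rewrite ler_norml => /andP[zM Mz].
  have z0 : 0 <= (z + M) / e by rewrite divr_ge0 ?(ltW e0)//; lra.
  by split=> //; rewrite ltnS le_truncn// ler_wpM2r ?invr_ge0 ?(ltW e0)// lerD2r.
have [x0 xK] := bnd _ xM; have [y0 yK] := bnd _ yM.
move=> /(congr1 val); rewrite /= !inordK// => xy.
have /andP[x1 x2] := truncn_itv x0; have /andP[y1 y2] := truncn_itv y0.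
rewrite xy in x1 x2.
have : `|(x + M) / e - (y + M) / e| <= 1.
  by rewrite ler_norml; rewrite -natr1 in x2 y2; lra.
rewrite -mulrBl normrM (gtr0_norm (x := e^-1)) ?invr_gt0// ler_pdivrMr// mul1r.
by rewrite opprD addrACA subrr addr0.
Qed.

Section small_oscillation.
Variables (R : realType) (T S : topologicalType) (B : T -> S -> R) (M : R).
Hypotheses (Tc : compact [set: T]) (Sc : compact [set: S]) (Sh : hausdorff_space S).
Hypotheses (Bl : forall t, continuous (B t)) (Br : forall s, continuous (B^~ s)).
Hypothesis BM : forall t s, `|B t s| <= M.

(** The same [n] gives the number of test points and the tolerance, so that one natural number names
    the whole test, as the counting argument requires. *)
Definition controlled (c : nat -> S) (d : R) (s : S) (n : nat) :=
  forall t t', (forall i, (i < n)%N -> `|B t (c i) - B t' (c i)| <= n.+1%:R^-1) ->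
    `|B t s - B t' s| <= d.

(** Otherwise there are pairs in [T * T] that agree better and better on more and more points of [c]
    while staying more than [d] apart at [s]. A cluster point of these pairs agrees on all of [c],
    hence at [s] by continuity of [B t], a contradiction. *)
Lemma closure_controlled (c : nat -> S) (d : R) (s : S) : 0 < d ->
  closure (range c) s -> exists n, controlled c d s n.
Proof.
move=> d0 cs; apply: contrapT => /forallNP nc.
have bad n : exists tt : T * T, (forall i, (i < n)%N ->
    `|B tt.1 (c i) - B tt.2 (c i)| <= n.+1%:R^-1) /\ d < `|B tt.1 s - B tt.2 s|.
  have /existsNP[t /existsNP[t' /not_implyP[H /negP]]] := nc n.
  by rewrite -ltNge => H'; exists (t, t').
have [u uP] := choice bad.
have TTc : compact [set: T * T] by rewrite -setXTT; exact: compact_setX.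
have [p [_ pP]] := TTc (u @ \oo) (fmap_proper_filter _ _) filterT.
have Bc x : continuous (fun q : T * T => B q.1 x - B q.2 x).
  move=> q; apply: cvgB.
    by apply: (continuous_comp (f := fst) (g := B^~ x)); [exact: cvg_fst | exact: Br].
  by apply: (continuous_comp (f := snd) (g := B^~ x)); [exact: cvg_snd | exact: Br].
have pc i : B p.1 (c i) = B p.2 (c i).
  apply/eqP; rewrite -subr_eq0 -normr_le0; apply/ler_addgt0Pl => e e0.
  rewrite addr0.
  have e20 : 0 < e / 2 by rewrite divr_gt0.
  have /(pP _ _) : (u @ \oo) [set q : T * T | `|B q.1 (c i) - B q.2 (c i)| <= e / 2].
    suff : \forall n \near \oo, `|B (u n).1 (c i) - B (u n).2 (c i)| <= e / 2 by [].
    near=> n; have [un _] := uP n; apply: le_trans (un i _) _; near: n.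
      exact: nbhs_infty_gt.
    by apply: filterS (near_infty_natSinv_lt (PosNum e20)) => k /= /ltW.
  move=> /(_ _ (Bc (c i) p _ (nbhsx_ballx _ _ e20)))[q [/= q1]].
  rewrite -ball_normE /= => q2.
  have := ler_normD (B p.1 (c i) - B p.2 (c i) - (B q.1 (c i) - B q.2 (c i)))
    (B q.1 (c i) - B q.2 (c i)).
  by rewrite subrK; lra.
have ps : B p.1 s = B p.2 s.
  have hc : continuous (fun x => B p.1 x - B p.2 x).
    by move=> x; apply: cvgB; exact: Bl.
  apply/eqP; rewrite -subr_eq0 -normr_le0; apply/ler_addgt0Pl => e e0.
  have [_ [[i _ <-]]] := cs _ (hc s _ (nbhsx_ballx _ _ e0)).
  by rewrite /ball /= pc subrr subr0 addr0 => /ltW.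
have : (u @ \oo) [set q : T * T | d < `|B q.1 s - B q.2 s|].
  suff : \forall n \near \oo, d < `|B (u n).1 s - B (u n).2 s| by [].
  by apply: filterE => n; have [] := uP n.
move=> /(pP _ _) /(_ (Bc s p _ (nbhsx_ballx _ _ d0)))[q [/= q1]].
by rewrite -ball_normE /= ps subrr sub0r normrN => q2; lra.
Unshelve. all: by end_near. Qed.

(* A code distinguishing the separated points controlled by [c 0, .., c n.-1]:
   [T] has a finite net for these functions, so that such a point is determined
   up to [3 d] by approximate values at finitely many elements of [T]. *)
Lemma controlled_code (c : nat -> S) (d : R) (n : nat) : 0 < d ->
  exists code : S -> nat, forall s s', controlled c d s n -> controlled c d s' n ->
    code s = code s' -> forall t, `|B t s - B t s'| <= 3 * d.
Proof.
move=> d0; have n0 : 0 < (n.+1%:R^-1 : R) by rewrite invr_gt0.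
have [K [q qP]] := quantize M n0; have [L [r rP]] := quantize M d0.
pose key (t : T) := [ffun i : 'I_n => q (B t (c i))].
have [rep repP] : exists rep : {ffun 'I_n -> 'I_K.+1} -> option T,
    forall t, exists2 t', rep (key t) = Some t' & key t' = key t.
  suff /choice[rep repP] : forall k, exists o : option T, forall t, key t = k ->
      exists2 t', o = Some t' & key t' = k.
    by exists rep => t; exact: repP.
  move=> k; have [[t tk]|nt] := pselect (exists t, key t = k).
    by exists (Some t) => _ _; exists t.
  by exists None => t tk; case: nt; exists t.
pose code s := [ffun k => if rep k is Some t then r (B t s) else ord0].
exists (pickle \o code) => s s' cs cs' /= /(pcan_inj pickleK) ss' t.
(* Compare [t] with the representative [t'] of its cell: control costs [d] at [s] and [d] at [s'],
   and the code costs a third [d] at [t']. *)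
have [t' t'E t'k] := repP t.
have keyE x : controlled c d x n -> `|B t x - B t' x| <= d.
  apply=> i ni; apply: qP => //.
  by have := congr1 (fun k : {ffun _} => k (Ordinal ni)) t'k; rewrite !ffunE.
have := congr1 (fun k : {ffun _} => k (key t)) ss'; rewrite !ffunE t'E.
move=> /(rP _ _ (BM _ _) (BM _ _)).
have := keyE _ cs; have := keyE _ cs'.
have -> : B t s - B t s' = (B t s - B t' s) + (B t' s - B t' s') - (B t s' - B t' s').
  by ring.
move=> h1 h2 h3; apply: le_trans (ler_normB _ _) _.
by have := ler_normD (B t s - B t' s) (B t' s - B t' s'); lra.
Qed.

Lemma shrink_open (W V : set S) s : open W -> nbhs s V -> W s ->
  exists W', [/\ open W', W' !=set0 & closure W' `<=` W `&` V].
Proof.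
move=> oW sV Ws.
have [A sA AWV] := compact_regular Sh Sc (filterT : nbhs s setT)
  (filterI (open_nbhs_nbhs (conj oW Ws)) sV).
move: sA; rewrite nbhsE => -[Z [oZ sZ] ZA]; exists Z; split=> //.
  by exists s.
exact: subset_trans (closureS ZA) AWV.
Qed.

(* Otherwise there are a binary tree of open sets and, for every branch, a point
   in the closure of the countable set of chosen points of the tree, such that
   the points of distinct branches are [e]-separated by some [t]. By
   [closure_controlled] and [controlled_code] there are only countably many. *)
Lemma small_oscillation (e : R) : 0 < e -> [set: S] !=set0 ->
  exists W, [/\ open W, W !=set0 &
    forall s s', W s -> W s' -> forall t, `|B t s - B t s'| <= e].
Proof.
move=> e0 Sn0; apply: contrapT => /forallNP nW.
have split2 (W : set S) : exists V : bool -> set S, open W -> W !=set0 ->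
    [/\ forall b, open (V b) /\ V b !=set0, forall b, closure (V b) `<=` W &
     forall s s', closure (V true) s -> closure (V false) s' ->
       exists t, e <= `|B t s - B t s'|].
  have [[oW W0]|nWW] := pselect (open W /\ W !=set0); last first.
    by exists (fun=> setT) => oW W0; case: nWW.
  have : ~ forall s s', W s -> W s' -> forall t, `|B t s - B t s'| <= e.
    by move=> H; apply: (nW W).
  move=> /existsNP[s /existsNP[s' /not_implyP[Ws /not_implyP[Ws']]]].
  move=> /existsNP[t /negP]; rewrite -ltNge => gap.
  (* Half of the excess over [e]: if both values move by less than [g], the gap stays at least
     [e]. *)
  pose g := (`|B t s - B t s'| - e) / 2.
  have g0 : 0 < g by rewrite divr_gt0// subr_gt0.
  have near x : nbhs x (B t @^-1` ball (B t x) g).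
    by apply: Bl; exact: nbhsx_ballx.
  have [V1 [oV1 V10 V1W]] := shrink_open oW (near s) Ws.
  have [V2 [oV2 V20 V2W]] := shrink_open oW (near s') Ws'.
  exists (fun b => if b then V1 else V2) => _ _; split.
  - by case.
  - by case=> x; [move=> /V1W[] | move=> /V2W[]].
  - move=> x x' /V1W[_ /= h1] /V2W[_ /= h2]; exists t.
    move: h1 h2; rewrite /ball /= => h1 h2.
    have := ler_normD (B t s - B t x) (B t x - B t x' - (B t s' - B t x')).
    have := ler_normB (B t x - B t x') (B t s' - B t x').
    have -> : B t s - B t x + (B t x - B t x' - (B t s' - B t x')) = B t s - B t s'.
      by ring.
    by rewrite /g in h1 h2; lra.
have [V VP] := choice split2.
(* Words carry the most recent choice at the head, so that [b :: w] is a child of [w]. *)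
pose U := fix U (w : seq bool) := if w is b :: w' then V (U w') b else setT.
have UP w : open (U w) /\ U w !=set0.
  elim: w => [|b w [oU U0]] /=; first by split=> //; exact: openT.
  by have [VO _ _] := VP _ oU U0.
have Usub b w : closure (U (b :: w)) `<=` U w.
  by have [oU U0] := UP w; have [_ + _] := VP _ oU U0; apply.
have [pt ptP] := choice (fun w => (UP w).2).
(* All chosen points of the tree in one sequence; numbers that code no word repeat the root
   point. *)
pose c i := if unpickle i is Some w then pt w else pt [::].
pose pre (a : nat -> bool) := fix pre n := if n is m.+1 then a m :: pre m else [::].
have preS a n m : (n <= m)%N -> U (pre a m) `<=` U (pre a n).
  elim: m => [|m IH]; first by rewrite leqn0 => /eqP ->.
  rewrite leq_eqVlt => /predU1P[-> //|/IH Unm] x Ux; apply: Unm.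
  by apply: (@Usub (a m)); exact: subset_closure.
(* The nodes along a branch decrease, so a cluster point of their chosen points lies in every
   closure. *)
have sa a : exists s, closure (range c) s /\ forall n, closure (U (pre a n)) s.
  have [s [_ sP]] := @Sc (pt \o pre a @ \oo) (fmap_proper_filter _ _) filterT.
  move: sP; rewrite clusterE => sP; exists s; split.
    apply: sP; suff : \forall n \near \oo, range c (pt (pre a n)) by [].
    apply: filterE => n; exists (pickle (pre a n)) => //.
    by rewrite /c pickleK.
  move=> n; apply: sP; exists n => // m /= nm; exact: (@preS a n m nm _ (ptP _)).
have [s sP] := choice sa.
have sep a b : a != b -> exists t, e <= `|B t (s a) - B t (s b)|.
  move=> ab; have ex : exists n, a n != b n.
    apply: contrapT => /forallNP H; move/eqP: ab; apply; apply/funext => n.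
    by apply/eqP; have /negP := H n; rewrite negbK.
  have [n nab nmin] := ex_minnP ex.
  have pab : pre a n = pre b n.
    have : forall k, (k <= n)%N -> pre a k = pre b k.
      elim=> [//|k IH kn] /=; rewrite IH 1?ltnW//; congr (_ :: _).
      by apply/eqP; apply: contraTT kn => /nmin; rewrite -ltnNge ltnS.
    by apply.
  have [_ /(_ n.+1) /= sa1] := sP a; have [_ /(_ n.+1) /= sb1] := sP b.
  have [oU U0] := UP (pre b n); have [_ _ VS] := VP _ oU U0.
  move: nab sa1 sb1; rewrite pab; case: (a n); case: (b n) => //= _ h1 h2.
    exact: VS.
  by have [t] := VS _ _ h2 h1; rewrite distrC; exists t.
(* With [d = e / 4] the coding error [3 * d] is below the separation [e]. *)
have d0 : 0 < e / 4 by rewrite divr_gt0.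
have [n nP] := choice (fun a => closure_controlled d0 (sP a).1).
have [code codeP] := choice (fun n => controlled_code c n d0).
apply: (@cantor_bool (fun a => pickle (n a, code (n a) (s a)))) => a b.
move=> /(pcan_inj pickleK)[nab cab]; apply/eqP; apply: contraT => /sep[t].
have := nP b; rewrite -nab in cab * => nb.
by have := codeP _ _ _ (nP a) nb cab t; lra.
Qed.

End small_oscillation.

(** * Uniform continuity on semigroup compactifications *)

Section WAP_roelcke.
Variables (R : realType) (G : groupTopologicalType) (c : gcompactification G).
Variables (m : c -> c -> c) (F : c -> R).
Hypotheses (mc : semitop_semigroup_comp m) (Fc : continuous F).
Local Notation j := (@cmap G c).

Let cF : forall s, continuous (F \o m s) /\ continuous (F \o m^~ s).
Proof.
have [_ _ msep _] := mc.
by move=> s; have [m1 m2] := msep s; split=> x;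
  apply: continuous_comp; [exact: m1 | exact: Fc | exact: m2 | exact: Fc].
Qed.

Lemma compact_fun_bounded (K : topologicalType) (f : K -> R) :
  compact [set: K] -> continuous f -> exists M, forall x, `|f x| <= M.
Proof.
move=> Kc fc; have : compact (f @` [set: K]).
  by apply: continuous_compact => //; apply: continuous_subspaceT.
move=> /compact_bounded[M [_ HM]]; exists (M + 1) => x.
by apply: (HM (M + 1)); [rewrite ltrDl | exists x].
Qed.

Lemma WAP_right_uniform (e : R) : 0 < e -> exists2 V, nbhs (1%g : G) V &
  forall v t, V v -> `|F (j (t * v)%g) - F (j t)| <= e.
Proof.
move=> e0; have [[Kc Kh jc jd] mA msep jM] := mc.
have [M FM] := compact_fun_bounded Kc Fc.
have [|W [oW [s0 Ws0] We]] := @small_oscillation R c c (fun t s => F (m t s)) M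
  Kc Kc Kh (fun t => (cF t).1) (fun s => (cF s).2) (fun t s => FM (m t s)) e e0.
  by exists (j 1%g).
have [g Wg] := dense_nbhs jd (open_nbhs_nbhs (conj oW Ws0)).
(* These are the [v] with [j (g * v)] in [W]; the oscillation bound at [t * g^-1] then cancels
   [g]. *)
exists ((m (j g) \o j) @^-1` W).
  have : continuous (m (j g) \o j).
    by move=> x; apply: continuous_comp; [exact: jc | exact: (msep _).1].
  by apply; apply: open_nbhs_nbhs; split=> //=; rewrite -jM mulg1.
move=> v t /= Wv; have := We _ _ Wv Wg (j (t * g^-1)%g).
by rewrite -!jM !mulgA mulgVK.
Qed.

Lemma WAP_left_uniform (e : R) : 0 < e -> exists2 V, nbhs (1%g : G) V &
  forall v t, V v -> `|F (j (v * t)%g) - F (j t)| <= e.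
Proof.
move=> e0; have [[Kc Kh jc jd] mA msep jM] := mc.
have [M FM] := compact_fun_bounded Kc Fc.
have [|W [oW [s0 Ws0] We]] := @small_oscillation R c c (fun t s => F (m s t)) M
  Kc Kc Kh (fun s => (cF s).2) (fun t => (cF t).1) (fun t s => FM (m s t)) e e0.
  by exists (j 1%g).
have [g Wg] := dense_nbhs jd (open_nbhs_nbhs (conj oW Ws0)).
exists ((m^~ (j g) \o j) @^-1` W).
  have : continuous (m^~ (j g) \o j).
    by move=> x; apply: continuous_comp; [exact: jc | exact: (msep _).2].
  by apply; apply: open_nbhs_nbhs; split=> //=; rewrite -jM mul1g.
move=> v t /= Wv; have := We _ _ Wv Wg (j (g^-1 * t)%g).
by rewrite -!jM -!mulgA !mulVKg.
Qed.

(** The left bound leads from [g] to [a * g], and the right bound from there to [a * g * b]. *)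
Lemma WAP_roelcke_bucont : roelcke_bucont (F \o j).
Proof.
have [[Kc _ _ _] _ _ _] := mc.
have [M FM] := compact_fun_bounded Kc Fc.
apply/roelcke_bucontP; split; first by exists M => x; exact: FM.
(* Members of [O g O] are within [2 e / 5] of [g], so two of them differ by at most [4 e / 5]. *)
move=> e e0; have e50 : 0 < e / 5 by rewrite divr_gt0.
have [V1 V11 V1P] := WAP_right_uniform e50.
have [V2 V21 V2P] := WAP_left_uniform e50.
exists (V1 `&` V2); first exact: filterI.
suff near g u : double_translate (V1 `&` V2) g u -> `|F (j u) - F (j g)| <= e / 5 + e / 5.
  move=> g u v /near ug /near vg /=.
  have := ler_normB (F (j u) - F (j g)) (F (j v) - F (j g)).
  by rewrite opprB addrA subrK; lra.
move=> [a [_ a2] [b [b1 _] <-]].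
have := V1P b (a * g)%g b1; have := V2P a g a2.
have := ler_normD (F (j (a * g * b)%g) - F (j (a * g)%g)) (F (j (a * g)%g) - F (j g)).
by rewrite addrA subrK; lra.
Qed.

End WAP_roelcke.

(** * Transport along isomorphisms and universality *)

Section WAP_transport.
Variables (R : realType) (G : groupTopologicalType).
Implicit Types c d : gcompactification G.

Lemma compact_separating (K : topologicalType) : compact [set: K] ->
  hausdorff_space K -> forall p q : K,
  (forall f : {f : K -> R | continuous f}, sval f p = sval f q) -> p = q.
Proof.
move=> Kc Kh p q pq; apply: contrapT => npq.
have acc := hausdorff_accessible Kh.
have cr : completely_regular_space K.
  by apply: (@normal_completely_regular R) => //; exact: compact_normal.
have := cr p [set q] (@accessible_closed_set1 K acc q) npq.
move=> /(uniform_separatorP (R := R))[f [fc _ f0 f1]].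
have fp : f p = 0 by apply: f0; exists p.
have fq : f q = 1 by apply: f1; exists q.
have := pq (exist _ f fc); rewrite /= fp fq.
by move=> /eqP; rewrite eq_sym oner_eq0.
Qed.

(** The formula for [m'] is exported because [is_sim_comp_transport] has to verify unit and
    inversion for this very multiplication. *)
Lemma semitop_semigroup_comp_transport c d (m : c -> c -> c) :
  compactification_eq c d -> semitop_semigroup_comp m ->
  exists2 m' : d -> d -> d, semitop_semigroup_comp m' &
    exists (h : c -> d) (k : d -> c), [/\ [/\ cancel h k, cancel k h, continuous h &
        continuous k], forall g, h (cmap c g) = cmap d g &
        forall s t, m' s t = h (m (k s) (k t))].
Proof.
move=> cd [cc mA msep jM]; have dc := compactification_eq_compactification cd cc.
have [h [k [hK kK hc kc hj]]] := cd.
exists (fun s t => h (m (k s) (k t))); last by exists h, k.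
split=> //.
- by move=> x y z; rewrite !hK mA.
- move=> s; split=> x.
    apply: (continuous_comp (f := m (k s) \o k) (g := h)); last exact: hc.
    by apply: continuous_comp; [exact: kc | exact: (msep _).1].
  apply: (continuous_comp (f := m^~ (k s) \o k) (g := h)); last exact: hc.
  by apply: continuous_comp; [exact: kc | exact: (msep _).2].
- by move=> x y; rewrite -!hj !hK jM.
Qed.

(** All continuous functions on [d] pull back to Roelcke uniformly continuous ones, which gives the
    map to [d]; [m] supplies the semigroup structure of the source. *)
Lemma roelcke_is_WAP c (m : c -> c -> c) :
  compactification_eq c (roelcke G R) -> semitop_semigroup_comp m ->
  is_WAP_comp (roelcke G R).
Proof.
move=> cb /(semitop_semigroup_comp_transport cb)[m' m'P _]; exists m'; split=> //.
move=> d md mdP; have [[Kc Kh _ _] _ dsep dM] := mdP.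
have [h hc hj] := @roelcke_extension R G d (cmap d) {f : d -> R | continuous f}
  (fun f => sval f) Kc (fun f => svalP f) (compact_separating Kc Kh)
  (fun f => WAP_roelcke_bucont mdP (svalP f)).
exists h; split=> //; have [[_ _ _ bd] _ bsep bM] := m'P.
(* With separate continuity only, density is applied to one factor at a time: here to the right one,
   with the left one in [G]. *)
have cont1 (g : G) : forall t, h (m' (cmap _ g) t) = md (h (cmap _ g)) (h t).
  apply: (dense_eq Kh bd (h := h \o m' (cmap _ g)) (k := md (h (cmap _ g)) \o h)).
  - by move=> x; apply: continuous_comp; [exact: (bsep _).1 | exact: hc].
  - by move=> x; apply: continuous_comp; [exact: hc | exact: (dsep _).1].
  - by move=> x /=; rewrite -bM !hj dM.
move=> s t; apply: (dense_eq Kh bd (h := h \o m'^~ t) (k := md^~ (h t) \o h)).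
- by move=> x; apply: continuous_comp; [exact: (bsep _).2 | exact: hc].
- by move=> x; apply: continuous_comp; [exact: hc | exact: (dsep _).2].
- by move=> x /=; exact: cont1.
Qed.

Lemma is_sim_comp_transport c d :
  compactification_eq c d -> is_sim_comp c -> is_sim_comp d.
Proof.
move=> cd [m [inv [[mP [m1 m2] [ji jo] [act [act1 actM actc actj]]] invP invU invc invj]]].
have [m' m'P [h [k [[hK kK hc kc] hj m'E]]]] := semitop_semigroup_comp_transport cd mP.
have kj g : k (cmap d g) = cmap c g by rewrite -hj hK.
exists m', (fun s => h (inv (k s))); split.
- split=> //.
  + by split=> x; rewrite m'E kj ?m1 ?m2 kK.
  + split; first by move=> x y; rewrite -!hj => /(can_inj hK)/ji.
    move=> A; rewrite jo; split=> -[V oV VA].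
      exists (k @^-1` V); first by apply: open_comp => // x _; exact: kc.
      by rewrite -VA; apply/seteqP; split=> x; rewrite /= kj.
    exists (h @^-1` V); first by apply: open_comp => // x _; exact: hc.
    by rewrite -VA; apply/seteqP; split=> x; rewrite /= hj.
  + exists (fun g s => h (act g (k s))); split.
    * by move=> s; rewrite act1 kK.
    * by move=> g g' s; rewrite hK actM.
    * move=> p; apply: (continuous_comp (f := fun p => act p.1 (k p.2))); last exact: hc.
      apply: (continuous_comp (f := fun p : G * d => (p.1, k p.2))
        (g := fun p => act p.1 p.2)); last exact: actc.
      apply: cvg_pair; first exact: cvg_fst.
      by apply: (continuous_comp (f := snd)); [exact: cvg_snd | exact: kc].
    * by move=> g g'; rewrite kj actj hj.
- by move=> s; rewrite !m'E !hK; have [-> ->] := invP (k s); rewrite kK.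
- move=> s t; rewrite !m'E !hK => /(congr1 k) + /(congr1 k).
  by rewrite !hK => h1 h2; rewrite -(invU _ _ h1 h2) kK.
- move=> x; apply: (continuous_comp (f := inv \o k)); last exact: hc.
  by apply: continuous_comp; [exact: kc | exact: invc].
- by move=> g; rewrite kj invj hj.
Qed.

End WAP_transport.

(** * The inner product of l2 *)

Section rsum_theory.
Variables (R : realType) (T : choiceType).
Implicit Types (u v p q : T -> R).

Local Notation summ u := (summable [set: T] (EFin \o u)).

Lemma summ_esum u : (forall x, 0 <= u x) -> summ u ->
  \esum_(x in [set: T]) (u x)%:E \is a fin_num.
Proof.
move=> u0; rewrite summableE; congr (_ \is a fin_num).
by apply: eq_esum => x _ /=; rewrite ger0_norm.
Qed.

Lemma summ_le u v : (forall x, `|u x| <= v x) -> summ v -> summ u.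
Proof.
move=> uv; apply: le_lt_trans; apply: le_esum => x _ /=.
by rewrite lee_fin (le_trans (uv x))// ler_norm.
Qed.

Lemma summD u v : summ u -> summ v -> summ (fun x => u x + v x).
Proof. exact: summableD. Qed.

Lemma summN u : summ u -> summ (fun x => - u x).
Proof. by rewrite summableN. Qed.

Lemma summZ a u : summ u -> summ (fun x => a * u x).
Proof.
move=> su; rewrite /summable.
have -> : \esum_(x in [set: T]) `|(EFin \o (fun x => (a * u x)%R)) x|%E =
    \esum_(x in [set: T]) (`|a| * `|u x|)%:E.
  by apply: eq_esum => x _ /=; rewrite normrM.
apply: le_lt_trans (esumZ (normr_ge0 a) (fun x => normr_ge0 (u x))) _.
move: su; rewrite -[summable _ _]/(_ < +oo)%E => su.
have : \esum_(x in [set: T]) `|u x|%:E \is a fin_num.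
  by rewrite ge0_fin_numE// esum_ge0// => x _; rewrite lee_fin.
by move=> /fineK <-; rewrite -EFinM ltry.
Qed.

(** Positive and negative parts are not additive; the freedom in the decomposition [u = p - q] is
    what makes [rsum] linear. *)
Lemma rsumE u p q : (forall x, 0 <= p x) -> (forall x, 0 <= q x) ->
  summ p -> summ q -> (forall x, u x = p x - q x) ->
  rsum u = fine (\esum_(x in [set: T]) (p x)%:E) -
           fine (\esum_(x in [set: T]) (q x)%:E).
Proof.
move=> p0 q0 sp sq upq.
have Epq : ((EFin \o p) \- (EFin \o q))%E = EFin \o u.
  by apply/funext => x /=; rewrite upq EFinB.
have := esumB sp sq (fun x _ => p0 x) (fun x _ => q0 x).
rewrite Epq => /(congr1 fine).
have su : summ u by rewrite -Epq; exact: summableB.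
rewrite !fineB ?summ_esum//.
- have := summable_funepos su; rewrite summableE; congr (_ \is a fin_num).
  by apply: eq_esum => x _; rewrite gee0_abs.
- have := summable_funeneg su; rewrite summableE; congr (_ \is a fin_num).
  by apply: eq_esum => x _; rewrite gee0_abs.
Qed.

Let pos u x : 0 <= Num.max (u x) 0. Proof. by rewrite le_max lexx orbT. Qed.
Let neg u x : 0 <= Num.max (- u x) 0. Proof. by rewrite le_max lexx orbT. Qed.

Let posneg u x : u x = Num.max (u x) 0 - Num.max (- u x) 0.
Proof.
have [u0|u0] := leP 0 (u x).
  by rewrite max_r ?oppr_le0// subr0.
by rewrite max_l ?oppr_ge0 ?(ltW u0)// opprK add0r.
Qed.

Let summpos u : summ u -> summ (fun x => Num.max (u x) 0).
Proof.
have : summ u -> summ (fun x => `|u x|).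
  apply: le_lt_trans; apply: le_esum => x _ /=.
  by rewrite lee_fin normr_id.
move=> /[apply]; apply: summ_le => x.
by rewrite ger0_norm ?pos// ge_max ler_norm normr_ge0.
Qed.

Let summneg u : summ u -> summ (fun x => Num.max (- u x) 0).
Proof. by move=> /summN; exact: summpos. Qed.

Lemma rsumD u v : summ u -> summ v ->
  rsum (fun x => u x + v x) = rsum u + rsum v.
Proof.
move=> su sv.
have fD p q : (forall x, 0 <= p x) -> (forall x, 0 <= q x) -> summ p -> summ q ->
    fine (\esum_(x in [set: T]) (p x + q x)%:E) =
    fine (\esum_(x in [set: T]) (p x)%:E) + fine (\esum_(x in [set: T]) (q x)%:E).
  move=> p0 q0 sp sq; rewrite -fineD ?summ_esum// -esumD//.
    by move=> x _; rewrite lee_fin.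
  by move=> x _; rewrite lee_fin.
rewrite (rsumE (pos u) (neg u) (summpos su) (summneg su) (posneg u)).
rewrite (rsumE (pos v) (neg v) (summpos sv) (summneg sv) (posneg v)).
rewrite (@rsumE _ (fun x => Num.max (u x) 0 + Num.max (v x) 0)
  (fun x => Num.max (- u x) 0 + Num.max (- v x) 0)).
- rewrite (fD _ _ (pos u) (pos v) (summpos su) (summpos sv)).
  rewrite (fD _ _ (neg u) (neg v) (summneg su) (summneg sv)).
  by ring.
- by move=> x; rewrite addr_ge0.
- by move=> x; rewrite addr_ge0.
- by apply: summD; exact: summpos.
- by apply: summD; exact: summneg.
- by move=> x; rewrite [in LHS](posneg u) [in LHS](posneg v) opprD addrACA.
Qed.

Lemma rsumN u : summ u -> rsum (fun x => - u x) = - rsum u.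
Proof.
move=> su; rewrite (rsumE (pos u) (neg u) (summpos su) (summneg su) (posneg u)).
rewrite (rsumE (neg u) (pos u) (summneg su) (summpos su)) ?opprB//.
by move=> x; rewrite [in LHS](posneg u) opprB.
Qed.

Lemma rsumZ a u : summ u -> rsum (fun x => a * u x) = a * rsum u.
Proof.
move=> su.
have fZ b p : 0 < b -> (forall x, 0 <= p x) -> summ p ->
    fine (\esum_(x in [set: T]) (b * p x)%:E) =
    b * fine (\esum_(x in [set: T]) (p x)%:E).
  move=> b0 p0 sp; have fp := summ_esum p0 sp.
  have bp0 x : 0 <= b * p x by rewrite mulr_ge0// ltW.
  have fbp := summ_esum bp0 (summZ b sp).
  rewrite -[b * fine _]/(fine b%:E * fine _) -fineM//; congr fine.
  (* [esumZ] is only an inequality; applied with [b^-1] it also gives the reverse one. *)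
  apply/eqP; rewrite eq_le esumZ ?(ltW b0)//=.
  have := @esumZ R T b^-1 (fun x => b * p x); rewrite invr_ge0 (ltW b0).
  move=> /(_ isT bp0).
  under [X in (X <= _ -> _)%E]eq_esum do rewrite mulrA mulVf ?gt_eqF// mul1r.
  rewrite -(fineK fp) -(fineK fbp) -!EFinM !lee_fin mulrC => h.
  by rewrite mulrC -ler_pdivlMr.
have rZ b : 0 < b -> rsum (fun x => b * u x) = b * rsum u.
  move=> b0; rewrite (rsumE (pos u) (neg u) (summpos su) (summneg su) (posneg u)).
  rewrite (@rsumE _ (fun x => b * Num.max (u x) 0) (fun x => b * Num.max (- u x) 0)).
  - rewrite (fZ _ _ b0 (pos u) (summpos su)) (fZ _ _ b0 (neg u) (summneg su)).
    by rewrite mulrBr.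
  - by move=> x; rewrite mulr_ge0// ltW.
  - by move=> x; rewrite mulr_ge0// ltW.
  - by apply: summZ; exact: summpos.
  - by apply: summZ; exact: summneg.
  - by move=> x; rewrite [in LHS](posneg u) mulrBr.
have [a0|a0|->] := ltgtP a 0.
- rewrite -[a]opprK mulNr -rZ ?oppr_gt0// -rsumN; last exact: summZ.
  by congr rsum; apply/funext => x; rewrite mulNr.
- exact: rZ.
- have s0 : summ (fun _ : T => 0 : R).
    by rewrite /summable esum1 ?ltry// => x _ /=; rewrite normr0.
  rewrite mul0r (@rsumE _ (fun=> 0) (fun=> 0)) ?subrr//.
  by move=> x; rewrite mul0r.
Qed.

End rsum_theory.

Section csum_theory.
Variables (R : realType) (T : choiceType).
Implicit Types (u v : T -> R[i]).

Definition csummable u := summable [set: T] (fun x => (normc (u x))%:E).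

Lemma normc_ge0 (z : R[i]) : 0 <= normc z.
Proof. by rewrite -ler0c -[(normc z)%:C%C]/(`|z|). Qed.

Lemma normc_conj (z : R[i]) : normc z^*%C = normc z.
Proof. by case: z => a b /=; rewrite sqrrN. Qed.

Lemma normc_Re (z : R[i]) : `|complex.Re z| <= normc z.
Proof. by have := normc_ge_Re z; rewrite -[`|z|]/((normc z)%:C%C) lecR. Qed.

Lemma normc_Im (z : R[i]) : `|complex.Im z| <= normc z.
Proof.
case: z => a b /=; rewrite -sqrtr_sqr ler_sqrt ?addr_ge0 ?sqr_ge0//.
by rewrite lerDr sqr_ge0.
Qed.

Lemma normcD (z w : R[i]) : normc (z + w) <= normc z + normc w.
Proof. exact: (@le_normcD R z w). Qed.

Lemma conjcD (z w : R[i]) : (z + w)^*%C = z^*%C + w^*%C.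
Proof. exact: rmorphD. Qed.

Lemma conjcN (z : R[i]) : (- z)^*%C = - z^*%C.
Proof. exact: rmorphN. Qed.

Lemma conjcM (z w : R[i]) : (z * w)^*%C = z^*%C * w^*%C.
Proof. exact: rmorphM. Qed.

Lemma csummable_Re u : csummable u -> summable [set: T] (EFin \o (fun x => complex.Re (u x))).
Proof. by apply: summ_le => x; exact: normc_Re. Qed.

Lemma csummable_Im u : csummable u -> summable [set: T] (EFin \o (fun x => complex.Im (u x))).
Proof. by apply: summ_le => x; exact: normc_Im. Qed.

Lemma csumD u v : csummable u -> csummable v ->
  csum (fun x => u x + v x) = csum u + csum v.
Proof.
move=> su sv; rewrite /csum.
have -> : (fun x => complex.Re (u x + v x)) =
    (fun x => complex.Re (u x) + complex.Re (v x)).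
  by apply/funext => x; rewrite raddfD.
have -> : (fun x => complex.Im (u x + v x)) =
    (fun x => complex.Im (u x) + complex.Im (v x)).
  by apply/funext => x; rewrite raddfD.
rewrite (rsumD (csummable_Re su) (csummable_Re sv)).
by rewrite (rsumD (csummable_Im su) (csummable_Im sv)).
Qed.

Lemma csumZ c u : csummable u -> csum (fun x => c * u x) = c * csum u.
Proof.
move=> su; have sR := csummable_Re su; have sI := csummable_Im su.
case: c => a b; rewrite /csum.
have -> : (fun x => complex.Re ((a +i* b)%C * u x)) =
    (fun x => a * complex.Re (u x) + - (b * complex.Im (u x))).
  by apply/funext => x; case: (u x).
have -> : (fun x => complex.Im ((a +i* b)%C * u x)) =
    (fun x => a * complex.Im (u x) + b * complex.Re (u x)).
  by apply/funext => x; case: (u x) => c d /=; rewrite [b * c]mulrC.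
rewrite (rsumD (summZ a sR) (summN (summZ b sI))) (rsumN (summZ b sI)).
rewrite (rsumD (summZ a sI) (summZ b sR)) (rsumZ a sR) (rsumZ b sI).
by rewrite (rsumZ a sI) (rsumZ b sR); congr Complex; rewrite [b * _]mulrC.
Qed.

Lemma csum_conj u : csummable u -> csum (fun x => (u x)^*%C) = (csum u)^*%C.
Proof.
move=> su; rewrite /csum /=; congr Complex.
  by congr rsum; apply/funext => x; case: (u x).
rewrite -rsumN; last exact: csummable_Im.
by congr rsum; apply/funext => x; case: (u x).
Qed.

End csum_theory.

Section inner_theory.
Variables (R : realType) (X : choiceType).
Local Notation H := (l2 R X).
Implicit Types f g h : H.

Lemma csummable_inner f g : csummable (fun x => f x * (g x)^*%C).
Proof.
have fin h : summable [set: X] (EFin \o (fun x => normc (h x) ^+ 2)).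
  rewrite /summable; have := l2funP h; rewrite /in_mem/= /l2pred /l2sq.
  by congr (_ < +oo)%E; apply: eq_esum => x _ /=; rewrite ger0_norm// sqr_ge0.
apply: summ_le (summD (fin f) (fin g)) => x /=.
rewrite ger0_norm ?normc_ge0// normcM normc_conj.
by have := sqr_ge0 (normc (f x) - normc (g x)); have := normc_ge0 (f x);
  have := normc_ge0 (g x); nra.
Qed.

Lemma innerDl f g h : inner (f + g) h = inner f h + inner g h.
Proof.
rewrite /inner -csumD; do ?exact: csummable_inner.
by congr csum; apply/funext => x; rewrite -mulrDl.
Qed.

Lemma innerZl c f g : inner (c *: f) g = c * inner f g.
Proof.
rewrite /inner -csumZ; last exact: csummable_inner.
by congr csum; apply/funext => x; rewrite mulrA.
Qed.

Lemma inner_conj f g : inner g f = (inner f g)^*%C.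
Proof.
rewrite /inner -csum_conj; last exact: csummable_inner.
congr csum; apply/funext => x; rewrite conjcM mulrC; congr (_ * _).
by rewrite conjcK.
Qed.

Lemma innerDr f g h : inner f (g + h) = inner f g + inner f h.
Proof. by rewrite inner_conj innerDl conjcD -!inner_conj. Qed.

Lemma innerZr c f g : inner f (c *: g) = c^*%C * inner f g.
Proof. by rewrite inner_conj innerZl conjcM -inner_conj. Qed.

Lemma inner0l f : inner 0 f = 0.
Proof. by rewrite -(scale0r f) innerZl mul0r. Qed.

Lemma inner0r f : inner f 0 = 0.
Proof. by rewrite inner_conj inner0l conjc0. Qed.

Lemma innerNl f g : inner (- f) g = - inner f g.
Proof. by rewrite -scaleN1r innerZl mulN1r. Qed.

Lemma innerNr f g : inner f (- g) = - inner f g.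
Proof. by rewrite inner_conj innerNl conjcN -inner_conj. Qed.

Lemma innerBl f g h : inner (f - g) h = inner f h - inner g h.
Proof. by rewrite innerDl innerNl. Qed.

Lemma innerBr f g h : inner f (g - h) = inner f g - inner f h.
Proof. by rewrite innerDr innerNr. Qed.

Lemma inner_suml (I : Type) (r : seq I) (P : pred I) (F : I -> H) g :
  inner (\sum_(i <- r | P i) F i) g = \sum_(i <- r | P i) inner (F i) g.
Proof.
apply: (big_morph (fun f => inner f g)) => [f h|]; first exact: innerDl.
exact: inner0l.
Qed.

Lemma inner_sumr (I : Type) (r : seq I) (P : pred I) (F : I -> H) g :
  inner g (\sum_(i <- r | P i) F i) = \sum_(i <- r | P i) inner g (F i).
Proof.
apply: (big_morph (fun f => inner g f)) => [f h|]; first exact: innerDr.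
exact: inner0r.
Qed.

Lemma inner_normE f : inner f f = ((l2norm f) ^+ 2)%:C%C.
Proof. by rewrite inner_self rmorphXn. Qed.

Lemma normE f : `|f| = (l2norm f)%:C%C.
Proof. by []. Qed.

Lemma l2norm0 : l2norm (0 : H) = 0.
Proof. by have := l2normZ 0 (0 : H); rewrite normc0 mul0r scale0r. Qed.

Lemma l2normN f : l2norm (- f) = l2norm f.
Proof. by rewrite -scaleN1r l2normZ normcN normc1 mul1r. Qed.

Lemma l2normB f g : l2norm (f - g) <= l2norm f + l2norm g.
Proof. by rewrite -(l2normN g); exact: l2normD. Qed.

Lemma l2norm_distC f g : l2norm (f - g) = l2norm (g - f).
Proof. by rewrite -l2normN opprB. Qed.

Lemma l2norm_sum (I : Type) (r : seq I) (P : pred I) (F : I -> H) :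
  l2norm (\sum_(i <- r | P i) F i) <= \sum_(i <- r | P i) l2norm (F i).
Proof.
elim/big_ind2: _ => //; first by rewrite l2norm0.
by move=> a b c d ab cd; apply: le_trans (l2normD _ _) _; exact: lerD.
Qed.

Lemma cauchy_schwarz f g : normc (inner f g) <= l2norm f * l2norm g.
Proof.
have [g0|g0] := eqVneq (l2norm g) 0.
  by rewrite (l2norm_eq0 g0) inner0r normc0 mulr_ge0 ?l2norm_ge0.
have N0 : inner g g != 0.
  rewrite inner_normE; apply/eqP => /complexI /eqP.
  by rewrite expf_eq0 /= (negPf g0).
pose a := inner f g / inner g g.
have aC : a^*%C = (inner f g)^*%C / inner g g.
  by rewrite /a conjcM conjc_inv -(inner_conj g g).
have E : inner (f - a *: g) (f - a *: g) =
    inner f f - inner f g * (inner f g)^*%C / inner g g.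
  rewrite innerBl !innerBr !innerZl !innerZr aC (inner_conj f g) /a.
  by field.
have : 0 <= inner (f - a *: g) (f - a *: g).
  by rewrite inner_normE ler0c sqr_ge0.
rewrite E -sqr_normc !inner_normE -[`|inner f g|]/((normc (inner f g))%:C%C).
rewrite -rmorphXn /= -fmorphV -rmorphM -rmorphB /= ler0c subr_ge0.
have g20 : 0 < l2norm g ^+ 2 by rewrite exprn_even_gt0.
rewrite ler_pdivrMr// -exprMn ler_sqr ?nnegrE ?normc_ge0//.
by rewrite mulr_ge0 ?l2norm_ge0.
Qed.

Lemma inner_eq f g : (forall h, inner f h = inner g h) -> f = g.
Proof.
move=> fg; apply/eqP; rewrite -subr_eq0; apply/eqP; apply: l2norm_eq0.
have : inner (f - g) (f - g) = 0 by rewrite innerBl fg subrr.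
by rewrite inner_normE => /complexI /eqP; rewrite expf_eq0 /= => /eqP.
Qed.

End inner_theory.

(** * Coordinates and unitary operators *)

Section basis_theory.
Variables (R : realType) (X : discreteTopologicalType).
Local Notation H := (l2 R X).
Local Notation e := (@l2_basis R X).
Implicit Types (f g h : H).

Lemma rsum_single (u : X -> R) x : (forall y, y != x -> u y = 0) ->
  rsum u = u x.
Proof.
move=> u0.
have single (p : X -> \bar R) : (0 <= p x)%E -> (forall y, y != x -> p y = 0%E) ->
    \esum_(y in [set: X]) p y = p x.
  move=> p0 pE; have pp y : (0 <= p y)%E by have [->|/pE ->] := eqVneq y x.
  rewrite (esumID [set x])// setTI esum_set1// esum1 ?adde0// => y [_ /eqP].
  exact: pE.
rewrite /rsum !single ?funepos_ge0 ?funeneg_ge0//.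
- rewrite funeposE funenegE /=; have [ux|ux] := leP 0 (u x).
    by rewrite max_l ?lee_fin// max_r ?lee_fin ?oppr_le0//= subr0.
  by rewrite max_r ?lee_fin ?(ltW ux)// max_l ?lee_fin ?oppr_ge0 ?(ltW ux)//= opprK add0r.
- by move=> y /u0; rewrite funenegE /= => ->; rewrite oppr0 maxxx.
- by move=> y /u0; rewrite funeposE /= => ->; rewrite maxxx.
Qed.

Lemma inner_basis f x : inner f (e x) = f x.
Proof.
rewrite /inner /csum.
have E (part : R[i] -> R) : part 0 = 0 ->
    rsum (fun y => part (f y * (e x y)^*%C)) = part (f x).
  move=> part0; rewrite (@rsum_single _ x) /= ?eqxx ?conjc1 ?mulr1// => y /negPf yx.
  by rewrite yx conjc0 mulr0.
by rewrite !E//; case: (f x).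
Qed.

Lemma basis_inner x y : inner (e x) (e y) = (x == y)%:R.
Proof. by rewrite inner_basis /= eq_sym. Qed.

Lemma l2norm_basis x : l2norm (e x) = 1.
Proof.
have : inner (e x) (e x) = 1 by rewrite basis_inner eqxx.
rewrite inner_normE => /complexI /eqP; rewrite sqrf_eq1 => /orP[/eqP //|/eqP h].
by have := l2norm_ge0 (e x); rewrite h; lra.
Qed.

Definition partial_sum (s : seq X) (c : X -> R[i]) : H :=
  \sum_(x <- s) c x *: e x.

Lemma inner_partial_sum s (c : X -> R[i]) h :
  inner (partial_sum s c) h = \sum_(x <- s) c x * (h x)^*%C.
Proof.
rewrite /partial_sum inner_suml; apply: eq_bigr => x _.
by rewrite innerZl inner_conj inner_basis.
Qed.

Lemma partial_sumE s (c : X -> R[i]) x : uniq s ->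
  partial_sum s c x = if x \in s then c x else 0.
Proof.
move=> us; rewrite -inner_basis inner_partial_sum; case: ifP => xs.
  rewrite (bigD1_seq x) //= eqxx conjc1 mulr1 big1 ?addr0// => y /negPf yx.
  by rewrite yx conjc0 mulr0.
rewrite big_seq big1// => y ys.
by rewrite /= (_ : (y == x) = false) ?conjc0 ?mulr0//; apply: contraFF xs => /eqP <-.
Qed.

Lemma partial_sum_norm s (c : X -> R[i]) : uniq s ->
  l2norm (partial_sum s c) ^+ 2 = \sum_(x <- s) normc (c x) ^+ 2.
Proof.
move=> us; apply: complexI; rewrite -inner_normE inner_partial_sum rmorph_sum /=.
rewrite big_seq [RHS]big_seq; apply: eq_bigr => x xs.
by rewrite partial_sumE// xs -sqr_normc rmorphXn.
Qed.

Lemma partial_sum_dist s f : uniq s ->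
  l2norm (f - partial_sum s f) ^+ 2 = l2norm f ^+ 2 - \sum_(x <- s) normc (f x) ^+ 2.
Proof.
move=> us; apply: complexI; rewrite -inner_normE.
have fs : inner (partial_sum s f) f = (\sum_(x <- s) normc (f x) ^+ 2)%:C%C.
  rewrite inner_partial_sum rmorph_sum /=; apply: eq_bigr => x _.
  by rewrite -sqr_normc rmorphXn.
rewrite innerBl !innerBr (inner_conj (partial_sum s f) f) fs conjc_real.
by rewrite !inner_normE partial_sum_norm// subrr subr0 rmorphB.
Qed.

(** [l2sq] is a supremum over finite sets; by [partial_sum_dist] a set that comes within [d ^+ 2] of
    it supports the required sum. *)
Lemma partial_sum_dense f (d : R) : 0 < d ->
  exists2 s, uniq s & l2norm (f - partial_sum s f) <= d.
Proof.
move=> d0; have d20 : 0 < d ^+ 2 by rewrite exprn_gt0.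
have : (l2sq f - (d ^+ 2)%:E < l2sq f)%E.
  by rewrite l2sqE -EFinB lte_fin gtrBl.
rewrite {2}/l2sq => /ereal_sup_gt[_ [A [finA _] <-]].
rewrite fsbig_finite//=.
set s := finmap.enum_fset (fset_set A).
have us : uniq s by exact: finmap.fset_uniq.
move=> h; exists s => //.
rewrite -ler_sqr ?nnegrE ?l2norm_ge0 ?(ltW d0)// partial_sum_dist//.
move: h; rewrite l2sqE sumEFin -EFinB lte_fin => /ltW.
by rewrite lerBlDr => h; rewrite lerBlDr addrC.
Qed.

(** The coordinates of the representing vector are forced by the basis. Testing [phi] on finite
    parts of [v] bounds its norm by [M], and density of finite sums gives the identity. *)
Lemma riesz (phi : H -> R[i]) (M : R) : 0 <= M ->
  (forall c f g, phi (c *: f + g) = c * phi f + phi g) ->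
  (forall f, normc (phi f) <= M * l2norm f) ->
  exists2 v : H, l2norm v <= M & forall f, phi f = inner f v.
Proof.
move=> M0 phil phiM.
have phi0 : phi 0 = 0 by have := phil (-1) 0 0; rewrite scaler0 addr0 mulN1r addNr.
have phiD f g : phi (f + g) = phi f + phi g by rewrite -[f]scale1r phil mul1r scale1r.
have phiZ c f : phi (c *: f) = c * phi f by rewrite -[X in phi X]addr0 phil phi0 addr0.
have phi_sum s c : phi (partial_sum s c) = \sum_(x <- s) c x * phi (e x).
  rewrite /partial_sum; elim: s => [|x s IH]; first by rewrite !big_nil.
  by rewrite !big_cons phiD phiZ IH.
pose v (x : X) := (phi (e x))^*%C.
have bound s : uniq s -> \sum_(x <- s) normc (v x) ^+ 2 <= M ^+ 2.
  move=> us; set S := \sum_(x <- s) _.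
  have S0 : 0 <= S by apply: sumr_ge0 => x _; exact: sqr_ge0.
  have phiS : phi (partial_sum s v) = S%:C%C.
    rewrite phi_sum /S rmorph_sum /=; apply: eq_bigr => x _.
    by rewrite -[phi (e x)]conjcK -/(v x) rmorphXn -sqr_normc.
  have := phiM (partial_sum s v); rewrite phiS.
  have := partial_sum_norm v us; rewrite -/S => nS.
  have -> : normc S%:C%C = S by rewrite /= expr0n addr0 sqrtr_sqr ger0_norm.
  rewrite -nS; have := l2norm_ge0 (partial_sum s v).
  set t := l2norm _ => t0 tM; rewrite ler_sqr ?nnegrE//.
  have [t1|t1] := eqVneq t 0; first by rewrite t1.
  have tt : 0 < t by rewrite lt_neqAle eq_sym t1.
  by move: tM; rewrite expr2 ler_pM2r.
have vM : (l2sq v <= (M ^+ 2)%:E)%E.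
  apply: ge_ereal_sup => _ [A [finA _] <-].
  rewrite fsbig_finite//= sumEFin lee_fin; apply: bound; exact: finmap.fset_uniq.
have vl2 : v \in @l2pred R X by apply: le_lt_trans vM _; exact: ltry.
have vn : l2norm (L2 vl2) <= M.
  rewrite -ler_sqr ?nnegrE ?l2norm_ge0// -lee_fin -l2sqE; exact: vM.
exists (L2 vl2) => // f.
have fin s : uniq s -> phi (partial_sum s f) = inner (partial_sum s f) (L2 vl2).
  move=> us; rewrite phi_sum inner_partial_sum; apply: eq_bigr => x _.
  by rewrite /= /v conjcK.
apply/eqP; rewrite -subr_eq0; apply/eqP/eq0_normc/eqP; rewrite -normr_le0.
rewrite ger0_norm ?normc_ge0//; apply/ler_addgt0Pl => d d0; rewrite addr0.
(* [phi] and the inner product with [v] are both bounded by [M], whence [M + M]; the [1] keeps the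
   denominator positive when [M = 0]. *)
have d20 : 0 < d / (M + M + 1).
  by rewrite divr_gt0//; lra.
have [s us sd] := partial_sum_dense f d20.
set g := partial_sum s f in sd.
have -> : phi f - inner f (L2 vl2) = phi (f - g) - inner (f - g) (L2 vl2).
  rewrite phiD innerBl -(scaleN1r g) phiZ mulN1r fin// -/g.
  by ring.
apply: le_trans (normcD _ _) _; rewrite normcN.
apply: le_trans (lerD (phiM _) (cauchy_schwarz _ _)) _.
have n0 := l2norm_ge0 (f - g).
have : l2norm (f - g) * (M + M + 1) <= d by rewrite -ler_pdivlMr//; lra.
by nra.
Qed.

End basis_theory.

(** * Complex Householder reflections *)

Section householder.
Variables (R : realType) (X : choiceType).
Local Notation H := (l2 R X).
Implicit Types (f g h p q d : H).

Lemma unitary_l2norm (u : H -> H) f : unitary u -> l2norm (u f) = l2norm f.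
Proof. by move=> uu; have := unitary_norm f uu; rewrite !normE => /complexI. Qed.

Lemma unitaryB (u : H -> H) f g : unitary u -> u (f - g) = u f - u g.
Proof.
move=> [ul _ _]; have := ul (-1) g f.
by rewrite !scaleN1r [f - g]addrC => ->; rewrite addrC.
Qed.

(** Expanding the inner products leaves a multiple of the difference of the two sides of the
    hypothesis. The same identity makes the map with the conjugate factor an inverse. *)
Lemma rank_one_unitary (k : R[i]) d :
  k + k^*%C = k * k^*%C * inner d d -> unitary (fun x => x - (k * inner x d) *: d).
Proof.
move=> kE.
have lin (c : R[i]) : linear (fun x => x - (c * inner x d) *: d : H).
  move=> a f g /=; rewrite innerDl innerZl mulrDr scalerDl scalerBr opprD.
  by rewrite addrACA scalerA (mulrCA c a).
have inv (c c' : R[i]) : c + c' = c * c' * inner d d ->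
    cancel (fun x => x - (c * inner x d) *: d : H) (fun x => x - (c' * inner x d) *: d).
  move=> cc x /=; rewrite innerBl innerZl -addrA -opprD -scalerDl.
  have -> : c * inner x d + c' * (inner x d - c * inner x d * inner d d) =
      (c + c' - c * c' * inner d d) * inner x d by ring.
  by rewrite cc subrr mul0r scale0r subr0.
split; first exact: lin.
- move=> f g; rewrite !(innerBl, innerBr, innerZl, innerZr) conjcM.
  rewrite -(inner_conj g d).
  transitivity (inner f g -
      (k + k^*%C - k * k^*%C * inner d d) * (inner f d * inner d g)); first by ring.
  by rewrite kE subrr mul0r subr0.
- exists (fun x => x - (k^*%C * inner x d) *: d); apply: inv => //.
  by rewrite addrC kE [k * _]mulrC.
Qed.

(** For [d = p - q] the factor [2 / <d, d>] of a real reflection sends [p] to [q] only if [<p, q>]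
    is real. The factor [1 / <p, d>] always does, and equal norms give [<d, d> = <p, d> + <d, p>],
    which makes the map unitary. *)
Lemma householder p q : l2norm p = l2norm q -> exists r : H -> H,
  [/\ unitary r, r p = q & forall x, inner x p = 0 -> inner x q = 0 -> r x = x].
Proof.
move=> npq; have [<-|pq] := eqVneq p q.
  by exists id; split=> //; exact: unitary_id.
pose d := p - q.
have dE : inner d d = inner p d + inner d p.
  rewrite /d !innerBl !innerBr.
  have -> : inner q q = inner p p by rewrite !inner_normE npq.
  by ring.
have dN0 : inner d d != 0.
  rewrite inner_normE; apply/eqP => /complexI /eqP; rewrite expf_eq0 /= => /eqP.
  by move=> /l2norm_eq0 /eqP; rewrite subr_eq0 (negPf pq).
have pN0 : inner p d != 0.
  by apply: contra dN0 => /eqP h; rewrite dE (inner_conj p d) h conjc0 addr0.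
have pN0' : (inner p d)^*%C != 0 by rewrite conjc_eq0.
exists (fun x => x - ((inner p d)^-1 * inner x d) *: d); split.
- apply: rank_one_unitary; rewrite conjc_inv dE (inner_conj p d).
  by field; rewrite pN0 pN0'.
- by rewrite mulVf// scale1r /d opprB addrC subrK.
- by move=> x xp xq; rewrite /d (innerBr x) xp xq subrr mulr0 scale0r subr0.
Qed.

End householder.

Section gram.
Variables (R : realType) (X : choiceType).
Local Notation H := (l2 R X).

Lemma orthonormal_norm (I : eqType) (e : I -> H) i :
  (forall i j, inner (e i) (e j) = (i == j)%:R) -> l2norm (e i) = 1.
Proof.
move=> /(_ i i); rewrite eqxx inner_normE => /complexI /eqP.
rewrite sqrf_eq1 => /orP[/eqP //|/eqP h].
by have := l2norm_ge0 (e i); rewrite h; lra.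
Qed.

Lemma normc_real (r : R) : normc r%:C%C = `|r|.
Proof. by rewrite /= expr0n addr0 sqrtr_sqr. Qed.

(* Gram-Schmidt orthogonalization of [y], one reflection for each vector. *)
Lemma near_orthonormal (I : eqType) (e : I -> H) (s : seq I) (eps : R) :
  (forall i j, inner (e i) (e j) = (i == j)%:R) -> uniq s -> 0 < eps ->
  exists2 eta : R, 0 < eta & forall y : I -> H,
    (forall i j, i \in s -> j \in s ->
       normc (inner (y i) (y j) - (i == j)%:R) <= eta) ->
    exists2 a : H -> H, unitary a &
      forall i, i \in s -> l2norm (a (e i) - y i) <= eps.
Proof.
move=> orth; elim: s eps => [|k s IH] eps /=.
  move=> _ _; exists 1; rewrite ?ltr01// => y _.
  by exists id => //; exact: unitary_id.
move=> /andP[ks us] eps0; set N : R := (size s)%:R.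
have N0 : 0 <= N by rewrite ler0n.
(* With [N] earlier vectors the correction [S] has norm at most [3 N t] and normalization costs at
   most [t + 3 N t], together below [6 (N + 1) t <= eps]. The minimum with [1] keeps [v] away from
   0. *)
pose t := Num.min 1 eps / (6 * (N + 1)).
have m0 : 0 < Num.min 1 eps by rewrite lt_min ltr01.
have t0 : 0 < t by rewrite divr_gt0//; nra.
have tE : 6 * (N + 1) * t = Num.min 1 eps.
  by rewrite mulrC divfK// gt_eqF//; nra.
have t1 : 6 * (N + 1) * t <= 1 by rewrite tE ge_min lexx.
have teps : 6 * (N + 1) * t <= eps by rewrite tE ge_min lexx orbT.
have [eta' eta'0 etaP] := IH t us t0.
exists (Num.min eta' t) => [|y yP]; first by rewrite lt_min eta'0.
have [a ua aP] : exists2 a : H -> H, unitary a &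
    forall i, i \in s -> l2norm (a (e i) - y i) <= t.
  apply: etaP => i j si sj; apply: le_trans (yP i j _ _) _.
  - by rewrite inE si orbT.
  - by rewrite inE sj orbT.
  - by rewrite ge_min lexx.
have ae i : l2norm (a (e i)) = 1.
  by rewrite (unitary_l2norm _ ua) (orthonormal_norm _ orth).
have aorth i j : inner (a (e i)) (a (e j)) = (i == j)%:R.
  by case: ua => _ -> _; exact: orth.
have yt i j : i \in k :: s -> j \in k :: s ->
    normc (inner (y i) (y j) - (i == j)%:R) <= t.
  by move=> si sj; apply: le_trans (yP i j si sj) _; rewrite ge_min lexx orbT.
have yk2 : `|l2norm (y k) ^+ 2 - 1| <= t.
  have := yt k k (mem_head _ _) (mem_head _ _).
  by rewrite eqxx inner_normE -[1]/(1%:C%C) -rmorphB normc_real.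
have yk0 := l2norm_ge0 (y k); set r := l2norm (y k) in yk2 yk0.
have [yk1 yk3] : 1 - t <= r /\ r <= 1 + t.
  by move: yk2; rewrite ler_norml => /andP[]; nra.
have Nt0 : 0 <= N * t by rewrite mulr_ge0// ltW.
(* Small because [a (e i)] is near [y i], which is almost orthogonal to [y k]. *)
pose c i := inner (y k) (a (e i)).
have cP i : i \in s -> normc (c i) <= 3 * t.
  move=> si; have -> : c i = inner (y k) (y i) + inner (y k) (a (e i) - y i).
    by rewrite innerBr addrC subrK.
  apply: le_trans (normcD _ _) _.
  have := yt k i (mem_head _ _); rewrite inE si orbT => /(_ isT).
  have /negPf -> : k != i by apply: contraNneq ks => ->.
  rewrite subr0 => h1; have := cauchy_schwarz (y k) (a (e i) - y i).
  have := aP i si; have := l2norm_ge0 (a (e i) - y i); rewrite -/r.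
  by nra.
pose S := \sum_(i <- s) c i *: a (e i); pose v := y k - S.
have Sn : l2norm S <= 3 * (N * t).
  apply: le_trans (l2norm_sum _ _ _) _.
  have -> : 3 * (N * t) = \sum_(i <- s) 3 * t.
    by rewrite big_const_seq count_predT iter_addr_0 -mulr_natr -/N; ring.
  rewrite big_seq [leRHS]big_seq; apply: ler_sum => i si.
  by rewrite l2normZ ae mulr1; exact: cP.
have vorth i : i \in s -> inner (a (e i)) v = 0.
  move=> si; apply: (can_inj (@conjcK R)); rewrite -inner_conj conjc0 innerBl.
  rewrite /S inner_suml (bigD1_seq i) //= innerZl aorth eqxx mulr1 big1 ?addr0 ?subrr//.
  by move=> j /negPf ji; rewrite innerZl aorth ji mulr0.
have vn1 : r - l2norm S <= l2norm v.
  by have := l2normD v S; rewrite subrK -/r; lra.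
have vn2 : l2norm v <= r + l2norm S by exact: l2normB.
have v0 : 0 < l2norm v by lra.
pose q := ((l2norm v)^-1)%:C%C *: v.
have qn : l2norm q = 1.
  by rewrite l2normZ normc_real ger0_norm ?invr_ge0 ?(ltW v0)// mulVf// gt_eqF.
have qv : l2norm (q - v) <= t + 3 * (N * t).
  have -> : q - v = ((l2norm v)^-1 - 1)%:C%C *: v.
    by rewrite rmorphB scalerBl scale1r.
  rewrite l2normZ normc_real -[X in _ * X]ger0_norm ?l2norm_ge0// -normrM.
  by rewrite mulrBl mulVf ?gt_eqF// mul1r ler_norml; lra.
(* For [i] in [s], [a (e i)] is orthogonal to [a (e k)] and to [v], so this reflection leaves it in
   place. *)
have [b [ub bp bfix]] := householder (etrans (ae k) (esym qn)).
exists (b \o a); first exact: unitary_comp.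
move=> i /=; rewrite inE => /predU1P[->|si].
  rewrite bp; have -> : q - y k = (q - v) - S by rewrite /v -addrA -opprD subrK.
  by apply: le_trans (l2normB _ _) _; nra.
rewrite bfix.
- by apply: le_trans (aP i si) _; nra.
- by rewrite aorth; case: eqP => // ik; move: ks; rewrite -ik si.
- by rewrite /q innerZr vorth// mulr0.
Qed.

End gram.

(** * Families with prescribed Gram matrix *)

Section spectral_sums.
Variable R : realType.
Local Notation C := R[i].

Lemma conj_conjc (z : C) : (z^* = z^*%C)%R.
Proof. by []. Qed.

(** The spectral theorem as scalar sums, ready to be contracted with families of vectors. The rows
    of [p] are the conjugates of the eigenvectors. *)
Lemma spectral_sums n (A : 'M[C]_n) :
  (forall i j, A j i = (A i j)^*%C) ->
  (forall c : 'I_n -> C, 0 <= \sum_i \sum_j c i * (c j)^*%C * A i j) ->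
  exists (p : 'I_n -> 'I_n -> C) (d : 'I_n -> R), [/\
    forall k, 0 <= d k,
    forall i j, \sum_k (p k i)^*%C * p k j = (i == j)%:R,
    forall i j, A i j = \sum_k (p k i)^*%C * (d k)%:C%C * p k j &
    forall k l, \sum_i \sum_j p k i * (p l j)^*%C * A i j = (k == l)%:R * (d k)%:C%C].
Proof.
move=> Aherm Apsd.
have At : (A ^t Num.conj)%sesqui = A.
  by apply/matrixP => i j; rewrite !mxE conj_conjc -Aherm.
have An : A \is normalmx by apply/normalmxP; rewrite At.
have /orthomx_spectralP AE := An.
have uP := spectral_unitarymx A; set P := spectralmx A in AE uP.
rewrite invmx_unitary// in AE.
have PP : P *m (P ^t Num.conj)%sesqui = 1%:M by exact/unitarymxP.
have PP' : (P ^t Num.conj)%sesqui *m P = 1%:M by apply: mulmx1C.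
have PAP : P *m A *m (P ^t Num.conj)%sesqui = diag_mx (spectral_diag A).
  by rewrite {1}AE !mulmxA PP mul1mx -mulmxA PP mulmx1.
have F4 k l : \sum_i \sum_j P k i * (P l j)^*%C * A i j =
    diag_mx (spectral_diag A) k l.
  rewrite -PAP !mxE exchange_big /=; apply: eq_bigr => j _.
  rewrite !mxE mulr_suml; apply: eq_bigr => i _.
  by rewrite conj_conjc mulrAC.
have d0 k : 0 <= spectral_diag A 0 k.
  have := Apsd (P k); rewrite (F4 k k) mxE eqxx mulr1n; exact.
have dE k : (complex.Re (spectral_diag A 0 k))%:C%C = spectral_diag A 0 k.
  by apply: RRe_real; apply: ger0_real.
exists P, (fun k => complex.Re (spectral_diag A 0 k)); split.
- by move=> k; rewrite -ler0c dE.
- move=> i j; have /matrixP/(_ i j) := PP'; rewrite !mxE => <-.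
  by apply: eq_bigr => k _; rewrite !mxE conj_conjc.
- move=> i j; rewrite {1}AE mxE; apply: eq_bigr => k _.
  rewrite mul_mx_diag mxE !mxE conj_conjc; congr (_ * _ * _).
  by rewrite dE.
- by move=> k l; rewrite F4 mxE dE; case: eqP => _; rewrite ?mulr1n ?mul1r ?mulr0n ?mul0r.
Qed.

End spectral_sums.

Section gram_theorem.
Variables (R : realType) (X : choiceType).
Local Notation H := (l2 R X).
Local Notation C := R[i].

Lemma normc_sum (I : Type) (r : seq I) (P : pred I) (F : I -> C) :
  normc (\sum_(i <- r | P i) F i) <= \sum_(i <- r | P i) normc (F i).
Proof.
elim/big_ind2: _ => //; first by rewrite normc0.
by move=> a b c d ab cd; apply: le_trans (normcD _ _) _; exact: lerD.
Qed.

Lemma le_term_sum (I : finType) (F : I -> R) i :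
  (forall j, 0 <= F j) -> F i <= \sum_j F j.
Proof. by move=> F0; rewrite (bigD1 i) //= lerDl sumr_ge0. Qed.

(* Diagonalizing [A] reduces the claim to nearly orthogonal families. *)
Lemma gram_realization (e : nat -> H) n (A : 'M[C]_n) :
  (forall i j, inner (e i) (e j) = (i == j)%:R) ->
  (forall i j, A j i = (A i j)^*%C) ->
  (forall c : 'I_n -> C, 0 <= \sum_i \sum_j c i * (c j)^*%C * A i j) ->
  exists z : 'I_n -> H, (forall i j, inner (z i) (z j) = A i j) /\
    forall eps : R, 0 < eps -> exists2 eta : R, 0 < eta & forall x : 'I_n -> H,
      (forall i j, normc (inner (x i) (x j) - A i j) <= eta) ->
      exists2 a : H -> H, unitary a & forall i, l2norm (a (z i) - x i) <= eps.
Proof.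
move=> orth Aherm Apsd.
have [p [d [d0 pV AE pA]]] := spectral_sums Aherm Apsd.
pose s k : R := Num.sqrt (d k).
have s0 k : 0 <= s k by exact: sqrtr_ge0.
have ss k : s k * s k = d k by rewrite -expr2 sqr_sqrtr.
have orth' (i j : 'I_n) : inner (e i) (e j) = (i == j)%:R by exact: orth.
(* With [P] the matrix of [p] and [D] the diagonal of [d], these are the rows of the factor
   [P^* sqrt D] of [A], read in the orthonormal family [e]. *)
pose z i := \sum_k (p k i)^*%C *: ((s k)%:C%C *: e (k : 'I_n)).
exists z; split.
  move=> i j; rewrite /z inner_suml AE; apply: eq_bigr => k _.
  rewrite inner_sumr (bigD1 k) //= big1 ?addr0.
    rewrite !(innerZl, innerZr) orth' eqxx conjc_real conjcK mulr1.
    by rewrite -ss rmorphM /=; ring.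
  by move=> l /negPf lk; rewrite !(innerZl, innerZr) orth' eq_sym lk !mulr0.
move=> eps eps0.
(* [B] bounds the passage to eigen-coordinates and back, [Q] the normalizing factors and [S] the
   rescaling. The inverse of 0 is 0, so null directions add nothing to [Q]. *)
pose B := \sum_k \sum_i normc (p k i).
have pB k : \sum_i normc (p k i) <= B.
  by apply: (le_term_sum (F := fun k => \sum_i normc (p k i))) => l;
    apply: sumr_ge0 => i _; exact: normc_ge0.
have pB' i : \sum_k normc (p k i) <= B.
  rewrite /B exchange_big /=.
  by apply: (le_term_sum (F := fun i => \sum_k normc (p k i))) => l;
    apply: sumr_ge0 => k _; exact: normc_ge0.
have B0 : 0 <= B by apply: sumr_ge0 => k _; apply: sumr_ge0 => i _; exact: normc_ge0.
pose Q := \sum_k (s k)^-1; pose S := \sum_k s k.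
have Q0 : 0 <= Q by apply: sumr_ge0 => k _; rewrite invr_ge0.
have S0 : 0 <= S by exact: sumr_ge0.
have sQ k : (s k)^-1 <= Q.
  by apply: (le_term_sum (F := fun k => (s k)^-1)) => l; rewrite invr_ge0.
have sS k : s k <= S by exact: le_term_sum.
pose tau := eps / (B + 1).
have B10 : 0 < B + 1 by rewrite ltr_wpDl.
have S10 : 0 < S + 1 by rewrite ltr_wpDl.
have tau0 : 0 < tau by rewrite divr_gt0.
have tauE : tau * (B + 1) = eps by rewrite divfK// gt_eqF.
(* Only the directions with positive eigenvalue can be normalized and matched with the orthonormal
   family. *)
pose r := [seq k <- enum 'I_n | 0 < d k].
have ur : uniq r by rewrite filter_uniq// enum_uniq.
have tS0 : 0 < tau / (S + 1) by rewrite divr_gt0.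
have [eta0 eta00 etaP] := near_orthonormal orth' ur tS0.
(* One [eta] serves twice: [B ^+ 2 * Q ^+ 2 * eta] bounds the Gram error after normalization, and
   [B ^+ 2 * eta] the squared length left in a null direction. *)
pose K := (B ^+ 2 + 1) * (Q ^+ 2 + 1).
have B2 : 0 <= B ^+ 2 by exact: sqr_ge0.
have Q2 : 0 <= Q ^+ 2 by exact: sqr_ge0.
have K0 : 0 < K by rewrite mulr_gt0// ltr_wpDl.
pose eta := Num.min eta0 (tau ^+ 2) / K.
have m0 : 0 < Num.min eta0 (tau ^+ 2) by rewrite lt_min eta00 exprn_gt0.
have etag0 : 0 < eta by rewrite divr_gt0.
have etaK : eta * K = Num.min eta0 (tau ^+ 2) by rewrite divfK// gt_eqF.
have BQ0 : 0 <= B ^+ 2 * Q ^+ 2 * eta := mulr_ge0 (mulr_ge0 B2 Q2) (ltW etag0).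
have B20 : 0 <= B ^+ 2 * eta := mulr_ge0 B2 (ltW etag0).
have Q20 : 0 <= Q ^+ 2 * eta := mulr_ge0 Q2 (ltW etag0).
have KE : eta * K = B ^+ 2 * Q ^+ 2 * eta + B ^+ 2 * eta + Q ^+ 2 * eta + eta.
  by rewrite /K; ring.
have eta1 : B ^+ 2 * Q ^+ 2 * eta <= eta0.
  have : Num.min eta0 (tau ^+ 2) <= eta0 by rewrite ge_min lexx.
  by rewrite -etaK KE; lra.
have eta2 : B ^+ 2 * eta <= tau ^+ 2.
  have : Num.min eta0 (tau ^+ 2) <= tau ^+ 2 by rewrite ge_min lexx orbT.
  by rewrite -etaK KE; lra.
exists eta => // x xA.
pose y k := \sum_i p k i *: x i.
have yA k l : normc (inner (y k) (y l) - (k == l)%:R * (d k)%:C%C) <= B ^+ 2 * eta.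
  have -> : inner (y k) (y l) - (k == l)%:R * (d k)%:C%C =
      \sum_i \sum_j p k i * (p l j)^*%C * (inner (x i) (x j) - A i j).
    rewrite -pA /y inner_suml -sumrB; apply: eq_bigr => i _.
    rewrite inner_sumr -sumrB; apply: eq_bigr => j _.
    by rewrite innerZl innerZr; ring.
  have -> : B ^+ 2 * eta = B * (B * eta) by ring.
  apply: le_trans (normc_sum _ _ _) _.
  apply: (@le_trans _ _ (\sum_i normc (p k i) * (B * eta))); last first.
    by rewrite -mulr_suml ler_wpM2r// mulr_ge0// ltW.
  apply: ler_sum => i _; apply: le_trans (normc_sum _ _ _) _.
  apply: (@le_trans _ _ (\sum_j normc (p k i) * (normc (p l j) * eta))); last first.
    by rewrite -mulr_sumr ler_wpM2l ?normc_ge0// -mulr_suml ler_wpM2r// ltW.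
  apply: ler_sum => j _; rewrite !normcM normc_conj mulrA ler_wpM2l//.
  by rewrite mulr_ge0 ?normc_ge0.
have [a ua aP] : exists2 a : H -> H, unitary a &
    forall i : 'I_n, i \in r -> l2norm (a (e i) - (s i)^-1%:C%C *: y i) <= tau / (S + 1).
  apply: etaP => k l; rewrite !mem_filter => /andP[dk _] /andP[dl _].
  have sk : 0 < s k by rewrite sqrtr_gt0.
  have sl : 0 < s l by rewrite sqrtr_gt0.
  have -> : inner ((s k)^-1%:C%C *: y k) ((s l)^-1%:C%C *: y l) - (k == l)%:R =
      ((s k)^-1 * (s l)^-1)%:C%C * (inner (y k) (y l) - (k == l)%:R * (d k)%:C%C).
    rewrite innerZl innerZr conjc_real mulrBr; congr (_ - _).
      by rewrite [in RHS]rmorphM /= mulrA.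
    case: eqP => [<-|_]; last by rewrite mul0r mulr0.
    by rewrite mul1r -rmorphM /= -ss mulrA mulfVK ?mulVf ?gt_eqF.
  rewrite normcM normc_real ger0_norm ?mulr_ge0 ?invr_ge0//.
  apply: le_trans eta1; have -> : B ^+ 2 * Q ^+ 2 * eta = (Q * Q) * (B ^+ 2 * eta) by ring.
  by apply: ler_pM => //; rewrite ?normc_ge0 ?mulr_ge0 ?invr_ge0// ler_pM ?invr_ge0.
exists a => // i.
have xE : x i = \sum_k (p k i)^*%C *: y k.
  transitivity (\sum_j (\sum_k (p k i)^*%C * p k j) *: x j).
    rewrite (bigD1 i) //= pV eqxx scale1r big1 ?addr0// => j /negPf ji.
    by rewrite pV eq_sym ji scale0r.
  under eq_bigr do rewrite scaler_suml.
  rewrite exchange_big /=; apply: eq_bigr => k _.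
  by rewrite /y scaler_sumr; apply: eq_bigr => j _; rewrite scalerA.
have [al _ _] := ua.
have a0 : a 0 = 0 by have := al (-1) 0 0; rewrite scaler0 addr0 scaleN1r addNr.
have aD f g : a (f + g) = a f + a g by rewrite -[f]scale1r al !scale1r.
have aZ c f : a (c *: f) = c *: a f by rewrite -[X in a X]addr0 al a0 addr0.
have -> : a (z i) - x i = \sum_k (p k i)^*%C *: (a ((s k)%:C%C *: e k) - y k).
  rewrite xE /z (big_morph a aD a0) -sumrB; apply: eq_bigr => k _.
  by rewrite aZ scalerBr.
apply: le_trans (l2norm_sum _ _ _) _.
apply: (@le_trans _ _ (\sum_k normc (p k i) * tau)).
  apply: ler_sum => k _; rewrite l2normZ normc_conj ler_wpM2l ?normc_ge0//.
  have [dk|] := ltP 0 (d k).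
    have sk : 0 < s k by rewrite sqrtr_gt0.
    have -> : a ((s k)%:C%C *: e k) - y k =
        (s k)%:C%C *: (a (e k) - (s k)^-1%:C%C *: y k).
      by rewrite aZ scalerBr scalerA -rmorphM /= mulfV ?gt_eqF// scale1r.
    rewrite l2normZ normc_real ger0_norm//.
    have : l2norm (a (e k) - (s k)^-1%:C%C *: y k) <= tau / (S + 1).
      by apply: aP; rewrite mem_filter dk mem_enum.
    move=> /(ler_wpM2l (s0 k)) /le_trans; apply.
    rewrite mulrA ler_pdivrMr// mulrC ler_wpM2l ?(ltW tau0)//.
    by apply: le_trans (sS k) _; rewrite lerDl.
  (* In a null direction [z] has no component and [y k] itself is short. *)
  move=> dk; have d00 : d k = 0 by apply/eqP; rewrite eq_le dk d0.
  rewrite /s d00 sqrtr0 scale0r a0 sub0r l2normN.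
  rewrite -ler_sqr ?nnegrE ?l2norm_ge0 ?(ltW tau0)//.
  apply: le_trans eta2; apply: le_trans (yA k k).
  by rewrite d00 mulr0 subr0 inner_normE normc_real ler_norm.
rewrite -mulr_suml -tauE mulrC ler_wpM2l ?(ltW tau0)//.
by apply: le_trans (pB' i) _; rewrite lerDl.
Qed.

End gram_theorem.

(** * Weak topologies *)

Section weak_topology.
Variables (R : realType) (X : choiceType).
Local Notation H := (l2 R X).
Implicit Types (f g h : H).

(* The real parts determine the weak topology: [Im <f, g> = Re <f, i g>]. *)
Definition re_inner f g : R := complex.Re (inner f g).

Lemma Im_inner f g : complex.Im (inner f g) = re_inner f ('i%C *: g).
Proof. by rewrite /re_inner innerZr; case: (inner f g) => a b /=; ring. Qed.

Lemma re_inner_eq f f' : (forall g, re_inner f g = re_inner f' g) -> f = f'.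
Proof.
move=> ff'; apply: inner_eq => g; have := ff' g; have := ff' ('i%C *: g).
rewrite -!Im_inner /re_inner; case: (inner f g) => a b; case: (inner f' g) => c d /=.
by move=> -> ->.
Qed.

Lemma re_innerC f g : re_inner f g = re_inner g f.
Proof. by rewrite /re_inner (inner_conj g f); case: (inner g f). Qed.

Lemma re_innerDl f g h : re_inner (f + g) h = re_inner f h + re_inner g h.
Proof. by rewrite /re_inner innerDl raddfD. Qed.

Lemma re_innerDr f g h : re_inner f (g + h) = re_inner f g + re_inner f h.
Proof. by rewrite /re_inner innerDr raddfD. Qed.

Lemma re_innerBl f g h : re_inner (f - g) h = re_inner f h - re_inner g h.
Proof. by rewrite /re_inner innerBl raddfB. Qed.

Lemma re_inner_bound f g : `|re_inner f g| <= l2norm f * l2norm g.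
Proof. by apply: le_trans (cauchy_schwarz f g); exact: normc_Re. Qed.

Lemma normc_le_ReIm (z : R[i]) : normc z <= `|complex.Re z| + `|complex.Im z|.
Proof.
case: z => a b /=; rewrite -ler_sqr ?nnegrE ?sqrtr_ge0 ?addr_ge0//.
rewrite sqr_sqrtr ?addr_ge0 ?sqr_ge0// sqrrD !real_normK ?num_real//.
by rewrite addrAC lerDl mulrn_wge0// mulr_ge0.
Qed.

Lemma complex_normE (z : R[i]) : `|z| = (normc z)%:C%C.
Proof. by []. Qed.

Lemma cvg_complexP (T : Type) (F : set_system T) (u : T -> R[i]) (z : R[i]) : Filter F ->
  (u @ F --> (z : R[i]^o)) <->
  ((fun t => complex.Re (u t)) @ F --> complex.Re z) /\
  ((fun t => complex.Im (u t)) @ F --> complex.Im z).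
Proof.
move=> FF; split=> [uz|[uR uI]].
  have uz' (e : R) : 0 < e -> \forall t \near F, normc (z - u t) < e.
    move=> e0; have e0' : 0 < e%:C%C :> R[i] by rewrite ltcR.
    have := @cvgr_dist_lt _ _ _ _ FF (u : T -> R[i]^o) z uz _ e0'.
    by apply: filterS => t; rewrite complex_normE ltcR.
  split; apply/cvgrPdist_lt => e e0; apply: filterS (uz' e e0) => t;
    apply: le_lt_trans.
    by rewrite -raddfB; exact: normc_Re.
  by rewrite -raddfB; exact: normc_Im.
apply/(@cvgrPdist_lt _ (R[i]^o) T F FF u z) => e; rewrite ltcE => /andP[/eqP eI e0] /=.
have e20 : 0 < complex.Re e / 2 by rewrite divr_gt0.
have := @filterI _ _ FF _ _ (@cvgr_dist_lt _ _ _ _ FF _ _ uR _ e20) (@cvgr_dist_lt _ _ _ _ FF _ _ uI _ e20).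
apply: filterS => t [tR tI]; rewrite complex_normE ltcE /= eI eqxx /=.
apply: le_lt_trans (normc_le_ReIm _) _; rewrite !raddfB /= (splitr (complex.Re e)).
exact: ltrD.
Qed.

Lemma cvg_weakP (T : Type) (F : set_system T) (u : T -> H) (f : H) : Filter F ->
  (u : T -> l2_weak R X) @ F --> (f : l2_weak R X) <->
  forall g, (fun t => re_inner (u t) g) @ F --> re_inner f g.
Proof.
move=> FF.
have FuF : Filter ((u : T -> l2_weak R X) @ F) by exact: fmap_filter.
split=> [uf g|uf].
  have /cvg_initialP/cvg_ptwsP /(_ g) : (u : T -> l2_weak R X) @ F --> (f : l2_weak R X) := uf.
  by move=> /(@cvg_complexP T F (fun t => inner (u t) g) (inner f g))[].
apply/cvg_initialP; apply/cvg_ptwsP => g.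
apply/(@cvg_complexP T F (fun t => inner (u t) g) (inner f g)); split; first exact: uf.
have := uf ('i%C *: g); rewrite -Im_inner.
by under eq_fun do rewrite -Im_inner.
Qed.

Lemma ultra_cvg (T : Type) (F : set_system T) (K : topologicalType) (A : set K)
    (u : T -> K) : UltraFilter F -> compact A -> (forall t, A (u t)) ->
  exists2 x, A x & u @ F --> x.
Proof.
move=> FU Ac uA; have FF : ProperFilter F := @ultra_proper _ _ FU.
have FA : (u @ F) A by suff : \forall t \near F, A (u t) by []; exact: filterE.
have [x [Ax Fx]] := Ac _ (fmap_proper_filter u _) FA.
exists x => // B xB; have [//|nB] := in_ultra_setVsetC (u @^-1` B) FU.
have [y [nBy By]] := Fx (~` B) B nB xB.
by case: nBy.
Qed.

End weak_topology.

(** * Weak compactness of balls and of contractions *)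

Section weak_compactness.
Variables (R : realType) (X : discreteTopologicalType).
Local Notation H := (l2 R X).
Implicit Types (f g h : H).

(** Banach-Alaoglu by ultrafilters: every real coordinate converges in a segment, and the limits
    form the real part of a bounded functional, to which [riesz] applies. *)
Lemma weak_ultra_limit (T : Type) (F : set_system T) (u : T -> H) (M : R) :
  UltraFilter F -> (forall t, l2norm (u t) <= M) ->
  exists2 v : H, l2norm v <= M &
    forall g, (fun t => re_inner (u t) g) @ F --> re_inner v g.
Proof.
move=> FU uM; have FF : ProperFilter F := @ultra_proper _ _ FU.
have M0 : 0 <= M by have [t _] := filter_ex (@filterT _ F _); exact: le_trans (l2norm_ge0 _) (uM t).
have lim_ex g : exists b : R, `|b| <= M * l2norm g /\
    (fun t => re_inner (u t) g) @ F --> b.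
  pose m := M * l2norm g.
  have [|x] := @ultra_cvg T F R `[- m, m] (fun t => re_inner (u t) g) FU
    (@segment_compact R (- m) m).
    move=> t; rewrite /= in_itv /= -ler_norml.
    apply: le_trans (re_inner_bound _ _) _.
    by rewrite ler_wpM2r ?l2norm_ge0.
  by rewrite /= in_itv /= -ler_norml => xm xl; exists x.
have [b bP] := choice lim_ex.
have bcvg g := (bP g).2.
have uniq_lim (x y : R) (w : T -> R) : w @ F --> x -> w @ F --> y -> x = y.
  by move=> wx wy; apply: (cvg_unique _ wx wy); exact: Rhausdorff.
have bD g h : b (g + h) = b g + b h.
  apply: (uniq_lim _ _ _ (bcvg _)).
  under eq_fun do rewrite re_innerDr.
  exact: cvgD (bcvg g) (bcvg h).
have bZ (a : R) g : b (a%:C%C *: g) = a * b g.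
  apply: (uniq_lim _ _ _ (bcvg _)).
  have E t : re_inner (u t) (a%:C%C *: g) = a * re_inner (u t) g.
    rewrite /re_inner innerZr conjc_real.
    by case: (inner (u t) g) => x y /=; rewrite mul0r subr0.
  under eq_fun do rewrite E.
  exact: cvgM (cvg_cst a) (bcvg g).
(* A complex linear functional is recovered from its real part [b]: its imaginary part at [g] is its
   real part at [- i g]. *)
pose phi g : R[i] := Complex (b g) (b (- 'i%C *: g)).
have bN g : b (- g) = - b g.
  by have := bZ (-1) g; rewrite rmorphN1 scaleN1r mulN1r.
have phil c f g : phi (c *: f + g) = c * phi f + phi g.
  rewrite /phi; case: c => x y.
  have cE : (x +i* y)%C = x%:C%C + y%:C%C * 'i%C by apply/eqP; rewrite eq_complex /=; apply/andP; split; apply/eqP; ring.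
  have -> : (x +i* y)%C *: f + g = x%:C%C *: f + y%:C%C *: ('i%C *: f) + g.
    by rewrite cE scalerDl scalerA.
  rewrite !scalerDr !bD bZ bZ.
  have -> : - 'i%C *: (x%:C%C *: f) = x%:C%C *: (- 'i%C *: f).
    by rewrite !scalerA mulrC.
  have -> : - 'i%C *: (y%:C%C *: ('i%C *: f)) = y%:C%C *: f.
    rewrite !scalerA; congr (_ *: _); apply/eqP; rewrite eq_complex /=.
    by apply/andP; split; apply/eqP; ring.
  rewrite !bZ scaleNr bN.
  by apply/eqP; rewrite eq_complex /=; apply/andP; split; apply/eqP; ring.
have phiM f : normc (phi f) <= M * l2norm f.
  have [->|n0] := eqVneq (normc (phi f)) 0; first by rewrite mulr_ge0 ?l2norm_ge0.
  have np : 0 < normc (phi f) by rewrite lt_neqAle eq_sym n0 normc_ge0.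
  (* Multiplying [f] by the conjugate of [phi f] makes the value real and nonnegative, so the bound
     on [b] becomes a bound on the modulus. *)
  pose c := (phi f)^*%C.
  have phiE : phi (c *: f) = ((normc (phi f)) ^+ 2)%:C%C.
    have := phil c f 0; rewrite addr0 => ->.
    have -> : phi 0 = 0 by have := phil (-1) 0 0; rewrite scaler0 addr0 mulN1r addNr.
    by rewrite addr0 mulrC -sqr_normc rmorphXn.
  have bE : b (c *: f) = (normc (phi f)) ^+ 2 by have := congr1 (@complex.Re R) phiE.
  have := (bP (c *: f)).1; rewrite bE l2normZ /c normc_conj.
  rewrite ger0_norm ?sqr_ge0// expr2 mulrCA ler_pM2l//.
have [v vM vP] := riesz M0 phil phiM.
exists v => // g; have -> : re_inner v g = b g by rewrite re_innerC /re_inner -vP.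
exact: bcvg.
Qed.

Lemma unit_ball_norm (f : unit_ball R X) : l2norm (val f : H) <= 1.
Proof. by have := set_valP f; rewrite /= normE -[1]/(1%:C%C) lecR. Qed.

Lemma unit_ball_compact : compact [set: unit_ball R X].
Proof.
rewrite compact_ultra => F FU _.
have [v v1 vP] := weak_ultra_limit FU unit_ball_norm.
have vB : (v : l2_weak R X) \in [set f : l2_weak R X | `|f : H| <= 1].
  by apply: mem_set; rewrite /= normE -[1]/(1%:C%C) lecR.
exists (exist _ (v : l2_weak R X) vB); split=> //.
have FF : ProperFilter F := @ultra_proper _ _ FU.
apply/cvg_set_typeP.
exact/(@cvg_weakP R X _ F (fun f : unit_ball R X => val f : H) v).
Qed.

Lemma contractions_norm (T : contractions R X) f :
  l2norm (val T f : H) <= l2norm f.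
Proof. by have [_ /(_ f)] := set_valP T; rewrite !normE lecR. Qed.

Lemma cvg_contractionsP (F : set_system (contractions R X)) (T : contractions R X) :
  Filter F ->
  F --> T <-> forall f g,
    (fun S : contractions R X => re_inner (val S f : H) g) @ F --> re_inner (val T f : H) g.
Proof.
move=> FF; split=> [/cvg_set_typeP/cvg_ptwsP FT f g|FT].
  exact: ((@cvg_weakP R X _ F (fun S : contractions R X => val S f : H) _ FF).1 (FT f) g).
apply/cvg_set_typeP; apply/cvg_ptwsP => f.
apply/(@cvg_weakP R X _ F (fun S : contractions R X => val S f : H)) => g.
exact: FT.
Qed.

Lemma contractions_coord_continuous f g :
  continuous (fun T : contractions R X => re_inner (val T f : H) g).
Proof.
by move=> T; have /cvg_contractionsP : nbhs T --> T by []; apply.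
Qed.

Lemma contractions_compact : compact [set: contractions R X].
Proof.
rewrite compact_ultra => F FU _; have FF : ProperFilter F := @ultra_proper _ _ FU.
have lim_ex f : exists v : H, l2norm v <= l2norm f /\ forall g,
    (fun S : contractions R X => re_inner (val S f : H) g) @ F --> re_inner v g.
  have [v v1 v2] := weak_ultra_limit FU (fun S => contractions_norm S f).
  by exists v.
have [T TP] := choice lim_ex.
have Tc : Defs.contraction T.
  split; last by move=> f; rewrite !normE lecR; have [] := TP f.
  move=> c f f'; apply: re_inner_eq => g.
  have [_ /(_ g) h1] := TP (c *: f + f').
  have [_ /(_ (c^*%C *: g)) h2] := TP f; have [_ /(_ g) h3] := TP f'.
  have -> : re_inner (c *: T f + T f') g = re_inner (T f) (c^*%C *: g) + re_inner (T f') g.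
    by rewrite re_innerDl /re_inner innerZl innerZr conjcK.
  have E (S : contractions R X) : re_inner (val S (c *: f + f') : H) g =
      re_inner (val S f : H) (c^*%C *: g) + re_inner (val S f' : H) g.
    have [Sl _] := set_valP S.
    have -> : val S (c *: f + f') = c *: (val S f : H) + (val S f' : H) by exact: Sl.
    by rewrite re_innerDl [in LHS]/re_inner innerZl /re_inner innerZr conjcK.
  rewrite (funext E) in h1.
  by apply: (cvg_unique _ h1 (cvgD h2 h3)); exact: Rhausdorff.
exists (exist _ (T : {ptws H -> l2_weak R X}) (mem_set Tc)); split=> //.
by apply/cvg_contractionsP => f g; have [_] := TP f; apply.
Qed.

Lemma contractions_separated (S T : contractions R X) :
  (forall f g, re_inner (val S f : H) g = re_inner (val T f : H) g) -> S = T.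
Proof.
by move=> ST; apply: val_inj; apply/funext => f; apply: re_inner_eq => g; exact: ST.
Qed.

End weak_compactness.

(** * The unitary group *)

Section unitary_topology.
Variables (R : realType) (X : choiceType).
Local Notation H := (l2 R X).
Local Notation U := (unitary_group R X).
Implicit Types (f g h : H) (u v : U).

Lemma cvg_l2P (T : Type) (F : set_system T) (u : T -> H) f : Filter F ->
  u @ F --> f <-> forall e : R, 0 < e -> \forall t \near F, l2norm (f - u t) < e.
Proof.
move=> FF; split=> [uf e e0|uf].
  have e0' : 0 < e%:C%C :> R[i] by rewrite ltcR.
  have := @cvgr_dist_lt _ _ _ _ FF u f uf _ e0'.
  by apply: filterS => t; rewrite normE ltcR.
apply/(@cvgrPdist_lt _ _ T F FF u f) => e; rewrite ltcE => /andP[/eqP eI e0].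
apply: filterS (uf _ e0) => t ft.
by rewrite normE ltcE /= eI eqxx.
Qed.

Lemma inner_dist f f' g : normc (inner f g - inner f' g) <=
  `|re_inner f g - re_inner f' g| +
  `|re_inner f ('i%C *: g) - re_inner f' ('i%C *: g)|.
Proof. by rewrite -innerBl -!re_innerBl -Im_inner; exact: normc_le_ReIm. Qed.

Lemma re_inner_cvg (T : Type) (F : set_system T) (u : T -> H) f g : Filter F ->
  u @ F --> f -> (fun t => re_inner (u t) g) @ F --> re_inner f g.
Proof.
move=> FF /cvg_l2P uf; apply/cvgrPdist_lt => e e0.
have g1 : 0 < l2norm g + 1 by rewrite ltr_wpDl ?l2norm_ge0.
apply: filterS (uf _ (divr_gt0 e0 g1)) => t; rewrite ltr_pdivlMr// -re_innerBl => ft.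
apply: le_lt_trans (re_inner_bound _ _) _; apply: le_lt_trans ft.
by rewrite ler_wpM2l ?l2norm_ge0// lerDl.
Qed.

Lemma cvg_unitaryP (T : Type) (F : set_system T) (w : T -> U) u : Filter F ->
  w @ F --> u <-> forall f, (fun t => unitary_fun (w t) f) @ F --> unitary_fun u f.
Proof.
move=> FF; have FwF : Filter (w @ F) by exact: fmap_filter.
split=> [/cvg_set_typeP/cvg_ptwsP|] wu; first exact: wu.
by apply/cvg_set_typeP; apply/cvg_ptwsP.
Qed.

(** The basic sets form a filter that converges to 1 by [cvg_unitaryP], so every neighbourhood
    contains one of them. The same device gives bases at contractions, in [G] and at 0-1
    matrices. *)
Lemma unitary_nbhs1 (O : set U) : nbhs (1%g : U) O -> exists (s : seq H) (d : R),
  0 < d /\ forall u, (forall f, f \in s -> l2norm (f - unitary_fun u f) < d) -> O u.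
Proof.
pose D := [set p : seq H * R | 0 < p.2].
pose B (p : seq H * R) := [set u : U | forall f, f \in p.1 -> l2norm (f - unitary_fun u f) < p.2].
have FF : Filter (filter_from D B).
  apply: filter_from_filter; first by exists ([::], 1); exact: ltr01.
  move=> [s d] [s' d'] d0 d'0; exists (s ++ s', Num.min d d').
    by rewrite /D /= lt_min d0.
  move=> u uB; split=> f fs /=.
    have := uB f; rewrite /= mem_cat fs => /(_ isT); rewrite lt_min => /andP[].
    by [].
  by have := uB f; rewrite /= mem_cat fs orbT => /(_ isT); rewrite lt_min => /andP[].
have Fc : id @ filter_from D B --> (1%g : U).
  apply/cvg_unitaryP => f; apply/cvg_l2P => e e0.
  by exists ([:: f], e) => // u /(_ f) /=; rewrite inE eqxx; exact.
move=> /Fc[[s d] d0 BO]; exists s, d; split=> // u us; exact: BO.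
Qed.

Lemma nbhs1_unitary f (d : R) : 0 < d ->
  nbhs (1%g : U) [set u : U | l2norm (f - unitary_fun u f) < d].
Proof.
move=> d0; have /cvg_unitaryP/(_ f)/cvg_l2P/(_ d d0) : id @ nbhs (1%g : U) --> (1%g : U).
  exact: cvg_id.
by [].
Qed.

Lemma unitary_mulE u v f : unitary_fun (u * v)%g f = unitary_fun u (unitary_fun v f).
Proof. by []. Qed.

Lemma unitary_invKV u f : unitary_fun u (unitary_fun u^-1%g f) = f.
Proof. by rewrite -unitary_mulE mulgV. Qed.

Lemma unitary_norm_fun u f : l2norm (unitary_fun u f) = l2norm f.
Proof. exact: (unitary_l2norm _ (unitary_funP u)). Qed.

Lemma unitary_fun_inner u f g :
  inner (unitary_fun u f) (unitary_fun u g) = inner f g.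
Proof. by have [_ + _] := unitary_funP u; apply. Qed.

Lemma unitary_funB u f g :
  unitary_fun u (f - g) = unitary_fun u f - unitary_fun u g.
Proof. exact: (unitaryB _ _ (unitary_funP u)). Qed.

Lemma unitary_dist u f g : l2norm (unitary_fun u f - unitary_fun u g) = l2norm (f - g).
Proof. by rewrite -unitary_funB unitary_norm_fun. Qed.

(** In [<a w b f, g>] the operator [b] hardly moves [f], and [a] can be passed to [g], which it
    hardly moves, by unitarity. *)
Lemma unitary_bucont f g :
  roelcke_bucont (fun u : U => re_inner (unitary_fun u f) g).
Proof.
apply/roelcke_bucontP; split.
  exists (l2norm f * l2norm g) => u; apply: le_trans (re_inner_bound _ _) _.
  by rewrite unitary_norm_fun.
move=> e e0; pose K := l2norm f + l2norm g + 1.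
have K0 : 0 < K by rewrite ltr_wpDl ?addr_ge0 ?l2norm_ge0.
(* Both displacements together cost at most [d * K = e / 4], so two members of one set of the cover
   differ by at most [e / 2]. *)
pose d := e / 4 / K; have d0 : 0 < d by rewrite !divr_gt0.
have dK : d * K = e / 4 by rewrite divfK// gt_eqF.
exists ([set u : U | l2norm (f - unitary_fun u f) < d] `&`
        [set u : U | l2norm (g - unitary_fun u g) < d]).
  by apply: filterI; exact: nbhs1_unitary.
suff near (w u : U) : double_translate ([set u : U | l2norm (f - unitary_fun u f) < d] `&`
        [set u : U | l2norm (g - unitary_fun u g) < d]) w u ->
    `|re_inner (unitary_fun u f) g - re_inner (unitary_fun w f) g| <= e / 4.
  move=> w u v /near uw /near vw.
  apply: le_lt_trans (ler_distD (re_inner (unitary_fun w f) g) _ _) _.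
  by rewrite (distrC (re_inner (unitary_fun w f) g)); lra.
move=> [a [_ ag] [b [bf _] <-]]; rewrite !unitary_mulE.
set h := unitary_fun w (unitary_fun b f).
have hn : l2norm h = l2norm f by rewrite !unitary_norm_fun.
have E1 : re_inner (unitary_fun a h) g =
    re_inner (unitary_fun a h) (g - unitary_fun a g) + re_inner h g.
  have -> : re_inner h g = re_inner (unitary_fun a h) (unitary_fun a g).
    by rewrite /re_inner unitary_fun_inner.
  by rewrite -re_innerDr subrK.
have := re_inner_bound (unitary_fun a h) (g - unitary_fun a g).
have := re_inner_bound (h - unitary_fun w f) g.
rewrite unitary_norm_fun hn unitary_dist l2norm_distC re_innerBl.
have := l2norm_ge0 f; have := l2norm_ge0 g.
have := l2norm_ge0 (f - unitary_fun b f); have := l2norm_ge0 (g - unitary_fun a g).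
move: bf ag => /=; rewrite E1; move: dK; rewrite /K.
set x1 := l2norm _; set x2 := l2norm _; set x3 := l2norm _; set x4 := l2norm _.
set y1 := re_inner _ _; set y2 := re_inner _ _; set y3 := re_inner _ _.
move=> dK b1 b2 h1 h2 h3 h4 h5 h6.
have p1 : x3 * x2 <= d * x2 := ler_wpM2r h3 (ltW b1).
have p2 : x1 * x4 <= x1 * d := ler_wpM2l h4 (ltW b2).
by have := ler_normD y3 (y1 - y2); rewrite addrA; lra.
Qed.

End unitary_topology.

Lemma infinite_sequence (T : Type) (A : set T) : infinite_set A ->
  exists e : nat -> T, injective e /\ forall n, A (e n).
Proof.
move=> /infiniteP/card_leP[f].
pose o n : set_type [set: nat] := exist _ n (mem_set I).
exists (fun n => set_val (f (o n))); split; last by move=> n; exact: set_valP.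
move=> m n /val_inj fmn.
have : o m = o n by apply: (@inj _ _ _ f); rewrite ?inE.
by case.
Qed.

(** * Finite dilations of contractions *)

Section dilation.
Variables (R : realType) (X : discreteTopologicalType).
Hypothesis Xinf : infinite_set [set: X].
Local Notation H := (l2 R X).
Local Notation U := (unitary_group R X).
Implicit Types (f g h : H).

Lemma orthonormal_sequence :
  exists e : nat -> H, forall i j, inner (e i) (e j) = (i == j)%:R.
Proof.
have [x [xi _]] := infinite_sequence Xinf.
by exists (fun n => l2_basis R (x n)) => i j; rewrite basis_inner (inj_eq xi).
Qed.

Lemma linear_sum (T : H -> H) n (c : 'I_n -> R[i]) (f : 'I_n -> H) : linear T ->
  T (\sum_i c i *: f i) = \sum_i c i *: T (f i).
Proof.
move=> Tl; have T0 : T 0 = 0 by have := Tl (-1) 0 0; rewrite scaler0 addr0 scaleN1r addNr.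
have TD g h : T (g + h) = T g + T h by rewrite -[g]scale1r Tl !scale1r.
rewrite (big_morph T TD T0); apply: eq_bigr => i _.
by rewrite -[X in T X]addr0 Tl T0 addr0.
Qed.

Lemma inner_sum2 n (c d : 'I_n -> R[i]) (f g : 'I_n -> H) :
  inner (\sum_i c i *: f i) (\sum_j d j *: g j) =
  \sum_i \sum_j c i * (d j)^*%C * inner (f i) (g j).
Proof.
rewrite inner_suml; apply: eq_bigr => i _; rewrite inner_sumr; apply: eq_bigr => j _.
by rewrite innerZl innerZr mulrA.
Qed.

(* [z0, z1] has the Gram matrix that [f, u f] would have for a unitary dilation
   [u] of [T]. *)
Lemma contraction_dilation (T : H -> H) n (f : 'I_n -> H) : Defs.contraction T ->
  exists z0 z1 : 'I_n -> H, [/\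
    forall i j, inner (z0 i) (z0 j) = inner (f i) (f j),
    forall i j, inner (z1 i) (z1 j) = inner (f i) (f j),
    forall i j, inner (z1 i) (z0 j) = inner (T (f i)) (f j) &
    forall eps : R, 0 < eps -> exists2 eta : R, 0 < eta & forall u : U,
      (forall i j, normc (inner (unitary_fun u (f i)) (f j) -
                          inner (T (f i)) (f j)) <= eta) ->
      exists a : U, forall i, l2norm (unitary_fun a (z0 i) - f i) <= eps /\
        l2norm (unitary_fun a (z1 i) - unitary_fun u (f i)) <= eps].
Proof.
move=> [Tl Tn]; have [e orth] := orthonormal_sequence.
pose A0 (a b : 'I_n + 'I_n) : R[i] := match a, b with
  | inl i, inl j | inr i, inr j => inner (f i) (f j)
  | inr i, inl j => inner (T (f i)) (f j)
  | inl i, inr j => inner (f i) (T (f j)) end.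
pose A : 'M[R[i]]_(n + n) := \matrix_(i, j) A0 (fintype.split i) (fintype.split j).
have AE a b : A (unsplit a) (unsplit b) = A0 a b by rewrite mxE !unsplitK.
have Aherm i j : A j i = (A i j)^*%C.
  by rewrite !mxE; case: (fintype.split i) => k; case: (fintype.split j) => l; exact: inner_conj.
have Apsd (c : 'I_(n + n) -> R[i]) : 0 <= \sum_i \sum_j c i * (c j)^*%C * A i j.
  pose c0 i := c (unsplit (inl i)); pose c1 i := c (unsplit (inr i)).
  have -> : \sum_i \sum_j c i * (c j)^*%C * A i j =
    (\sum_i \sum_j c0 i * (c0 j)^*%C * A0 (inl i) (inl j) +
     \sum_i \sum_j c0 i * (c1 j)^*%C * A0 (inl i) (inr j)) +
    (\sum_i \sum_j c1 i * (c0 j)^*%C * A0 (inr i) (inl j) +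
     \sum_i \sum_j c1 i * (c1 j)^*%C * A0 (inr i) (inr j)).
    rewrite big_split_ord; congr (_ + _); rewrite -big_split; apply: eq_bigr => i _;
      rewrite big_split_ord; congr (_ + _); apply: eq_bigr => j _;
      by rewrite -AE.
  rewrite /= -!inner_sum2.
  rewrite -(linear_sum c1 f Tl).
  set p := \sum_i c0 i *: f i; set q := \sum_i c1 i *: f i.
  (* Completing the square: what remains is [|q|^2 - |T q|^2]. *)
  have -> : inner p p + inner p (T q) + (inner (T q) p + inner q q) =
      inner (p + T q) (p + T q) + (inner q q - inner (T q) (T q)).
    by rewrite innerDl !innerDr; ring.
  rewrite addr_ge0//; first by rewrite inner_normE ler0c sqr_ge0.
  rewrite subr_ge0 !inner_normE lecR ler_sqr ?nnegrE ?l2norm_ge0//.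
  by have := Tn q; rewrite !normE lecR.
have [z [zA zP]] := gram_realization orth Aherm Apsd.
exists (fun i => z (unsplit (inl i))), (fun i => z (unsplit (inr i))); split.
- by move=> i j; rewrite zA AE.
- by move=> i j; rewrite zA AE.
- by move=> i j; rewrite zA AE.
move=> eps eps0; have [eta eta0 etaP] := zP eps eps0; exists eta => // u uT.
pose x (a : 'I_n + 'I_n) := match a with inl i => f i | inr i => unitary_fun u (f i) end.
have close0 (y : R[i]) : normc (y - y) <= eta by rewrite subrr normc0 ltW.
have xA a b : normc (inner (x a) (x b) - A0 a b) <= eta.
  case: a => k; case: b => l; [exact: close0 | | exact: uT |].
    have := uT l k; rewrite -normc_conj conjcD conjcN -!inner_conj; exact.
  by have := close0 (inner (f k) (f l)); rewrite -{1}(unitary_fun_inner u).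
have [|a ua aP] := etaP (fun i => x (fintype.split i)).
  by move=> i j; rewrite mxE; exact: xA.
exists (mk_unitary ua) => i; split.
  by have := aP (unsplit (inl i)); rewrite unsplitK.
by have := aP (unsplit (inr i)); rewrite unsplitK.
Qed.

End dilation.

(** * Contractions as the compactification of the unitary group *)

Section unitary_roelcke.
Variables (R : realType) (X : discreteTopologicalType).
Hypothesis Xinf : infinite_set [set: X].
Local Notation H := (l2 R X).
Local Notation U := (unitary_group R X).
Local Notation Theta := (contractions R X).
Implicit Types (f g h : H).

Lemma contractions_coord_nbhs (T : Theta) n (f : 'I_n -> H) (eta : R) : 0 < eta ->
  nbhs T [set S : Theta | forall i j, normc (inner (val S (f i) : H) (f j) -
                                    inner (val T (f i) : H) (f j)) <= eta].
Proof.
move=> eta0; have e20 : 0 < eta / 2 by rewrite divr_gt0.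
have near1 g h : nbhs T [set S : Theta | `|re_inner (val T g : H) h - re_inner (val S g : H) h| < eta / 2].
  exact: (@cvgr_dist_lt _ _ _ _ _ _ _ (@contractions_coord_continuous R X g h T) _ e20).
pose P i j (S : Theta) :=
  `|re_inner (val T (f i) : H) (f j) - re_inner (val S (f i) : H) (f j)| < eta / 2 /\
  `|re_inner (val T (f i) : H) ('i%C *: f j) - re_inner (val S (f i) : H) ('i%C *: f j)| < eta / 2.
have near2 : nbhs T [set S | forall i j, P i j S].
  apply: (filter_forall (F := nbhs T) (f := fun i S => forall j, P i j S)) => i.
  apply: (filter_forall (F := nbhs T) (f := P i)) => j.
  by apply: filterI; exact: near1.
apply: filterS near2 => S ST i j; have [h1 h2] := ST i j.
apply: le_trans (inner_dist _ _ _) _; rewrite distrC.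
by rewrite (distrC (re_inner (val S (f i) : H) ('i%C *: f j))); lra.
Qed.

Lemma contractions_nbhs (T : Theta) (O : set Theta) : nbhs T O ->
  exists (s : seq H) (d : R), 0 < d /\
    forall S : Theta, (forall f g, f \in s -> g \in s ->
      normc (inner (val S f : H) g - inner (val T f : H) g) < d) -> O S.
Proof.
pose D := [set p : seq H * R | 0 < p.2].
pose B (p : seq H * R) := [set S : Theta | forall f g, f \in p.1 -> g \in p.1 ->
      normc (inner (val S f : H) g - inner (val T f : H) g) < p.2].
have FF : Filter (filter_from D B).
  apply: filter_from_filter; first by exists ([::], 1); exact: ltr01.
  move=> [s d] [s' d'] d0 d'0; exists (s ++ s', Num.min d d').
    by rewrite /D /= lt_min d0.
  move=> S SB; split=> f g fs gs /=.
    by have := SB f g; rewrite /= !mem_cat fs gs => /(_ isT isT); rewrite lt_min => /andP[].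
  by have := SB f g; rewrite /= !mem_cat fs gs !orbT => /(_ isT isT); rewrite lt_min => /andP[].
have Fc : filter_from D B --> T.
  apply/cvg_contractionsP => f g; apply/cvgrPdist_lt => e e0.
  exists ([:: f; g], e) => // S /(_ f g) /=; rewrite !inE !eqxx orbT => /(_ isT isT).
  by apply: le_lt_trans; rewrite distrC /re_inner -raddfB; exact: normc_Re.
move=> /Fc[[s d] d0 BO]; exists s, d; split=> // S Ss; exact: BO.
Qed.

Lemma contraction_of_unitary_continuous :
  continuous (@contraction_of_unitary R X : U -> Theta).
Proof.
move=> u; have FF := fmap_filter (@contraction_of_unitary R X) (nbhs_filter u).
apply/cvg_contractionsP => f g.
have uf : (fun v => unitary_fun v f) @ nbhs u --> unitary_fun u f.
  by have /cvg_unitaryP : id @ nbhs u --> u by exact: cvg_id.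
exact: re_inner_cvg uf.
Qed.

(** [f], [z0] and [z1] have one Gram matrix, so unitaries [a1], [a2], [a3] nearly carry a common
    model [z] to each of them. Then [w] nearly sends [z0] to [f], [u] nearly sends [f] to [w z1],
    and the products [<w z1, w z0>] are the matrix of [T]. *)
Lemma contraction_of_unitary_dense :
  dense (range (@contraction_of_unitary R X : U -> Theta)).
Proof.
move=> O [T OT] oO.
have [s [d [d0 sO]]] := contractions_nbhs (open_nbhs_nbhs (conj oO OT)).
pose n := size s; pose f (i : 'I_n) := tnth (in_tuple s) i.
have [Tl Tn] := set_valP T.
have [z0 [z1 [z00 z11 z10 _]]] := contraction_dilation Xinf f (conj Tl Tn).
have [e orth] := orthonormal_sequence R Xinf.
pose A : 'M[R[i]]_n := \matrix_(i, j) inner (f i) (f j).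
have Aherm i j : A j i = (A i j)^*%C by rewrite !mxE -inner_conj.
have Apsd (c : 'I_n -> R[i]) : 0 <= \sum_i \sum_j c i * (c j)^*%C * A i j.
  under eq_bigr do under eq_bigr do rewrite mxE.
  by rewrite -inner_sum2 inner_normE ler0c sqr_ge0.
have [z [_ zP]] := gram_realization orth Aherm Apsd.
pose M := \sum_i l2norm (f i); have M0 : 0 <= M by apply: sumr_ge0 => i _; exact: l2norm_ge0.
have fM i : l2norm (f i) <= M by apply: le_term_sum => j; exact: l2norm_ge0.
(* Two error terms, each at most [2 * eps * M], have to stay below [d]. *)
pose eps := d / 4 / (M + 1); have M1 : 0 < M + 1 by rewrite ltr_wpDl.
have eps0 : 0 < eps by rewrite !divr_gt0.
have epsM : eps * (M + 1) = d / 4 by rewrite divfK// gt_eqF.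
have [eta eta0 etaP] := zP eps eps0.
have approx (x : 'I_n -> H) : (forall i j, inner (x i) (x j) = inner (f i) (f j)) ->
    exists a : U, forall i, l2norm (unitary_fun a (z i) - x i) <= eps.
  move=> xf; have [|a ua aP] := etaP x; last by exists (mk_unitary ua).
  by move=> i j; rewrite mxE xf subrr normc0 ltW.
have [a1 a1P] := approx f (fun _ _ => erefl).
have [a2 a2P] := approx z0 z00.
have [a3 a3P] := approx z1 z11.
pose w : U := (a1 * a2^-1)%g; pose u : U := (w * (a3 * a1^-1))%g.
have wz0 i : l2norm (f i - unitary_fun w (z0 i)) <= eps + eps.
  rewrite -(subrKA (unitary_fun a1 (z i))); apply: le_trans (l2normD _ _) _.
  apply: lerD; first by rewrite l2norm_distC; exact: a1P.
  rewrite /w unitary_mulE unitary_dist -(unitary_dist a2) unitary_invKV.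
  exact: a2P.
have uf i : l2norm (unitary_fun u (f i) - unitary_fun w (z1 i)) <= eps + eps.
  rewrite /u (unitary_mulE w) unitary_dist unitary_mulE.
  rewrite -(subrKA (unitary_fun a3 (z i))); apply: le_trans (l2normD _ _) _.
  apply: lerD; last exact: a3P.
  rewrite unitary_dist -(unitary_dist a1) unitary_invKV l2norm_distC; exact: a1P.
have nz1 i : l2norm (z1 i) = l2norm (f i).
  apply/eqP; rewrite -(@eqrXn2 _ 2) ?l2norm_ge0//; apply/eqP/complexI.
  by rewrite -!inner_normE z11.
exists (contraction_of_unitary u); split; last by exists u.
apply: sO => f0 g0 /seq_tnthP[i ->] /seq_tnthP[j ->].
rewrite -[tnth _ i]/(f i) -[tnth _ j]/(f j) -[val (contraction_of_unitary u)]/(unitary_fun u).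
have -> : inner (unitary_fun u (f i)) (f j) - inner (val T (f i) : H) (f j) =
    inner (unitary_fun u (f i) - unitary_fun w (z1 i)) (f j) +
    inner (unitary_fun w (z1 i)) (f j - unitary_fun w (z0 j)).
  rewrite innerBl innerBr unitary_fun_inner z10.
  by rewrite addrA subrK.
apply: le_lt_trans (normcD _ _) _.
have := cauchy_schwarz (unitary_fun u (f i) - unitary_fun w (z1 i)) (f j).
have := cauchy_schwarz (unitary_fun w (z1 i)) (f j - unitary_fun w (z0 j)).
rewrite unitary_norm_fun nz1.
have := ler_pM (l2norm_ge0 _) (l2norm_ge0 _) (uf i) (fM j).
have := ler_pM (l2norm_ge0 _) (l2norm_ge0 _) (fM i) (wz0 j).
by lra.
Qed.

Lemma contraction_small (T : Theta) (O : set U) : nbhs (1%g : U) O ->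
  exists2 W, nbhs T W & forall u v : U,
    W (contraction_of_unitary u) -> W (contraction_of_unitary v) ->
    exists2 g, double_translate O g u & double_translate O g v.
Proof.
move=> O1; have [s [d [d0 sO]]] := unitary_nbhs1 O1.
pose n := size s; pose f (i : 'I_n) := tnth (in_tuple s) i.
have [Tl Tn] := set_valP T.
have [z0 [z1 [_ _ _ zP]]] := contraction_dilation Xinf f (conj Tl Tn).
have d40 : 0 < d / 4 by rewrite divr_gt0.
have [eta eta0 etaP] := zP (d / 4) d40.
exists [set S : Theta | forall i j, normc (inner (val S (f i) : H) (f j) -
                                    inner (val T (f i) : H) (f j)) <= eta].
  exact: contractions_coord_nbhs.
move=> u v uT vT.
have [a aP] := etaP u uT; have [b bP] := etaP v vT.
(* [w] nearly fixes [f] and nearly sends [u f] to [v f]; [c] is the correction with [v = w u c], and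
   so it nearly fixes [f] as well. *)
pose w : U := (b * a^-1)%g; pose c : U := (u^-1 * w^-1 * v)%g.
have wf i : l2norm (f i - unitary_fun w (f i)) <= d / 4 + d / 4.
  rewrite -(subrKA (unitary_fun b (z0 i))); apply: le_trans (l2normD _ _) _.
  apply: lerD; first by rewrite l2norm_distC; exact: (bP i).1.
  rewrite /w unitary_mulE unitary_dist -(unitary_dist a) unitary_invKV.
  exact: (aP i).1.
have cf i : l2norm (f i - unitary_fun c (f i)) <= d / 4 + d / 4.
  rewrite -(unitary_dist (w * u)%g) /c -unitary_mulE !mulgA mulgK mulgV mul1g.
  rewrite /w !unitary_mulE.
  rewrite -(subrKA (unitary_fun b (z1 i))); apply: le_trans (l2normD _ _) _.
  apply: lerD; last exact: (bP i).2.
  rewrite unitary_dist -(unitary_dist a) unitary_invKV l2norm_distC.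
  exact: (aP i).2.
have d2 : d / 4 + d / 4 < d by lra.
have small (x : U) : (forall i, l2norm (f i - unitary_fun x (f i)) <= d / 4 + d / 4) -> O x.
  by move=> xf; apply: sO => f0 /seq_tnthP[i ->]; exact: le_lt_trans (xf i) d2.
have O11 : O 1%g by exact: nbhs_singleton.
exists u; first by exists 1%g => //; exists 1%g => //; rewrite mul1g mulg1.
exists w; first exact: small.
by exists c; [exact: small | rewrite /c !mulgA mulgK mulgV mul1g].
Qed.

Lemma unitary_roelcke_eq :
  compactification_eq (roelcke U R) (contraction_comp R X).
Proof.
apply: (@roelcke_eq R U (contraction_comp R X) (H * H)%type
  (fun p (T : Theta) => re_inner (val T p.1 : H) p.2)).
- exact: contractions_compact.
- exact: contraction_of_unitary_dense.
- by move=> p; exact: contractions_coord_continuous.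
- by move=> S T ST; apply: contractions_separated => f g; exact: (ST (f, g)).
- by move=> p; exact: unitary_bucont.
- exact: contraction_small.
Qed.

Lemma contraction_compP (S T : Theta) :
  Defs.contraction ((val S : H -> H) \o (val T : H -> H)).
Proof.
have [Sl Sn] := set_valP S; have [Tl Tn] := set_valP T; split.
  by move=> c f g; rewrite /= [val T _]Tl [LHS]Sl.
by move=> f; apply: le_trans (Sn _) _; exact: Tn.
Qed.

Definition contraction_mul (S T : Theta) : Theta :=
  exist _ ((val S : H -> H) \o (val T : H -> H) : {ptws H -> l2_weak R X})
    (mem_set (contraction_compP S T)).

(** The value at [g] of the adjoint of [S]: pairing [S T f] with [g] is pairing [T f] with [v], so
    [T |-> S T] is continuous. *)
Lemma contraction_adjoint (S : Theta) g :
  exists v, forall h, re_inner (val S h : H) g = re_inner h v.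
Proof.
have [Sl Sn] := set_valP S.
have [|||v _ vP] := @riesz R X (fun h => inner (val S h : H) g) (l2norm g).
- exact: l2norm_ge0.
- move=> c f f'; have -> : val S (c *: f + f') = c *: (val S f : H) + (val S f' : H) by exact: Sl.
  by rewrite innerDl innerZl.
- move=> f; apply: le_trans (cauchy_schwarz _ _) _; rewrite mulrC.
  by rewrite ler_wpM2l ?l2norm_ge0// contractions_norm.
by exists v => h; rewrite /re_inner vP.
Qed.

Lemma contraction_mul_semitop :
  semitop_semigroup_comp (c := contraction_comp R X) contraction_mul.
Proof.
split.
- split; [exact: contractions_compact | | exact: contraction_of_unitary_continuous |
    exact: contraction_of_unitary_dense].
  apply: (@separating_hausdorff R _ (H * H)%type
    (fun p (T : Theta) => re_inner (val T p.1 : H) p.2)).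
    by move=> p; exact: contractions_coord_continuous.
  by move=> S T ST; apply: contractions_separated => f g; exact: (ST (f, g)).
- by move=> S T V; exact: val_inj.
- have cont (w : Theta -> Theta) T : (forall f g,
      (fun V : Theta => re_inner (val (w V) f : H) g) @ nbhs T --> re_inner (val (w T) f : H) g) ->
      w @ nbhs T --> w T.
    have FF := fmap_filter w (nbhs_filter T).
    by move=> wT; apply/cvg_contractionsP.
  move=> S; split=> T; apply: cont => f g /=.
    have [v vP] := contraction_adjoint S g.
    rewrite vP; under eq_fun do rewrite vP.
    exact: contractions_coord_continuous.
  exact: (@contractions_coord_continuous R X (val S f : H) g T).
- by move=> u v; exact: val_inj.
Qed.

Lemma unitary_is_WAP : is_WAP_comp (roelcke U R).
Proof.
apply: (roelcke_is_WAP _ contraction_mul_semitop).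
exact/compactification_eq_sym/unitary_roelcke_eq.
Qed.

End unitary_roelcke.

(** * Ultratransitive permutation groups *)

Lemma locally_constant_continuous (S T : topologicalType) (k : S -> T) :
  (forall s, \forall s' \near s, k s' = k s) -> continuous k.
Proof.
move=> kc s A /nbhs_singleton Aks.
by apply: filterS (kc s) => s' /= ->.
Qed.

Lemma cvg_bool (T : Type) (F : set_system T) (u : T -> bool) b : Filter F ->
  u @ F --> b <-> \forall t \near F, u t = b.
Proof.
move=> FF; split=> [ub|ub A /nbhs_singleton Ab].
  exact: (ub [set b] (discrete_set1 b)).
by suff : \forall t \near F, A (u t) by []; apply: filterS ub => t ->.
Qed.

Lemma ptws_compact (U : Type) (V : topologicalType) :
  compact [set: V] -> compact [set: {ptws U -> V}].
Proof.
move=> Vc; rewrite compact_ultra => F FU _.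
have FF : ProperFilter F := @ultra_proper _ _ FU.
have lim_ex x : exists v : V, (fun f : {ptws U -> V} => f x) @ F --> v.
  have [|v _ vP] := @ultra_cvg _ F V [set: V] (fun f : {ptws U -> V} => f x) FU Vc.
    by [].
  by exists v.
have [f fP] := choice lim_ex.
by exists f; split=> //; apply/cvg_ptwsP.
Qed.

Section permutation_topology.
Variables (X : discreteTopologicalType) (G : groupClosed (perm_group X)).
Local Notation sG := (subgroup G).
Implicit Types (g h u v : sG).

Definition pf g : X -> X := perm_fun (val g : perm_group X).

Lemma pfM g h x : pf (g * h)%g x = pf g (pf h x).
Proof. by []. Qed.

Lemma pfK g x : pf g^-1%g (pf g x) = x.
Proof. by rewrite -pfM mulVg. Qed.

Lemma pfKV g x : pf g (pf g^-1%g x) = x.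
Proof. by rewrite -pfM mulgV. Qed.

Lemma pf_inj g : injective (pf g).
Proof. exact: can_inj (pfK g). Qed.

Lemma pf_eqV g x y : (pf g x == y) = (x == pf g^-1%g y).
Proof. by apply/eqP/eqP => [<-|->]; rewrite ?pfK ?pfKV. Qed.

Lemma pf_eq g h : (forall x, pf g x = pf h x) -> g = h.
Proof. by move=> gh; apply: val_inj; apply: perm_fun_inj; apply/funext. Qed.

Lemma cvg_subgroupP (T : Type) (F : set_system T) (w : T -> sG) g : Filter F ->
  w @ F --> g <-> forall x, \forall t \near F, pf (w t) x = pf g x.
Proof.
move=> FF; have FwF : Filter (w @ F) by exact: fmap_filter.
have Fv : Filter ((fun h : sG => val h : perm_group X) @ (w @ F)) by exact: fmap_filter.
have Fv' : Filter ((fun h : perm_group X => val h : {ptws X -> X}) @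
    ((fun h : sG => val h : perm_group X) @ (w @ F))) by exact: fmap_filter.
split=> [/cvg_initialP/cvg_set_typeP/cvg_ptwsP wg x|wg].
  exact: (wg x [set pf g x] (discrete_set1 _)).
apply/cvg_initialP; apply/cvg_set_typeP; apply/cvg_ptwsP => x A /nbhs_singleton Ax.
suff : \forall t \near F, A (pf (w t) x) by [].
by apply: filterS (wg x) => t ->.
Qed.

Lemma nbhs_subgroup g x : nbhs g [set h | pf h x = pf g x].
Proof.
have /cvg_subgroupP : id @ nbhs g --> g by exact: cvg_id.
exact.
Qed.

Lemma subgroup_nbhs g (O : set sG) : nbhs g O ->
  exists s : seq X, forall h, (forall x, x \in s -> pf h x = pf g x) -> O h.
Proof.
pose B (s : seq X) := [set h : sG | forall x, x \in s -> pf h x = pf g x].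
have FF : Filter (filter_from [set: seq X] B).
  apply: filter_from_filter; first by exists [::].
  move=> s s' _ _; exists (s ++ s') => // h hB.
  by split=> x xs; apply: hB; rewrite mem_cat xs ?orbT.
have Fc : id @ filter_from [set: seq X] B --> g.
  by apply/cvg_subgroupP => x; exists [:: x] => // h; apply; rewrite inE.
by move=> /Fc[s _ sO]; exists s.
Qed.

Hypothesis Gult : ultratransitive G.

(** Ultratransitivity speaks of injective tuples, so repetitions are removed from [s]. *)
Lemma ultratransitive_seq (s : seq X) (tau : X -> X) : {in s &, injective tau} ->
  exists g : sG, forall x, x \in s -> pf g x = tau x.
Proof.
move=> taui; pose n := size (undup s).
pose x (i : 'I_n) := tnth (in_tuple (undup s)) i.
have xs i : x i \in s by rewrite -mem_undup mem_tnth.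
have xi : injective x.
  by apply/tuple_uniqP; rewrite /= undup_uniq.
have yi : injective (tau \o x) by move=> i j /(taui _ _ (xs i) (xs j))/xi.
have [g gG gx] := Gult xi yi.
exists (exist _ g gG) => z zs.
have /(nthP z)[i iz <-] : z \in undup s by rewrite mem_undup.
have := gx (Ordinal iz); by rewrite /= /x !(tnth_nth z).
Qed.

(* If [u] and [v] have the same finite matrix on [s], extend the partial map
   fixing [s] and sending [u x] to [v x] to an element of [G]. *)
Lemma permutation_small (O : set sG) : nbhs (1%g : sG) O ->
  exists s : seq X, forall u v,
    (forall x y, x \in s -> y \in s -> (pf u x == y) = (pf v x == y)) ->
    exists2 g, double_translate O g u & double_translate O g v.
Proof.
move=> O1; have [s sO] := subgroup_nbhs O1; exists s => u v uv.
pose tau z := if z \in s then z else pf v (pf u^-1%g z).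
have tauE x : x \in s -> tau (pf u x) = pf v x.
  move=> xs; rewrite /tau; case: ifP => us; last by rewrite pfK.
  by apply/esym/eqP; rewrite -uv// eqxx.
have taui : {in s ++ map (pf u) s &, injective tau}.
  have mem z : z \in s ++ map (pf u) s -> z \in s \/ exists2 x, x \in s & z = pf u x.
    by rewrite mem_cat => /orP[|/mapP[x xs ->]]; [left | right; exists x].
  have mixed z x : z \in s -> x \in s -> tau z = tau (pf u x) -> z = pf u x.
    move=> zs xs; rewrite tauE// /tau zs => zv.
    by apply/esym/eqP; rewrite uv// -zv.
  move=> z z' /mem[zs|[x xs ->]] /mem[zs'|[x' xs' ->]].
  - by rewrite /tau zs zs'.
  - exact: mixed.
  - by move=> /esym /mixed ->.
  - by rewrite !tauE// => /pf_inj ->.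
have [a aP] := ultratransitive_seq taui.
have as_ x : x \in s -> pf a x = x.
  by move=> xs; rewrite aP ?mem_cat ?xs// /tau xs.
have au x : x \in s -> pf a (pf u x) = pf v x.
  by move=> xs; rewrite aP ?tauE// mem_cat map_f ?orbT.
have O11 : O 1%g by exact: nbhs_singleton.
exists u; first by exists 1%g => //; exists 1%g => //; rewrite mul1g mulg1.
exists a; first by apply: sO => x /as_ ->.
(* The right factor [c] solves [v = a * u * c]; it fixes [s] because [a * u] and [v] agree there. *)
exists (u^-1 * a^-1 * v)%g; last by rewrite !mulgA mulgK mulgV mul1g.
by apply: sO => x xs; rewrite !pfM -au// !pfK.
Qed.

(** If all members of [O] fix [x] and [y], the matrix entry is constant on [O g O]. *)
Lemma perm_bucont (R : realType) x y :
  roelcke_bucont (fun g : sG => (pf g x == y)%:R : R).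
Proof.
apply/roelcke_bucontP; split.
  by exists 1 => g; rewrite normr_nat lern1 leq_b1.
move=> e e0; exists ([set h | pf h x = x] `&` [set h | pf h y = y]).
  by apply: filterI; [exact: (nbhs_subgroup 1%g x) | exact: (nbhs_subgroup 1%g y)].
suff E g u : double_translate ([set h | pf h x = x] `&` [set h | pf h y = y]) g u ->
    (pf u x == y) = (pf g x == y).
  by move=> g u v /E -> /E ->; rewrite subrr normr0.
move=> [a [_ ay] [b [bx _] <-]]; rewrite !pfM bx.
by rewrite -[in LHS]ay (inj_eq (@pf_inj a)).
Qed.

(** By [permutation_small] the neighbourhood condition of [roelcke_eq] reduces to reading each
    matrix entry continuously from [c]. *)
Lemma perm_roelcke_eq (R : realType) (c : gcompactification sG) (I : Type)
    (phi : I -> c -> R) :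
  compact [set: c] -> dense (range (@cmap sG c)) ->
  (forall i, continuous (phi i)) ->
  (forall p q, (forall i, phi i p = phi i q) -> p = q) ->
  (forall i, roelcke_bucont (phi i \o cmap c)) ->
  (forall x y, exists chi : c -> R, continuous chi /\
     forall g, chi (cmap c g) = (pf g x == y)%:R) ->
  compactification_eq (roelcke sG R) c.
Proof.
move=> Kc cd phic sep phib chi_ex; apply: (roelcke_eq Kc cd phic sep phib) => p O O1.
have [s sO] := permutation_small O1.
have [chi chiP] := choice (fun xy : X * X => chi_ex xy.1 xy.2).
(* Two values in [{0, 1}] at distance less than [1 / 2] from the same real are equal. *)
have near1 xy : nbhs p [set q | `|chi xy p - chi xy q| < 2^-1].
  have /(_ p) := (chiP xy).1; move=> /cvgr_dist_lt; apply.
  by rewrite invr_gt0.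
pose ss := allpairs pair s s.
have near2 (t : seq (X * X)) : nbhs p [set q | forall xy, xy \in t -> `|chi xy p - chi xy q| < 2^-1].
  elim: t => [|xy t IH]; first exact: filterE.
  apply: filterS (filterI (near1 xy) IH) => q [q1 q2] xy'.
  by rewrite inE => /predU1P[->//|]; exact: q2.
exists [set q | forall xy, xy \in ss -> `|chi xy p - chi xy q| < 2^-1]; first exact: near2.
move=> u v uW vW; apply: sO => x y xs ys.
have xys : (x, y) \in ss by apply/allpairsP; exists (x, y).
have := uW _ xys; have := vW _ xys; rewrite !(chiP _).2 /=.
case: (pf u x == y); case: (pf v x == y) => //=; rewrite !ltr_norml;
  by move=> /andP[h1 h2] /andP[h3 h4]; exfalso; lra.
Qed.

End permutation_topology.

(** * The unitary representation restricted to [G] *)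

Section unitary_representation.
Variables (R : realType) (X : discreteTopologicalType) (G : groupClosed (perm_group X)).
Local Notation H := (l2 R X).
Local Notation sG := (subgroup G).
Local Notation U := (unitary_group R X).
Local Notation rep := (fun g : sG => perm_unitary R (val g : perm_group X) : U).

Lemma repM (g h : sG) : rep (g * h)%g = (rep g * rep h)%g.
Proof.
apply: unitary_fun_inj; apply/funext => f; apply: val_inj; apply/funext => x /=.
congr (l2fun f _).
have -> : ((val g : perm_group X) * val h)^-1%g = ((val h : perm_group X)^-1 * (val g)^-1)%g.
  by rewrite invgM.
by [].
Qed.

Lemma l2_perm_linear (g : perm_group X) : linear (@l2_perm R X g).
Proof. by have [] := l2_perm_unitary R g. Qed.

Lemma rep_partial_sum (g : sG) s (c : X -> R[i]) :
  (forall x, x \in s -> pf g x = x) ->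
  unitary_fun (rep g) (partial_sum s c) = partial_sum s c.
Proof.
move=> gs; have gl := l2_perm_linear (val g : perm_group X).
have g0 : l2_perm (val g : perm_group X) 0 = 0 :> H.
  by have := gl (-1) 0 0; rewrite scaler0 addr0 scaleN1r addNr.
rewrite /unitary_fun /= /partial_sum; elim: s gs => [|x s IH] gs.
  by rewrite !big_nil.
rewrite !big_cons gl l2_perm_basis IH; last by move=> y ys; apply: gs; rewrite inE ys orbT.
have -> : perm_fun (val g : perm_group X) x = x by apply: gs; rewrite mem_head.
by [].
Qed.

(** A vector is within [d / 4] of a finite sum, which is fixed by all [g] fixing its support; the
    remainder is displaced by at most [d / 2]. *)
Lemma rep_nbhs1 (O : set U) : nbhs (1%g : U) O -> nbhs (1%g : sG) (rep @^-1` O).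
Proof.
move=> /unitary_nbhs1[s [d [d0 sO]]].
have near1 f : nbhs (1%g : sG) [set g | l2norm (f - unitary_fun (rep g) f) < d].
  have d40 : 0 < d / 4 by rewrite divr_gt0.
  have [t ut td] := partial_sum_dense f d40.
  have : nbhs (1%g : sG) [set g : sG | forall x, x \in t -> pf g x = x].
    elim: t {ut td} => [|x t IH]; first exact: filterE.
    apply: filterS (filterI (nbhs_subgroup (1%g : sG) x) IH) => g [g1 g2] y.
    by rewrite inE => /predU1P[->//|]; exact: g2.
  apply: filterS => g /(@rep_partial_sum g t f) gt /=.
  set p := partial_sum t f in gt td.
  have -> : f - unitary_fun (rep g) f = (f - p) - unitary_fun (rep g) (f - p).
    by rewrite unitary_funB gt opprB addrA subrK.
  by apply: le_lt_trans (l2normB _ _) _; rewrite unitary_norm_fun; lra.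
have near2 (t : seq H) : nbhs (1%g : sG)
    [set g | forall f, f \in t -> l2norm (f - unitary_fun (rep g) f) < d].
  elim: t => [|f t IH]; first exact: filterE.
  apply: filterS (filterI (near1 f) IH) => g [g1 g2] f'.
  by rewrite inE => /predU1P[->//|]; exact: g2.
by apply: filterS (near2 s) => g gs; exact: sO.
Qed.

Lemma rep_bucont (f : U -> R) : roelcke_bucont f -> roelcke_bucont (f \o rep).
Proof.
move=> /roelcke_bucontP[[M fM] fu]; apply/roelcke_bucontP; split.
  by exists M => g /=.
move=> e e0; have [V V1 Ve] := fu e e0; exists (rep @^-1` V); first exact: rep_nbhs1.
have E g u : double_translate (rep @^-1` V) g u -> double_translate V (rep g) (rep u).
  by move=> [a aV [b bV <-]]; exists (rep a) => //; exists (rep b) => //; rewrite !repM.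
by move=> g u v /E uV /E vV; exact: (Ve _ _ _ uV vV).
Qed.

Lemma rep_basis (g : sG) x y :
  re_inner (unitary_fun (rep g) (l2_basis R x)) (l2_basis R y) = (pf g x == y)%:R.
Proof.
have -> : unitary_fun (rep g) (l2_basis R x) = l2_basis R (pf g x) by exact: l2_perm_basis.
by rewrite /re_inner basis_inner; case: eqP.
Qed.

End unitary_representation.

(** * The Ellis compactifications and the closure in [bU] *)

Section models.
Variables (R : realType) (X : discreteTopologicalType) (G : groupClosed (perm_group X)).
Hypothesis Gult : ultratransitive G.
Local Notation H := (l2 R X).
Local Notation sG := (subgroup G).
Local Notation U := (unitary_group R X).
Local Notation aX := (one_point_compactification X).
Local Notation B := (unit_ball R X).
Local Notation rep := (fun g : sG => perm_unitary R (val g : perm_group X) : U).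

Lemma alpha_indicator_continuous (y : X) : continuous (fun q : aX => (q == Some y)%:R : R).
Proof.
apply: locally_constant_continuous => -[x|].
  have : nbhs (Some x : aX) [set Some x : aX].
    suff : nbhs x (Some @^-1` [set Some x : aX]) by [].
    by apply: filterS (discrete_set1 x) => z ->.
  by apply: filterS => q ->.
have : nbhs (None : aX) (Some @` (~` [set y]) `|` [set None]).
  by exists [set y] => //; split; [exact: compact_set1 | exact: discrete_closed].
apply: filterS => q [[x /= xy <-]|-> //].
by case: eqP => // -[/xy].
Qed.

Lemma ellis_alpha_eq : compactification_eq (roelcke sG R)
  (ellis (fun g : sG => alpha_act (val g))).
Proof.
set c := ellis _; pose phi (xy : X * X) (p : c) : R := (set_val p (Some xy.1) == Some xy.2)%:R.
have evc x : continuous (fun p : c => set_val p x : aX).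
  move=> p; pose ev (q : {ptws aX -> aX}) := q x.
  have eva : {for set_val p, continuous ev} := @ptws_eval_continuous _ _ x _.
  exact: (continuous_comp (@set_val_continuous _ _ p) eva).
have phic xy : continuous (phi xy).
  by move=> p; exact: (continuous_comp (evc _ p) (@alpha_indicator_continuous _ _)).
have phiE xy g : phi xy (cmap c g) = (pf g xy.1 == xy.2)%:R.
  by congr ((_ : bool)%:R); apply/eqP/eqP => [[]|<-].
apply: (perm_roelcke_eq Gult (phi := phi)) => //.
- by apply: closure_comp_compact; apply: ptws_compact; exact: one_point_compactification_compact.
- exact: closure_comp_dense.
- move=> p q pq.
  (* The coordinates [phi] test finite arguments only. Infinity is fixed by [G], and by limits as
     well, because finite points are open. *)
  have at_None (r : c) : set_val r None = None.
    case E : (set_val r None) => [y|//].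
    have sN : nbhs (Some y : aX) [set Some y : aX].
      suff : nbhs y (Some @^-1` [set Some y : aX]) by [].
      by apply: filterS (discrete_set1 y) => z ->.
    have : nbhs r [set s : c | set_val s None = Some y].
      have rN : nbhs (set_val r None : aX) [set Some y : aX] by rewrite E.
      exact: (evc None r _ rN).
    by move=> /(dense_nbhs (@closure_comp_dense _ _ _))[g].
  apply: val_inj; apply/funext => -[x|]; last by rewrite [LHS]at_None [RHS]at_None.
  have pqE y : (set_val p (Some x) == Some y) = (set_val q (Some x) == Some y).
    have := pq (x, y); rewrite /phi /=.
    by case: eqP => _; case: eqP => _ // /eqP; rewrite ?oner_eq0// eq_sym oner_eq0.
  (* The value infinity is recognized by the vanishing of all the indicators. *)
  have pqE' : set_val p (Some x) = set_val q (Some x).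
    case Ep : (set_val p (Some x)) => [y|].
      by have := pqE y; rewrite Ep eqxx => /esym/eqP.
    case Eq : (set_val q (Some x)) => [y|//].
    by have := pqE y; rewrite Ep Eq eqxx.
  exact: pqE'.
- move=> xy; have -> : phi xy \o cmap c = fun g : sG => (pf g xy.1 == xy.2)%:R.
    by apply/funext => g; exact: phiE.
  exact: perm_bucont.
- by move=> x y; exists (phi (x, y)); split=> // g; exact: phiE.
Qed.

Lemma l2_basis_ball (x : X) :
  (l2_basis R x : l2_weak R X) \in [set f : l2_weak R X | `|f : H| <= 1].
Proof. by apply: mem_set; rewrite /= normE l2norm_basis. Qed.

Lemma ellis_ball_eq : compactification_eq (roelcke sG R)
  (ellis (fun g : sG => @ball_act R X (val g))).
Proof.
set c := ellis _.
pose phi (fh : B * H) (p : c) : R := re_inner (val (set_val p fh.1 : B) : H) fh.2.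
have phic fh : continuous (phi fh).
  move=> p; pose ev (q : {ptws B -> B}) := q fh.1.
  have eva : {for set_val p, continuous ev} := @ptws_eval_continuous _ _ fh.1 _.
  have evc : {for p, continuous (fun p : c => set_val p fh.1 : B)} :=
    continuous_comp (@set_val_continuous _ _ p) eva.
  have wc : {for set_val p fh.1, continuous (fun b : B => re_inner (val b : H) fh.2)}.
    have := @set_val_continuous _ _ (set_val p fh.1 : B).
    by move=> /(@cvg_weakP R X B _ (fun b : B => val b : H) (val (set_val p fh.1 : B) : H)) /(_ fh.2).
  exact: (continuous_comp evc wc).
have phiE fh g : phi fh (cmap c g) = re_inner (unitary_fun (rep g) (val fh.1 : H)) fh.2.
  by [].
apply: (perm_roelcke_eq Gult (phi := phi)) => //.
- by apply: closure_comp_compact; apply: ptws_compact; exact: unit_ball_compact.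
- exact: closure_comp_dense.
- move=> p q pq; apply: val_inj; apply/funext => f; apply: val_inj.
  by apply: re_inner_eq => h; exact: (pq (f, h)).
- move=> fh; exact: (@rep_bucont R X G _ (unitary_bucont (val fh.1 : H) fh.2)).
- move=> x y; exists (phi (exist _ (l2_basis R x : l2_weak R X) (l2_basis_ball x), l2_basis R y)).
  split=> // g; rewrite phiE; exact: rep_basis.
Qed.

Lemma roelcke_unitary_compact : infinite_set [set: X] -> compact [set: roelcke U R].
Proof.
move=> Xinf; have [cc _ _ _] := contraction_mul_semitop R Xinf.
by have [] := compactification_eq_compactification
  (compactification_eq_sym (unitary_roelcke_eq R Xinf)) cc.
Qed.

(** Points of [bU] are separated by the bounded uniformly continuous functions on [U], which
    restrict to such functions on [G] by [rep_bucont]; pairs of basis vectors give the matrix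
    entries. *)
Lemma closure_unitary_eq : infinite_set [set: X] ->
  compactification_eq (roelcke sG R)
    (closure_comp (fun g : sG => cmap (roelcke U R) (rep g))).
Proof.
move=> Xinf; set c := closure_comp _.
pose phi (f : set_type (@roelcke_bucont R U)) (p : c) : R :=
  set_val (set_val p : roelcke U R) f.
have phic f : continuous (phi f).
  move=> p; exact: (continuous_comp (@set_val_continuous _ _ p)
    (@roelcke_eval_continuous R U f (set_val p))).
have phiE f g : phi f (cmap c g) = set_val f (rep g) by [].
apply: (perm_roelcke_eq Gult (phi := phi)) => //.
- by apply: closure_comp_compact; exact: roelcke_unitary_compact.
- exact: closure_comp_dense.
- by move=> p q pq; apply: val_inj; apply: val_inj; apply/funext.
- by move=> f; exact: (@rep_bucont R X G (set_val f) (set_valP f)).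
- move=> x y; pose i : set_type (@roelcke_bucont R U) :=
    exist (fun f => f \in @roelcke_bucont R U) _
      (mem_set (unitary_bucont (l2_basis R x) (l2_basis R y))).
  exists (phi i); split=> // g; rewrite phiE; exact: rep_basis.
Qed.

End models.

(** * The inverse monoid of partial bijections *)

Section partial_bijections.
Variables (R : realType) (X : discreteTopologicalType) (G : groupClosed (perm_group X)).
Hypotheses (Gult : ultratransitive G) (Xinf : infinite_set [set: X]).
Local Notation sG := (subgroup G).

(** Each clause involves two entries at a time and so survives pointwise limits, unlike being
    everywhere defined or onto. *)
Definition partial_bijection : set {ptws (X * X)%type -> bool} := [set M |
  (forall x y y', M (x, y) -> M (x, y') -> y = y') /\
  (forall x x' y, M (x, y) -> M (x', y) -> x = x')].

Local Notation K := (set_type partial_bijection).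

Definition graph (M : K) x y : bool := set_val M (x, y).

Definition mk_graph (r : X -> X -> bool)
    (rP : partial_bijection (fun xy : X * X => r xy.1 xy.2)) : K :=
  exist _ ((fun xy => r xy.1 xy.2) : {ptws (X * X)%type -> bool}) (mem_set rP).

Lemma graph_fun (M : K) x y y' : graph M x y -> graph M x y' -> y = y'.
Proof. by have [+ _] := set_valP M; apply. Qed.

Lemma graph_inj (M : K) x x' y : graph M x y -> graph M x' y -> x = x'.
Proof. by have [_ +] := set_valP M; apply. Qed.

Lemma graph_eq (M N : K) : (forall x y, graph M x y = graph N x y) -> M = N.
Proof. by move=> MN; apply: val_inj; apply/funext => -[x y]; exact: MN. Qed.

Lemma cvg_graphP (T : Type) (F : set_system T) (w : T -> K) (M : K) : Filter F ->
  w @ F --> M <-> forall x y, \forall t \near F, graph (w t) x y = graph M x y.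
Proof.
move=> FF; have FwF : Filter (w @ F) by exact: fmap_filter.
have Fv : Filter (@set_val _ partial_bijection @ (w @ F)) by exact: fmap_filter.
split=> [/cvg_set_typeP/cvg_ptwsP wM x y|wM].
  exact: (wM (x, y) [set graph M x y] (discrete_set1 _)).
apply/cvg_set_typeP; apply/cvg_ptwsP => -[x y].
exact: ((@cvg_bool T F (fun t => graph (w t) x y) (graph M x y) FF).2 (wM x y)).
Qed.

Lemma nbhs_graph (M : K) x y : nbhs M [set N | graph N x y = graph M x y].
Proof.
have /cvg_graphP : id @ nbhs M --> M by exact: cvg_id.
exact.
Qed.

Lemma graph_continuous (S : topologicalType) (k : S -> K) :
  (forall s x y, \forall s' \near s, graph (k s') x y = graph (k s) x y) ->
  continuous k.
Proof. by move=> kc s; apply/(@cvg_graphP S (nbhs s) k (k s)) => x y; exact: kc. Qed.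

Lemma graph_nbhs (M : K) (O : set K) : nbhs M O -> exists s : seq X, forall N : K,
  (forall x y, x \in s -> y \in s -> graph N x y = graph M x y) -> O N.
Proof.
pose V (s : seq X) := [set N : K |
  forall x y, x \in s -> y \in s -> graph N x y = graph M x y].
have FF : Filter (filter_from [set: seq X] V).
  apply: filter_from_filter; first by exists [::].
  move=> s s' _ _; exists (s ++ s') => // N NV.
  by split=> x y xs ys; apply: NV; rewrite mem_cat ?xs ?ys ?orbT.
have Fc : id @ filter_from [set: seq X] V --> M.
  apply/cvg_graphP => x y; exists [:: x; y] => // N; apply.
    by rewrite mem_head.
  by rewrite !inE eqxx orbT.
by move=> /Fc[s _ sO]; exists s.
Qed.

Lemma partial_bijection_compact : compact [set: K].
Proof.
rewrite compact_ultra => F FU _; have FF : ProperFilter F := @ultra_proper _ _ FU.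
pose r x y := `[< F [set M | graph M x y] >].
have rP : partial_bijection (fun xy : X * X => r xy.1 xy.2).
  split=> [x y y'|x x' y] /asboolP h1 /asboolP h2.
    by have [M [M1 M2]] := filter_ex (filterI h1 h2); exact: graph_fun M1 M2.
  by have [M [M1 M2]] := filter_ex (filterI h1 h2); exact: graph_inj M1 M2.
exists (mk_graph rP); split=> //.
suff : id @ F --> mk_graph rP by [].
apply/cvg_graphP => x y; rewrite -[graph (mk_graph rP) x y]/(r x y) /r.
case: asboolP => [FM|nF]; first by apply: filterS FM => M.
have [//|] := in_ultra_setVsetC [set M | graph M x y] FU.
by apply: filterS => M /= /negP/negbTE.
Qed.

Lemma perm_graphP (g : sG) : partial_bijection (fun xy : X * X => pf g xy.1 == xy.2).
Proof.
by split=> [x y y' /= /eqP <- /eqP|x x' y /= /eqP <- /eqP /pf_inj].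
Qed.

Definition graph_comp : gcompactification sG :=
  @GCompactification sG K (fun g => @mk_graph (fun x y => pf g x == y) (perm_graphP g)).

Lemma graph_cmap (g : sG) x y : graph (cmap graph_comp g) x y = (pf g x == y).
Proof. by []. Qed.

(** A point of [s] without image in [s] is sent to a fresh point outside [s], which leaves the
    entries over [s] unchanged; [index x s] keeps the fresh points distinct, so the finite map is
    injective. *)
Lemma graph_comp_dense : dense (range (@cmap _ graph_comp)).
Proof.
move=> O [M OM] oO; have [s0 sO] := graph_nbhs (open_nbhs_nbhs (conj oO OM)).
pose s := undup s0.
have Xs : infinite_set ([set: X] `\` [set` s]) by exact: infinite_setD.
have [e [ei es]] := infinite_sequence Xs.
have esN n : e n \in s = false by apply/negP => h; have [_] := es n; apply.
pose tau x := if [pick i : 'I_(size s) | graph M x (tnth (in_tuple s) i)] is Some i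
  then tnth (in_tuple s) i else e (index x s).
have tauP x : (tau x \in s /\ graph M x (tau x)) \/
    (tau x = e (index x s) /\ forall y, y \in s -> ~~ graph M x y).
  rewrite /tau; case: pickP => [i Mi|nM]; first by left; split=> //; exact: mem_tnth.
  by right; split=> // y /seq_tnthP[i ->]; rewrite nM.
have taui : {in s &, injective tau}.
  move=> x x' xs xs'; have [[t1 m1]|[t1 m1]] := tauP x; have [[t2 m2]|[t2 m2]] := tauP x'.
  - by move=> tt; apply: (graph_inj m1); rewrite tt.
  - by rewrite t2 => tt; move: t1; rewrite tt esN.
  - by rewrite t1 => tt; move: t2; rewrite -tt esN.
  - by rewrite t1 t2 => /ei /(congr1 (nth x s)); rewrite !nth_index.
have [g gP] := ultratransitive_seq Gult taui.
exists (cmap graph_comp g); split; last by exists g.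
apply: sO => x y; rewrite -!(mem_undup s0) -/s => xs ys.
rewrite graph_cmap gP//; have [[t1 m1]|[t1 m1]] := tauP x.
  by apply/eqP/idP => [<-//|]; exact: graph_fun.
rewrite t1 (negbTE (m1 _ ys)); apply/eqP => ey.
by move: ys; rewrite -ey esN.
Qed.

Lemma graph_comp_eq : compactification_eq (roelcke sG R) graph_comp.
Proof.
pose phi (xy : X * X) (M : graph_comp) : R := (graph M xy.1 xy.2)%:R.
have phic xy : continuous (phi xy).
  apply: locally_constant_continuous => M.
  by apply: filterS (nbhs_graph M xy.1 xy.2) => N; rewrite /phi => ->.
apply: (perm_roelcke_eq Gult (phi := phi)) => //.
- exact: partial_bijection_compact.
- exact: graph_comp_dense.
- move=> M N MN; apply: graph_eq => x y; have := MN (x, y); rewrite /phi /=.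
  by case: (graph M x y); case: (graph N x y) => // /eqP; rewrite ?oner_eq0// eq_sym oner_eq0.
- by move=> xy; exact: perm_bucont.
- by move=> x y; exists (phi (x, y)).
Qed.

Definition graph_mul_rel (M N : K) x z := `[< exists y, graph N x y /\ graph M y z >].

Lemma graph_mulP (M N : K) : partial_bijection (fun xz : X * X => graph_mul_rel M N xz.1 xz.2).
Proof.
split=> [x z z'|x x' z] /asboolP[y [h1 h2]] /asboolP[y' [h3 h4]].
  by rewrite (graph_fun h3 h1) in h4; exact: graph_fun h2 h4.
by rewrite (graph_inj h4 h2) in h3; exact: graph_inj h1 h3.
Qed.

Definition graph_mul (M N : K) : K := @mk_graph (graph_mul_rel M N) (graph_mulP M N).

Lemma graph_mulE (M N : K) x z :
  graph (graph_mul M N) x z <-> exists y, graph N x y /\ graph M y z.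
Proof. by split=> [/asboolP|?] //; apply/asboolP. Qed.

Lemma graph_invP (M : K) : partial_bijection (fun xy : X * X => graph M xy.2 xy.1).
Proof. by split=> [x y y'|x x' y]; [exact: graph_inj | exact: graph_fun]. Qed.

Definition graph_inv (M : K) : K := @mk_graph (fun x y => graph M y x) (graph_invP M).

Lemma graph_invE (M : K) x y : graph (graph_inv M) x y = graph M y x.
Proof. by []. Qed.

Lemma graph_ext (M N : K) : (forall x y, graph M x y <-> graph N x y) -> M = N.
Proof. by move=> MN; apply: graph_eq => x y; apply/idP/idP => /MN. Qed.

Lemma graph_mulA : associative graph_mul.
Proof.
move=> M N V; apply: graph_ext => x w; split.
  move=> /graph_mulE[z [/graph_mulE[y [h1 h2]] h3]].
  by apply/graph_mulE; exists y; split=> //; apply/graph_mulE; exists z.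
move=> /graph_mulE[y [h1 /graph_mulE[z [h2 h3]]]].
by apply/graph_mulE; exists z; split=> //; apply/graph_mulE; exists y.
Qed.

(** A row or column of the fixed factor has at most one 1, so an entry of the product is a single
    entry of the other factor or constantly false. *)
Lemma graph_mul_separate : separately_continuous graph_mul.
Proof.
move=> M; split; apply: graph_continuous => N x z.
  have [[y yz]|nM] := pselect (exists y, graph M y z).
    have E V : graph (graph_mul M V) x z = graph V x y.
      apply/idP/idP => [/graph_mulE[y' [h1 h2]]|h]; last by apply/graph_mulE; exists y.
      by rewrite -(graph_inj h2 yz).
    by apply: filterS (nbhs_graph N x y) => V /= VN; rewrite !E.
  have E V : graph (graph_mul M V) x z = false.
    by apply/negP => /graph_mulE[y [_ h]]; apply: nM; exists y.
  by apply: filterE => V; rewrite !E.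
have [[y xy]|nM] := pselect (exists y, graph M x y).
  have E V : graph (graph_mul V M) x z = graph V y z.
    apply/idP/idP => [/graph_mulE[y' [h1 h2]]|h]; last by apply/graph_mulE; exists y.
    by rewrite -(graph_fun h1 xy).
  by apply: filterS (nbhs_graph N y z) => V /= VN; rewrite !E.
have E V : graph (graph_mul V M) x z = false.
  by apply/negP => /graph_mulE[y [h _]]; apply: nM; exists y.
by apply: filterE => V; rewrite !E.
Qed.

Lemma graph_mul_cmap (g : sG) (M : K) x z :
  graph (graph_mul (cmap graph_comp g) M) x z = graph M x (pf g^-1%g z).
Proof.
apply/idP/idP => [/graph_mulE[y [h1]]|h].
  by rewrite graph_cmap => /eqP <-; rewrite pfK.
by apply/graph_mulE; exists (pf g^-1%g z); split=> //; rewrite graph_cmap pfKV.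
Qed.

Lemma graph_comp_continuous : continuous (@cmap _ graph_comp).
Proof.
apply: graph_continuous => g x y; apply: filterS (nbhs_subgroup g x) => h /= hg.
by rewrite !graph_cmap hg.
Qed.

Lemma graph_comp_morph :
  {morph @cmap _ graph_comp : g h / (g * h)%g >-> graph_mul g h}.
Proof.
move=> g h; apply: graph_eq => x z; rewrite graph_mul_cmap !graph_cmap pfM.
by rewrite -pf_eqV eq_sym.
Qed.

Lemma graph_comp_semitop : semitop_semigroup_comp (c := graph_comp) graph_mul.
Proof.
split; [|exact: graph_mulA|exact: graph_mul_separate|exact: graph_comp_morph].
split; [exact: partial_bijection_compact| |exact: graph_comp_continuous|
  exact: graph_comp_dense].
apply: (@separating_hausdorff R K (X * X)%type (fun xy M => (graph M xy.1 xy.2)%:R)).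
  move=> xy; apply: locally_constant_continuous => M.
  by apply: filterS (nbhs_graph M xy.1 xy.2) => N ->.
move=> M N MN; apply: graph_eq => x y; have := MN (x, y) => /=.
by case: (graph M x y); case: (graph N x y) => // /eqP; rewrite ?oner_eq0// eq_sym oner_eq0.
Qed.

Lemma graph_comp_embedding : is_embedding (@cmap _ graph_comp).
Proof.
split.
  move=> g h gh; apply: pf_eq => x; apply/esym/eqP.
  by rewrite -graph_cmap -gh graph_cmap.
move=> A; split=> [oA|[V oV <-]]; last first.
  by apply: open_comp => // x _; exact: graph_comp_continuous.
(* The union of all open sets with trace inside [A]; only the covering of [A] remains to be
   shown. *)
exists (\bigcup_(V in [set V : set K | open V /\ cmap graph_comp @^-1` V `<=` A]) V).
  by apply: bigcup_open => V [].
apply/seteqP; split=> [g [V [_ VA] /VA]//|g Ag].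
have [s sA] := subgroup_nbhs (open_nbhs_nbhs (conj oA Ag)).
pose W := [set M : K | forall x, x \in s -> graph M x (pf g x)].
have Wg : nbhs (cmap graph_comp g) W.
  rewrite /W; elim: s {sA W} => [|x s IH]; first exact: filterE.
  apply: filterS (filterI (nbhs_graph (cmap graph_comp g) x (pf g x)) IH) => M [h1 h2] y.
  by rewrite inE => /predU1P[->|]; [rewrite h1 graph_cmap eqxx | exact: h2].
move: Wg; rewrite nbhsE => -[V [oV Vg] VW].
exists V => //; split=> // h /VW Wh; apply: sA => x xs; apply/eqP.
by rewrite -graph_cmap; exact: Wh.
Qed.

Lemma graph_comp_sim : is_sim_comp graph_comp.
Proof.
have j1 (M : K) x z : graph (cmap graph_comp 1%g) x z = (x == z) by [].
exists graph_mul, graph_inv; split.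
- split; [exact: graph_comp_semitop| |exact: graph_comp_embedding|].
    split=> M; apply: graph_ext => x z; split.
    + by move=> /graph_mulE[y [h]]; rewrite graph_cmap => /eqP <-.
    + by move=> h; apply/graph_mulE; exists z; rewrite graph_cmap.
    + by move=> /graph_mulE[y []]; rewrite graph_cmap => /eqP <-.
    + by move=> h; apply/graph_mulE; exists x; rewrite graph_cmap eqxx.
  exists (fun g => graph_mul (cmap graph_comp g)); split.
  + by move=> M; apply: graph_eq => x z; rewrite graph_mul_cmap (pfK (1%g : sG) z : pf _ z = z).
  + by move=> g h M; rewrite graph_mulA -graph_comp_morph.
  + apply: graph_continuous => -[g M] x z /=.
    (* The translate by [g] has at [z] the entry of [M] at [g^-1 z], and every [h] sending [g^-1 z]
       to [z] has the same preimage of [z]. *)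
    exists ([set h | pf h (pf g^-1%g z) = pf g (pf g^-1%g z)],
            [set N | graph N x (pf g^-1%g z) = graph M x (pf g^-1%g z)]).
      by split; [exact: nbhs_subgroup | exact: nbhs_graph].
    move=> [h N] [/= hg NM]; rewrite !graph_mul_cmap.
    by rewrite -NM; congr (graph N x _); rewrite -{1}(pfKV g z) -hg pfK.
  + by move=> g h; rewrite graph_comp_morph.
- move=> M; split; apply: graph_ext => x z; split.
  + move=> /graph_mulE[y [h1 /graph_mulE[w [h2 h3]]]].
    by rewrite graph_invE in h2; rewrite (graph_inj h1 h2).
  + move=> h; apply/graph_mulE; exists z; split=> //; apply/graph_mulE; exists x.
    by rewrite graph_invE.
  + move=> /graph_mulE[y [h1 /graph_mulE[w [h2 h3]]]].
    by rewrite graph_invE in h1; rewrite graph_invE (graph_fun h1 h2) -graph_invE.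
  + move=> h; apply/graph_mulE; exists z; split=> //; apply/graph_mulE; exists x.
    by rewrite graph_invE -graph_invE.
(* An edge of [N] factors through [N M N]. Since edges are determined by either end, the outer two
   are the edge itself and the middle one is its reverse in [M]. *)
- move=> M N MNM NMN; apply: graph_ext => y x; rewrite graph_invE; split=> h.
    have := h; rewrite -{1}NMN => /graph_mulE[x1 [h1 /graph_mulE[y1 [h2 h3]]]].
    rewrite (graph_fun h1 h) in h2.
    by rewrite -(graph_inj h3 h).
  have := h; rewrite -{1}MNM => /graph_mulE[y1 [h1 /graph_mulE[x1 [h2 h3]]]].
  rewrite (graph_fun h1 h) in h2.
  by rewrite -(graph_inj h3 h).
- apply: graph_continuous => M x y.
  by apply: filterS (nbhs_graph M y x) => N; rewrite !graph_invE.
- by move=> g; apply: graph_eq => x y; rewrite graph_invE !graph_cmap pf_eqV eq_sym.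
Qed.

End partial_bijections.

Theorem corollary4p10 (R : realType) (X : discreteTopologicalType)
    (G : groupClosed (perm_group X)) :
  infinite_set [set: X] -> ultratransitive G ->
  let bG := roelcke (subgroup G) R in
  let bU := roelcke (unitary_group R X) R in
  (* b_r G = e_{alpha X} G = e_B G *)
  (compactification_eq bG (ellis (fun g : subgroup G => alpha_act (val g))) /\
   compactification_eq bG
     (ellis (fun g : subgroup G => @ball_act R X (val g)))) /\
  (* b_r G is the closure of G in b_r U, which is the space of contractions
     in the weak operator topology and the WAP-compactification of U *)
  [/\ compactification_eq bG
        (closure_comp
           (fun g : subgroup G => cmap bU (perm_unitary R (val g)))),
      compactification_eq bU (contraction_comp R X) &
      is_WAP_comp bU] /\
  [/\ is_sim_comp bG, is_WAP_comp bG & WAP_group (subgroup G) R].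
Proof.
move=> Xinf Gult bG bU.
have bGK := compactification_eq_sym (graph_comp_eq R Gult Xinf).
have wap : is_WAP_comp bG := roelcke_is_WAP bGK (graph_comp_semitop R Gult Xinf).
split; first by split; [exact: ellis_alpha_eq | exact: ellis_ball_eq].
split; first split.
- exact: closure_unitary_eq.
- exact: unitary_roelcke_eq.
- exact: unitary_is_WAP.
split=> //; first exact: is_sim_comp_transport bGK (graph_comp_sim R Gult Xinf).
by exists bG => //; exact: compactification_eq_refl.
Qed.
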